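(* Let $0<\alpha<1$ and $k\in\mathbb R$, and let $g_{\alpha,k}=\varphi_{\alpha,k}^{-2}g_{\mathbb S^2}+\varphi_{\alpha,k}^2d\xi^2$ be the metric on $\mathbb S^2\times\mathbb S^1$ constructed in the context, with $\Gamma=\{p\}\times\mathbb S^1$. Then: (1) $g_{\alpha,k}$ is a well-defined $C^{1,\alpha}$ Riemannian metric on $\mathbb S^2\times\mathbb S^1$; (2) $g_{\alpha,k}$ is smooth on $(\mathbb S^2\times\mathbb S^1)\setminus\Gamma$; (3) the scalar curvature satisfies $\mathrm{Scalar}_{g_{\alpha,k}}\ge\frac58$ on $(\mathbb S^2\times\mathbb S^1)\setminus\Gamma$.
   Context: Construction of $g_{\alpha,k}$. Let $b\in C^\infty(\mathbb R)$ with $b(x)=0$ for $x\le\frac12$, $b(x)=1$ for $x\ge1$, $0\le b\le1$, $|b'|\le10$, $|b''|\le100$. Define $\psi_\alpha:[-1,1]^2\to\mathbb R$ by $$\psi_\alpha(r,\theta)=|r\theta|\,b\Big(\frac{|\theta|}{|r|^{1/\alpha}}\Big)b\Big(\frac{|r|}{|\theta|^{1/\alpha}}\Big)\ \text{ if } r\theta\ne0,\qquad \psi_\alpha(r,\theta)=0\ \text{ if } r\theta=0.$$ Let $\chi\in C_c^\infty(\mathbb R^2)$ with $0\le\chi\le1$, $\chi\equiv1$ on $[-1,1]^2$ and $\chi\equiv0$ outside $[-2,2]^2$; for $\rho>0$ put $\chi_\rho(r,\theta)=\chi(r/\rho,\theta/\rho)$. Set $$\rho_*=\min\Big\{\tfrac14,\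 \tfrac1{4(1+|k|)},\ \tfrac{1}{4(1+|k|)(15+\frac{10}\alpha)\sqrt{1+\sec^2(1/2)}}\Big\}.$$ Let $p\in\mathbb S^2$ and choose local coordinates $(r,\theta)$ centered at $p$ such that the round metric is $g_{\mathbb S^2}=dr^2+\cos^2r\,d\theta^2$ in a neighborhood of $(0,0)$. Let $\varphi_{\alpha,k}=1+k\,\chi_{\rho_*}\psi_\alpha$, extended by $1$ outside the support of $\chi_{\rho_*}$, and $g_{\alpha,k}=\varphi_{\alpha,k}^{-2}g_{\mathbb S^2}+\varphi_{\alpha,k}^2d\xi^2$, where $\xi$ is the coordinate on $\mathbb S^1$.
   Formalization: Part (3) additionally assumes that the partial derivatives of χ are at most 2 in absolute value (for arbitrarily steep χ the bound 5/8 fails); the coordinates (r,θ) are assumed defined on [-2ρ_*,2ρ_*]², which contains the support of χ_{ρ_*}. *)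

(* Defs.v *)
From HB Require Import structures.
From mathcomp Require Import all_boot all_order all_algebra.
From mathcomp Require Import all_classical all_reals all_analysis.

Set Implicit Arguments.
Unset Strict Implicit.
Unset Printing Implicit Defensive.

Import Order.TTheory GRing.Theory Num.Theory.
Import numFieldNormedType.Exports.

Local Open Scope classical_set_scope.
Local Open Scope ring_scope.

(* Calculus on open subsets of R^n. *)

Definition partial (R : realType) (n : nat) (i : 'I_n) (f : 'rV[R]_n -> R)
  : 'rV[R]_n -> R := fun u => 'D_(delta_mx 0 i) f u.

(* [f] is C^m on the open set [D]: its iterated partial derivatives up to
   order [m] exist and are continuous on [D]. *)
Fixpoint Ck_on (R : realType) (n m : nat) (D : set 'rV[R]_n)
    (f : 'rV[R]_n -> R) {struct m} : Prop :=
  (forall u, D u -> {for u, continuous f}) /\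
  match m with
  | 0 => True
  | m'.+1 => forall i : 'I_n,
      (forall u, D u -> derivable f u (delta_mx 0 i)) /\
      Ck_on m' D (partial i f)
  end.

Definition smooth_on (R : realType) (n : nat) (D : set 'rV[R]_n)
  (f : 'rV[R]_n -> R) : Prop := forall m, Ck_on m D f.

(* C^{1,alpha} in the local sense, the usual one in the charts of a manifold. *)
Definition C1holder_on (R : realType) (n : nat) (alpha : R)
    (D : set 'rV[R]_n) (f : 'rV[R]_n -> R) : Prop :=
  Ck_on 1 D f /\
  forall (i : 'I_n) u, D u ->
    exists (C : R) (V : set 'rV[R]_n), nbhs u V /\
      forall v w, V v -> V w ->
        `|partial i f v - partial i f w| <= C * `|v - w| `^ alpha.

(* Curvature of a metric given in coordinates by a field [G] of n x n matrices,
   with R^l_{kij} = d_i Gamma^l_{jk} - d_j Gamma^l_{ik} + ... and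
   Ric_{kj} = R^l_{klj}, so that round spheres have positive curvature. *)

Definition christoffel (R : realType) (n : nat) (G : 'rV[R]_n -> 'M[R]_n)
    (k i j : 'I_n) (u : 'rV[R]_n) : R :=
  2^-1 * \sum_(l < n) invmx (G u) k l *
    (partial i (fun v => G v j l) u + partial j (fun v => G v i l) u
     - partial l (fun v => G v i j) u).

Definition riemann (R : realType) (n : nat) (G : 'rV[R]_n -> 'M[R]_n)
    (l k i j : 'I_n) (u : 'rV[R]_n) : R :=
  partial i (christoffel G l j k) u - partial j (christoffel G l i k) u
  + \sum_(m < n) (christoffel G l i m u * christoffel G m j k u
                  - christoffel G l j m u * christoffel G m i k u).

Definition ricci (R : realType) (n : nat) (G : 'rV[R]_n -> 'M[R]_n)
    (k j : 'I_n) (u : 'rV[R]_n) : R :=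
  \sum_(l < n) riemann G l k l j u.

Definition scalar_curvature (R : realType) (n : nat)
    (G : 'rV[R]_n -> 'M[R]_n) (u : 'rV[R]_n) : R :=
  \sum_(k < n) \sum_(j < n) invmx (G u) k j * ricci G k j u.

(* The manifold S^2 x S^1 in R^3 x R^2. *)

Definition dotp (R : realType) (n : nat) (v w : 'rV[R]_n) : R :=
  \sum_(i < n) v 0 i * w 0 i.

Definition sphere (R : realType) (n : nat) : set 'rV[R]_n.+1 :=
  [set q | dotp q q = 1].

Notation ambient R := ('rV[R]_3 * 'rV[R]_2)%type.

Definition S2xS1 (R : realType) : set (ambient R) :=
  [set q | sphere q.1 /\ sphere q.2].

Definition tangent (R : realType) (q : ambient R) : set (ambient R) :=
  [set v | dotp q.1 v.1 = 0 /\ dotp q.2 v.2 = 0].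

(* The smooth structure is given by the atlas of all product charts made of the
   spherical coordinates of an orthonormal frame of R^3 (the rows of the
   orthogonal matrix [Q]) and the angle on S^1 (restricted to the interval of
   length 2 pi centered at [xi0]). *)

Definition spherical (R : realType) (Q : 'M[R]_3) (r t : R) : 'rV[R]_3 :=
  (\row_(i < 3) [:: cos r * cos t; cos r * sin t; sin r]`_i) *m Q.

Definition chart (R : realType) (Q : 'M[R]_3) (u : 'rV[R]_3) : ambient R :=
  (spherical Q (u 0 0) (u 0 1), \row_(i < 2) [:: cos (u 0 2); sin (u 0 2)]`_i).

Definition chart_dom (R : realType) (xi0 : R) : set 'rV[R]_3 :=
  [set u | [/\ `|u 0 0| < pi / 2, `|u 0 1| < pi & `|u 0 2 - xi0| < pi]].

Definition orthogonal_mx (R : realType) (n : nat) (Q : 'M[R]_n) : Prop :=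
  Q *m Q^T = 1%:M.

(* A metric assigns to a point [q] a form [g q] on pairs of vectors, only
   meaningful for [q] on S^2 x S^1 and vectors tangent at [q]. *)
Notation metric R := (ambient R -> ambient R -> ambient R -> R).

Definition chart_vector (R : realType) (Q : 'M[R]_3) (u : 'rV[R]_3)
    (i : 'I_3) : ambient R := 'D_(delta_mx 0 i) (chart Q) u.

Definition components (R : realType) (g : metric R) (Q : 'M[R]_3)
    (u : 'rV[R]_3) : 'M[R]_3 :=
  \matrix_(i, j) g (chart Q u) (chart_vector Q u i) (chart_vector Q u j).

Definition riemannian (R : realType) (g : metric R) : Prop :=
  forall q, S2xS1 q ->
  [/\ forall v w, tangent q v -> tangent q w -> g q v w = g q w v,
      forall (a : R) v v' w, tangent q v -> tangent q v' -> tangent q w ->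
        g q (a *: v + v') w = a * g q v w + g q v' w
    & forall v, tangent q v -> v != 0 -> 0 < g q v v].

Definition C1holder_metric (R : realType) (alpha : R) (g : metric R) : Prop :=
  forall (Q : 'M[R]_3) (xi0 : R), orthogonal_mx Q -> forall i j : 'I_3,
    C1holder_on alpha (chart_dom xi0) (fun u => components g Q u i j).

(* [A] is meant to be open in S^2 x S^1. *)
Definition smooth_metric_on (R : realType) (A : set (ambient R))
    (g : metric R) : Prop :=
  forall (Q : 'M[R]_3) (xi0 : R), orthogonal_mx Q -> forall i j : 'I_3,
    smooth_on (chart_dom xi0 `&` chart Q @^-1` A)
      (fun u => components g Q u i j).

Definition scalar_ge_on (R : realType) (A : set (ambient R)) (g : metric R)
    (c : R) : Prop :=
  forall (Q : 'M[R]_3) (xi0 : R), orthogonal_mx Q ->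
    forall u, chart_dom xi0 u -> A (chart Q u) ->
      c <= scalar_curvature (components g Q) u.

(* The construction of g_{alpha,k}. *)

Definition square (R : realType) (a : R) : set 'rV[R]_2 :=
  [set u | forall i, `|u 0 i| <= a].

Definition step_profile (R : realType) (b : R -> R) : Prop :=
  (forall n x, derivable (derive1n n b) x 1) /\
  [/\ forall x, x <= 2^-1 -> b x = 0,
      forall x, 1 <= x -> b x = 1,
      forall x, 0 <= b x <= 1,
      forall x, `|derive1 b x| <= 10
    & forall x, `|derive1n 2 b x| <= 100].

Definition cutoff (R : realType) (chi : 'rV[R]_2 -> R) : Prop :=
  smooth_on setT chi /\
  [/\ forall u, 0 <= chi u <= 1,
      forall u, square 1 u -> chi u = 1
    & forall u, ~ square 2 u -> chi u = 0].

Definition psi (R : realType) (alpha : R) (b : R -> R) (u : 'rV[R]_2) : R :=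
  let r := u 0 0 in let t := u 0 1 in
  if r * t == 0 then 0
  else `|r * t| * b (`|t| / `|r| `^ alpha^-1) * b (`|r| / `|t| `^ alpha^-1).

Definition dilate (R : realType) (rho : R) (chi : 'rV[R]_2 -> R)
  : 'rV[R]_2 -> R := fun u => chi (rho^-1 *: u).

Definition rho_star (R : realType) (alpha k : R) : R :=
  Num.min (1 / 4) (Num.min (1 / (4 * (1 + `|k|)))
    (1 / (4 * (1 + `|k|) * (15 + 10 / alpha)
          * Num.sqrt (1 + (cos (1 / 2)) ^- 2)))).

(* Local coordinates (r, theta) of S^2 centered at [p], given by the inverse
   parametrization [x : U -> S^2], in which the round metric is
   dr^2 + cos^2 r dtheta^2. *)
Definition round_coordinates (R : realType) (p : 'rV[R]_3) (U : set 'rV[R]_2)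
    (x : 'rV[R]_2 -> 'rV[R]_3) : Prop :=
  [/\ open U, U 0 & x 0 = p] /\
  [/\ forall u, U u -> sphere (x u),
      forall u v, U u -> U v -> x u = x v -> u = v,
      forall i : 'I_3, smooth_on U (fun u => x u 0 i),
      forall u, U u -> row_free ('J x u)
    & forall u, U u ->
        let dr := 'D_(delta_mx 0 0) x u in
        let dt := 'D_(delta_mx 0 1) x u in
        [/\ dotp dr dr = 1, dotp dr dt = 0 & dotp dt dt = cos (u 0 0) ^+ 2]].

(* phi_{alpha,k} read in the coordinates (r, theta). *)
Definition phi_loc (R : realType) (alpha k : R) (b : R -> R)
    (chi : 'rV[R]_2 -> R) (u : 'rV[R]_2) : R :=
  1 + k * dilate (rho_star alpha k) chi u * psi alpha b u.

Definition phi (R : realType) (alpha k : R) (b : R -> R)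
    (chi : 'rV[R]_2 -> R) (U : set 'rV[R]_2) (x : 'rV[R]_2 -> 'rV[R]_3)
    (q : 'rV[R]_3) : R :=
  if q \in x @` U then phi_loc alpha k b chi (pinv U x q) else 1.

(* f^-2 g_{S^2} + f^2 dxi^2, where dxi^2 is the Euclidean metric of R^2
   restricted to the unit circle, xi being the angle. *)
Definition twisted_metric (R : realType) (f : 'rV[R]_3 -> R) : metric R :=
  fun q v w => f q.1 ^- 2 * dotp v.1 w.1 + f q.1 ^+ 2 * dotp v.2 w.2.

(* Main.v *)
Require Import Defs.
From HB Require Import structures.
From mathcomp Require Import all_boot all_order all_algebra.
From mathcomp Require Import all_classical all_reals all_analysis.
From mathcomp Require Import ring lra.

Set Implicit Arguments.
Unset Strict Implicit.
Unset Printing Implicit Defensive.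

Import Order.TTheory GRing.Theory Num.Theory.
Import numFieldNormedType.Exports.

Local Open Scope classical_set_scope.
Local Open Scope ring_scope.

(* On an open subset of S^2 where phi is smooth, the scalar curvature of
   phi^-2 g_{S^2} + phi^2 dxi^2 is 2 phi^2 - 2 |grad phi|^2, the gradient being
   taken in the round metric: the second derivatives of phi cancel. As
   |phi - 1| <= 1/4, and as |d_i psi| <= (11 + 10/alpha) |u_{1-i}| together with
   the choice of rho_* gives |grad phi|^2 <= 1/4, this is at least
   2 (9/16) - 2 (1/4) = 5/8.

   Near the axes psi vanishes, and away from the origin it is smooth. Writing its
   derivatives with the Euler operator x d/dx, which keeps derivatives of b
   bounded, one gets |d_i psi| <= C |u_{1-i}|, a bounded derivative of d_i psi in
   the direction 1-i, and a derivative of size |u_{1-i}|^(1 - 1/alpha) in the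
   direction i, on the region |u_i| >= |u_{1-i}|^(1/alpha) / 2; interpolating
   these bounds gives that d_i psi is alpha-Hoelder.

   A parametrization x in which the round metric is dr^2 + cos^2 r dt^2 satisfies
   the moving frame equations of the sphere, which can be integrated along the
   coordinate lines: x is the spherical coordinate map of an orthonormal frame.
   Hence phi pulls back smoothly to every chart through latitude and longitude. *)

(** * Directional derivatives *)

(** The cancellation is special to these exponents. With Delta and grad those of the round metric,
    the conformal factor phi^-2 contributes 2 phi^2 (1 + Delta log phi) in dimension two, the
    warping factor phi contributes - 2 phi Delta phi, and 2 phi^2 Delta log phi = 2 phi Delta phi -
    2 |grad phi|^2. So the curvature is bounded below without any bound on the second derivatives of
    phi near p.

    In rho_*, 15 = 11 + 4: the cutoff contributes rho^-1 |d_i chi| |psi| <= 4 |u_{1-i}| when |d_i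
    chi| <= 2 and |u_i| <= 2 rho. As rho_* <= 1/4, the support lies in |r| <= 1/2, where 1 / cos^2 r
    <= sec^2(1/2).

    The obstacle is that (r, theta) are given abstractly, while regularity and curvature are tested
    in the charts of every orthonormal frame. Rigidity makes x explicit; since the spherical
    coordinates are inverted smoothly only on a half sphere, each chart is covered by two open sets,
    one where this inverse exists and one where phi is 1. *)

Section Directional.
Context {R : realType} {V : normedModType R}.
Implicit Types (f : V -> R) (g : R -> R) (u v : V).

(** Carries the one-variable mean value theorem and chain rule over to directional derivatives; the
    base point [h *: v + u] is general because the mean value theorem visits a whole segment. *)
Lemma is_derive_lineP (W : normedModType R) (f : V -> W) u v h d :
  is_derive (h *: v + u) v f d <-> is_derive h 1 (fun s : R => f (s *: v + u)) d.
Proof.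
have E : (fun s : R => s^-1 *: ((f \o shift (h *: v + u)) (s *: v) - f (h *: v + u)))
  = (fun s : R => s^-1 *: (((fun s : R => f (s *: v + u)) \o shift h) (s *: 1)
       - f (h *: v + u))).
  by apply/funext => s /=; rewrite [s%:A]mulr1 scalerDl addrA.
by split=> -[D <-]; split; rewrite /derivable /derive ?E// -E.
Qed.

Lemma is_derive_line (W : normedModType R) (f : V -> W) u v d :
  is_derive u v f d -> is_derive (0 : R) 1 (fun s : R => f (s *: v + u)) d.
Proof. by move=> H; apply/is_derive_lineP; rewrite scale0r add0r. Qed.

(** On the line through [u] along [v] this is the one-variable chain rule, so a single directional
    derivative of [f] suffices. *)
Lemma is_derive_comp1 f g u v df dg :
  is_derive u v f df -> is_derive (f u) 1 g dg ->
  is_derive u v (g \o f) (dg * df).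
Proof.
move=> /is_derive_line Hf Hg.
rewrite -[u]add0r -(scale0r v); apply/is_derive_lineP.
have Hg' : is_derive ((fun s : R => f (s *: v + u)) 0) 1 g dg.
  by rewrite scale0r add0r.
have := is_derive1_comp Hg' Hf.
by rewrite mulrC.
Qed.

Lemma is_derive_ext f f' u v d : is_derive u v f d -> f =1 f' -> is_derive u v f' d.
Proof. by move=> H /funext <-. Qed.

Lemma is_derive_near f f' u v d (A : set V) :
  open A -> A u -> (forall w, A w -> f w = f' w) ->
  is_derive u v f d -> is_derive u v f' d.
Proof.
move=> oA Au E; apply: near_eq_is_derive.
by apply: filterS (open_nbhs_nbhs (conj oA Au)) => w /E.
Qed.

Lemma is_derive_mul f f' u v d d' : is_derive u v f d -> is_derive u v f' d' ->
  is_derive u v (fun w => f w * f' w) (d * f' u + f u * d').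
Proof.
move=> H H'; have := is_deriveM H H' => H2.
apply: is_derive_eq H2 _.
by rewrite -![_ *: _]/(_ * _) addrC [f' u * _]mulrC.
Qed.

Lemma is_derive_inv f u v d : f u != 0 -> is_derive u v f d ->
  is_derive u v (fun w => (f w)^-1) (- (f u)^-2 * d).
Proof.
move=> f0 [H1 H2]; split; first exact: derivableV.
by rewrite deriveV // H2.
Qed.

End Directional.

Lemma is_derive_coord (R : realType) (m n : nat) (u v : 'M[R]_(m, n)) i j :
  is_derive u v (fun w : 'M[R]_(m, n) => w i j) (v i j).
Proof.
have D : derivable (fun w : 'M[R]_(m, n) => w) u v by exact: derivable_id.
split; first by move/derivable_mxP: D; exact.
have := derive_mx D; rewrite derive_id.
by move/matrixP => /(_ i j); rewrite mxE.
Qed.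

Lemma rV_ballP (R : realType) (n : nat) (u v : 'rV[R]_n) e :
  0 < e -> (ball u e v <-> forall i, `|v 0 i - u 0 i| < e).
Proof.
move=> e0; split=> [[_ H] i|H].
  by have := H 0 i; rewrite -ball_normE /= distrC.
split=> // i j; rewrite -ball_normE /= distrC.
by rewrite [i]ord1.
Qed.

Lemma rV_norm_le (R : realType) (n : nat) (u : 'rV[R]_n) e :
  0 <= e -> (forall i, `|u 0 i| <= e) -> `|u| <= e.
Proof.
move=> e0 H; rewrite [leLHS]/Num.Def.normr/= mx_normrE (bigmax_le _ e0)//= => -[i j] _.
by rewrite /= [i]ord1.
Qed.

Lemma rV_coord_le (R : realType) (n : nat) (u : 'rV[R]_n) i : `|u 0 i| <= `|u|.
Proof.
rewrite [leRHS]/Num.Def.normr/= mx_normrE.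
exact: (le_bigmax _ (fun p => `|u p.1 p.2|) (0, i)).
Qed.

(** * Mean value theorem, and differentiability from continuous partial derivatives *)

Section MeanValue.
Context {R : realType} {V : normedModType R}.
Implicit Types (f : V -> R) (u v : V).

Lemma is_derive_scale_dir f u v (a d : R) :
  is_derive u v f d -> is_derive u (a *: v) f (a * d).
Proof.
move=> H; rewrite -[u]add0r -(scale0r (a *: v)); apply/is_derive_lineP.
have -> : (fun s : R => f (s *: (a *: v) + u)) =
    (fun s => f (s *: v + u)) \o (fun s => a * s).
  by apply/funext => s /=; rewrite scalerA mulrC.
have H1 : is_derive (0 : R) 1 (fun s : R => a * s) a.
  by apply: is_derive_eq; rewrite -[LHS]/(_ * _) mulr1.
have H2 : is_derive (a * 0) 1 (fun s : R => f (s *: v + u)) d.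
  by rewrite mulr0; apply: is_derive_line.
by apply: is_derive_eq (is_derive1_comp H2 H1) _; rewrite mulrC.
Qed.

Lemma mean_value_segment f u v (df : R -> R) :
  (forall t : R, 0 <= t <= 1 -> is_derive (t *: v + u) v f (df t)) ->
  exists2 t : R, 0 <= t <= 1 & f (v + u) - f u = df t.
Proof.
move=> H.
have H' (t : R) : 0 <= t <= 1 -> is_derive t 1 (fun s : R => f (s *: v + u)) (df t).
  by move=> /H; move/is_derive_lineP.
have [||t] := @MVT_segment R (fun s => f (s *: v + u)) df 0 1 ler01.
- by move=> x; rewrite in_itv /= => /andP[x0 x1]; apply: H'; rewrite !ltW.
- apply: derivable_within_continuous => x; rewrite in_itv /= => x01.
  by case: (H' x x01).
rewrite in_itv /= scale1r scale0r add0r subr0 mulr1 => t01 E.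
by exists t.
Qed.

End MeanValue.

Lemma convex_combination_lt (R : realFieldType) (t p q r : R) :
  0 <= t <= 1 -> `|p| < r -> `|q| < r -> `|t * p + (1 - t) * q| < r.
Proof.
move=> /andP[t0 t1] pr qr; apply: (le_lt_trans (ler_normD _ _)).
rewrite !normrM (ger0_norm t0) (@ger0_norm _ (1 - t)) ?subr_ge0 //.
have [->|tn1] := eqVneq t 1; first by rewrite subrr mul0r addr0 mul1r.
have : 0 < 1 - t by rewrite subr_gt0 lt_neqAle tn1.
nra.
Qed.

Section Box.
Context {R : realType} {n : nat}.
Implicit Types (f : 'rV[R]_n -> R) (u v w : 'rV[R]_n).

(* The sup-norm ball is a box, hence two of its points are joined inside it by
   a path along the coordinate axes. *)
Lemma box_increment f (c : 'I_n -> R) (df : 'I_n -> 'rV[R]_n -> R) u (r e : R) :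
  0 < r ->
  (forall i w, ball u r w ->
    is_derive w (delta_mx 0 i) f (df i w) /\ `|df i w - c i| <= e) ->
  forall v w, ball u r v -> ball u r w ->
    `|f v - f w - \sum_(i < n) c i * (v 0 i - w 0 i)| <= n%:R * e * `|v - w|.
Proof.
move=> r0 H v w Bv Bw.
(* [z j] takes its first [j] coordinates from [v] and the others from [w], so consecutive points
   differ in one coordinate. *)
pose z (j : nat) : 'rV[R]_n := \row_i (if (i < j)%N then v 0 i else w 0 i).
have z0 : z 0%N = w by apply/rowP => i; rewrite mxE.
have zn : z n = v by apply/rowP => i; rewrite mxE ltn_ord.
(* Subtracting the linear part travelled so far lets the claim telescope into [n] one-dimensional
   increments. *)
pose F j := f (z j) - \sum_(i < n | (i < j)%N) c i * (v 0 i - w 0 i).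
have -> : f v - f w - \sum_(i < n) c i * (v 0 i - w 0 i) = F n - F 0%N.
  rewrite /F zn z0 [X in _ = _ - (f w - X)]big1 ?subr0; last by move=> i.
  rewrite (eq_bigl (fun i : 'I_n => (i < n)%N)); last by move=> i; rewrite ltn_ord.
  by rewrite addrAC.
suff S j : (j <= n)%N -> `|F j - F 0%N| <= j%:R * e * `|v - w| by exact: S.
elim: j => [_|j IH jn]; first by rewrite subrr normr0 !mul0r.
have {IH} := IH (ltnW jn).
pose o := Ordinal jn.
suff S1 : `|F j.+1 - F j| <= e * `|v - w|.
  move=> IH; rewrite -(subrKA (F j)); apply: (le_trans (ler_normD _ _)).
  by rewrite -natr1 mulrDl mulrDl mul1r [leRHS]addrC lerD.
pose a := v 0 o - w 0 o.
have zS : z j.+1 = a *: delta_mx 0 o + z j.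
  apply/rowP => i; rewrite !mxE /= ltnS.
  case: (ltngtP i j) => [ij|ij|ij].
  - by rewrite -val_eqE /= (ltn_eqF ij) mulr0 add0r.
  - by rewrite -val_eqE /= (gtn_eqF ij) mulr0 add0r.
  - have -> : i = o by apply/val_inj.
    by rewrite eqxx mulr1 /a subrK.
have inB (t : R) : 0 <= t <= 1 -> ball u r (t *: (a *: delta_mx 0 o) + z j).
  move=> t01; apply/rV_ballP => // i.
  have Bv' := (rV_ballP u v r0).1 Bv; have Bw' := (rV_ballP u w r0).1 Bw.
  rewrite !mxE /=; have [->|io] := eqVneq i o; last first.
    by rewrite !mulr0 add0r; case: ifP.
  rewrite ltnn mulr1 /a.
  have -> : t * (v 0 o - w 0 o) + w 0 o - u 0 o =
    t * (v 0 o - u 0 o) + (1 - t) * (w 0 o - u 0 o) by ring.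
  exact: convex_combination_lt.
have /= [t t01] := @mean_value_segment R _ f (z j) (a *: delta_mx 0 o)
  (fun t : R => a * df o (t *: (a *: delta_mx 0 o) + z j))
  (fun t t01 => is_derive_scale_dir a (H o _ (inB t t01)).1).
rewrite -zS => E.
have -> : F j.+1 - F j = a * (df o (t *: (a *: delta_mx 0 o) + z j) - c o).
  rewrite /F (bigD1 o) //= (eq_bigl (fun i : 'I_n => (i < j)%N)); last first.
    move=> i; rewrite ltnS -val_eqE /=; case: ltngtP => //.
  rewrite [RHS]mulrBr -E /a; ring.
rewrite normrM mulrC; apply: ler_pM => //; first exact: (H o _ (inB t t01)).2.
by have := rV_coord_le (v - w) o; rewrite !mxE.
Qed.

End Box.

Section Differentiability.
Context {R : realType} {n : nat}.
Implicit Types (f : 'rV[R]_n -> R) (u v w : 'rV[R]_n).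

Lemma near_exists_ball (T : pseudoMetricType R) (P : T -> Prop) (u : T) :
  (\forall w \near u, P w) -> exists2 r : R, 0 < r & forall w : T, ball u r w -> P w.
Proof. by move=> /nbhs_ballP[r r0 H]; exists r. Qed.

Lemma partials_near f (df : 'I_n -> 'rV[R]_n -> R) (D : set 'rV[R]_n) u (e : R) :
  open D -> D u -> (forall i w, D w -> is_derive w (delta_mx 0 i) f (df i w)) ->
  (forall i, {for u, continuous (df i)}) -> 0 < e ->
  exists2 r : R, 0 < r & forall i w, ball u r w ->
    is_derive w (delta_mx 0 i) f (df i w) /\ `|df i w - df i u| <= e.
Proof.
move=> oD Du H C e0.
have [r r0 Hr] : exists2 r : R, 0 < r & forall w, ball u r w ->
    D w /\ forall i, `|df i w - df i u| <= e.
  apply: near_exists_ball; near=> w; split; first by near: w; exact: open_nbhs_nbhs.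
  near: w; apply: filter_forall => i.
  have /cvgrPdist_le /(_ e e0) := C i.
  by apply: filterS => w; rewrite distrC.
by exists r => // i w /Hr[Dw Hw]; split; [exact: H|exact: Hw].
Unshelve. all: by end_near. Qed.

Lemma differentiable_of_partials f (df : 'I_n -> 'rV[R]_n -> R)
    (D : set 'rV[R]_n) u :
  open D -> D u -> (forall i w, D w -> is_derive w (delta_mx 0 i) f (df i w)) ->
  (forall i, {for u, continuous (df i)}) -> differentiable f u.
Proof.
move=> oD Du H C.
pose c i := df i u.
pose L (v : 'rV[R]_n) : R := \sum_(i < n) c i * v 0 i.
have Llin : linear L.
  move=> a v w; rewrite -[a *: L v]/(a * L v) /L mulr_sumr -big_split /=.
  by apply: eq_bigr => i _; rewrite !mxE; ring.
pose LL := GRing.isLinear.Build R 'rV[R]_n R *%R L Llin.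
pose Lh : {linear 'rV[R]_n -> R} := HB.pack L LL.
have LE v : Lh v = \sum_(i < n) c i * v 0 i by [].
have Lc : continuous Lh.
  apply/linear_bounded_continuous; apply/linear_boundedP.
  near=> M => v; rewrite LE; apply: (le_trans (ler_norm_sum _ _ _)).
  apply: (@le_trans _ _ (\sum_(i < n) `|c i| * `|v|)).
    by apply: ler_sum => i _; rewrite normrM ler_wpM2l // rV_coord_le.
  rewrite -mulr_suml ler_wpM2r //; near: M; exact: nbhs_pinfty_ge.
have E : f \o shift u = cst (f u) + Lh +o_ (0 : 'rV[R]_n) id.
  apply/eqaddoP => e' e0.
  (* Dividing by [n.+1] keeps the sum of the [n] errors at most [e'], also when [n] is 0. *)
  have n0 : 0 < n.+1%:R :> R by rewrite ltr0n.
  have [r r0 Hr] := partials_near oD Du H C (divr_gt0 e0 n0).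
  have near0 : \forall h \near (0 : 'rV[R]_n), `|h| < r.
    by apply/nbhs_ballP; exists r => // h; rewrite -ball_normE /= sub0r normrN.
  near=> h.
  have B0 : ball u r u by exact: ballxx.
  have B1 : ball u r (h + u).
    rewrite -ball_normE /= opprD addrCA subrr addr0 normrN.
    by near: h.
  have := box_increment r0 Hr B1 B0.
  rewrite addrK /= => I.
  have -> : ((f \o shift u - (cst (f u) + Lh)) h : R) =
      f (h + u) - f u - \sum_(i < n) df i u * ((h + u) 0 i - u 0 i).
    rewrite -![(_ - _ : _ -> _) _]/(_ - _) -![(_ + _ : _ -> _) _]/(_ + _) /=.
    rewrite /L opprD addrA.
    by congr (_ - _); apply: eq_bigr => i _; rewrite mxE addrK.
  apply: (le_trans I); rewrite ler_wpM2r // mulrA ler_pdivrMr // mulrC.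
  by apply: ler_wpM2l; [exact: ltW|rewrite ler_nat].
by apply/diff_locallyP; rewrite (diff_unique Lc E).
Unshelve. all: by end_near. Qed.

Lemma diff_partial f u v : differentiable f u ->
  'd f u v = \sum_(j < n) partial j f u * v 0 j.
Proof.
move=> df; rewrite {1}(row_sum_delta v) linear_sum; apply: eq_bigr => j _.
by rewrite linearZ /partial deriveE // mulrC.
Qed.

(** Only the derivative of [c] along [v] is assumed: restricted to the line, [c] becomes a
    differentiable curve, to which the chain rule for differentials applies. *)
Lemma is_derive_chain (V : normedModType R) (c : V -> 'rV[R]_n) f (u v : V)
    (dc : 'I_n -> R) :
  (forall j, is_derive u v (fun w : V => c w 0 j) (dc j)) ->
  differentiable f (c u) ->
  is_derive u v (f \o c) (\sum_(j < n) partial j f (c u) * dc j).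
Proof.
move=> H df; rewrite -[u in is_derive u]add0r -(scale0r v).
apply/is_derive_lineP; set g := fun s : R => c (s *: v + u).
have H' j : is_derive (0 : R) 1 (fun s => g s 0 j) (dc j).
  exact: (is_derive_line (H j)).
have Dg : derivable g 0 1 by apply/derivable_mxP => i j; rewrite [i]ord1; case: (H' j).
have dg : differentiable g 0 by apply/derivable1_diffP.
have g0 : g 0 = c u by rewrite /g scale0r add0r.
have df' : differentiable f (g 0) by rewrite g0.
have dfg : differentiable (f \o g) 0 by exact: differentiable_comp.
split; first exact/derivable1_diffP.
have -> : 'D_1 (fun s : R => (f \o c) (s *: v + u)) 0 = 'd f (g 0) ('d g 0 1).
  by rewrite deriveE // -[fun s : R => _]/(f \o g) diff_comp.
rewrite diff_partial // g0 -deriveE // derive_mx //.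
by apply: eq_bigr => j _; rewrite mxE; case: (H' j) => _ ->.
Qed.

End Differentiability.

(** * Functions of class C^m *)

Section Ck.
Context {R : realType}.

Lemma nbhs_open (T : topologicalType) (D : set T) u : open D -> D u -> nbhs u D.
Proof. by move=> oD Du; apply: open_nbhs_nbhs. Qed.

Lemma continuous_near (T U : topologicalType) (D : set T) (f g : T -> U) u :
  open D -> D u -> (forall w, D w -> f w = g w) ->
  {for u, continuous f} -> {for u, continuous g}.
Proof.
move=> oD Du E C; rewrite /prop_for /continuous_at -(E u Du).
apply: cvg_trans C; apply: near_eq_cvg.
by apply: filterS (nbhs_open oD Du) => w /E.
Qed.

Variable n : nat.
Implicit Types (f g : 'rV[R]_n -> R) (D : set 'rV[R]_n).

Lemma Ck_continuous m D f : Ck_on m D f -> forall u, D u -> {for u, continuous f}.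
Proof. by case: m => [|m] []. Qed.

Lemma Ck_is_derive m D f i u : Ck_on m.+1 D f -> D u ->
  is_derive u (delta_mx 0 i) f (partial i f u).
Proof. by move=> [_ H] Du; apply: derivableP; exact: (H i).1. Qed.

Lemma Ck_partial m D f i : Ck_on m.+1 D f -> Ck_on m D (partial i f).
Proof. by move=> [_ H]; exact: (H i).2. Qed.

Lemma Ck_sub m D D' f : D' `<=` D -> Ck_on m D f -> Ck_on m D' f.
Proof.
move=> S; elim: m f => [|m IH] f [C H]; split=> //; first by move=> u /S; exact: C.
  by move=> u /S; exact: C.
move=> i; split; first by move=> u /S; exact: (H i).1.
exact/IH/(H i).2.
Qed.

Lemma Ck_eq m D f g : open D -> (forall u, D u -> f u = g u) ->
  Ck_on m D f -> Ck_on m D g.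
Proof.
move=> oD; elim: m f g => [|m IH] f g E [C H]; split=> //.
- by move=> u Du; apply: (continuous_near oD Du E); exact: C.
- by move=> u Du; apply: (continuous_near oD Du E); exact: C.
move=> i; split.
  move=> u Du; have [_ H'] := H i.
  have := is_derive_near oD Du E (derivableP ((H i).1 u Du)).
  by case.
apply: IH (H i).2 => u Du.
have := is_derive_near oD Du E (derivableP ((H i).1 u Du)).
by rewrite /partial; case=> _ <-.
Qed.

(** Introduction rule behind the closure properties below. Continuity of [f] comes for free, since
    continuous partial derivatives make [f] differentiable. *)
Lemma Ck_S m D f (df : 'I_n -> 'rV[R]_n -> R) : open D ->
  (forall i u, D u -> is_derive u (delta_mx 0 i) f (df i u)) ->
  (forall i, Ck_on m D (df i)) -> Ck_on m.+1 D f.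
Proof.
move=> oD H C; split.
  move=> u Du; apply: differentiable_continuous.
  apply: (differentiable_of_partials oD Du H) => i.
  exact: (Ck_continuous (C i)).
move=> i; split; first by move=> u Du; case: (H i u Du).
by apply: Ck_eq (C i) => // u Du; rewrite /partial; case: (H i u Du) => _ <-.
Qed.

Lemma Ck_le m m' D f : (m' <= m)%N -> Ck_on m D f -> Ck_on m' D f.
Proof.
elim: m' m f => [|m' IH] [|m] f //= le [C H]; split=> // i.
by split; [exact: (H i).1|apply: IH (H i).2].
Qed.

(** [Ck_on] carries no uniformity over [D], so it can be checked piecewise: near the axes and off
    them, or on two open sets covering the sphere. *)
Lemma Ck_local m D f :
  (forall u, D u -> exists V : set 'rV[R]_n, [/\ open V, V u & Ck_on m V f]) ->
  Ck_on m D f.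
Proof.
elim: m f => [|m IH] f H; split=> //.
- by move=> u /H[V [oV Vu]] /Ck_continuous; exact.
- by move=> u /H[V [oV Vu]] /Ck_continuous; exact.
move=> i; split; first by move=> u /H[V [oV Vu [_ /(_ i)[+ _]]]]; exact.
by apply: IH => u /H[V [oV Vu [_ /(_ i)[_ C]]]]; exists V.
Qed.

Lemma Ck_differentiable m D f u : open D -> Ck_on m.+1 D f -> D u ->
  differentiable f u.
Proof.
move=> oD C Du; apply: (differentiable_of_partials oD Du (df := fun i => partial i f)).
  by move=> i w Dw; apply: Ck_is_derive C Dw.
by move=> i; exact: (Ck_continuous (Ck_partial i C)).
Qed.

Lemma Ck_cst m D (c : R) : open D -> Ck_on m D (fun=> c).
Proof.
move=> oD; elim: m c => [|m IH] c; first by split=> // u _; exact: cst_continuous.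
by apply: (@Ck_S _ _ _ (fun _ => fun=> 0)) => // i u _; exact: is_derive_cst.
Qed.

Lemma Ck_coord m D i : open D -> Ck_on m D (fun u : 'rV[R]_n => u 0 i).
Proof.
move=> oD; case: m => [|m]; first by split=> // u _; exact: coord_continuous.
apply: (@Ck_S _ _ _ (fun j => fun=> (delta_mx 0 j : 'rV[R]_n) 0 i)) => //.
  by move=> j u _; exact: is_derive_coord.
by move=> j; exact: Ck_cst.
Qed.

Lemma Ck_add m D f g : open D -> Ck_on m D f -> Ck_on m D g ->
  Ck_on m D (fun u => f u + g u).
Proof.
move=> oD; elim: m f g => [|m IH] f g Hf Hg.
  by split=> // u Du; apply: continuousD;
    [exact: Ck_continuous Hf _ Du|exact: Ck_continuous Hg _ Du].
apply: (@Ck_S _ _ _ (fun i u => partial i f u + partial i g u)) => //.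
  move=> i u Du.
  exact: (is_deriveD (Ck_is_derive i Hf Du) (Ck_is_derive i Hg Du)).
by move=> i; apply: IH; apply: Ck_partial.
Qed.

Lemma Ck_mul m D f g : open D -> Ck_on m D f -> Ck_on m D g ->
  Ck_on m D (fun u => f u * g u).
Proof.
move=> oD; elim: m f g => [|m IH] f g Hf Hg.
  by split=> // u Du; apply: continuousM;
    [exact: Ck_continuous Hf _ Du|exact: Ck_continuous Hg _ Du].
apply: (@Ck_S _ _ _ (fun i u => partial i f u * g u + f u * partial i g u)) => //.
  move=> i u Du.
  exact: (is_derive_mul (Ck_is_derive i Hf Du) (Ck_is_derive i Hg Du)).
move=> i; apply: Ck_add => //; apply: IH.
- exact: Ck_partial.
- exact: Ck_le Hg.
- exact: Ck_le Hf.
- exact: Ck_partial.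
Qed.

Lemma Ck_opp m D f : open D -> Ck_on m D f -> Ck_on m D (fun u => - f u).
Proof.
move=> oD Hf; apply: Ck_eq (Ck_mul oD (Ck_cst m (-1) oD) Hf) => // u _.
by rewrite mulN1r.
Qed.

Lemma Ck_sum m D p (F : 'I_p -> 'rV[R]_n -> R) : open D ->
  (forall j, Ck_on m D (F j)) -> Ck_on m D (fun u => \sum_(j < p) F j u).
Proof.
move=> oD; elim: p F => [|p IH] F H.
  by apply: Ck_eq (Ck_cst m 0 oD) => // u _; rewrite big_ord0.
apply: Ck_eq (Ck_add oD (IH _ (fun j => H (widen_ord (leqnSn p) j))) (H ord_max)) => //.
by move=> u _; rewrite big_ord_recr.
Qed.

Lemma Ck_exp m D f k : open D -> Ck_on m D f -> Ck_on m D (fun u => f u ^+ k).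
Proof.
move=> oD Hf; elim: k => [|k IH]; first exact: Ck_cst.
by apply: Ck_eq (Ck_mul oD Hf IH) => // u _; rewrite exprS.
Qed.

(* [Ck_on m] is asked of the composite with [g'], not of [g'] itself: when [g'] is
   expressed through [g], induction on [m] needs no higher derivative of [g]. *)
Lemma Ck_comp1 m D f (g g' : R -> R) : open D ->
  (forall u, D u -> is_derive (f u) 1 g (g' (f u))) ->
  Ck_on m.+1 D f -> Ck_on m D (fun u => g' (f u)) ->
  Ck_on m.+1 D (fun u => g (f u)).
Proof.
move=> oD H Hf Hg'.
apply: (@Ck_S _ _ _ (fun i u => g' (f u) * partial i f u)) => //.
  by move=> i u Du; exact: is_derive_comp1 (Ck_is_derive i Hf Du) (H u Du).
by move=> i; apply: Ck_mul => //; exact: Ck_partial.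
Qed.

Lemma C0_comp1 D f (g : R -> R) :
  (forall u, D u -> {for f u, continuous g}) -> Ck_on 0 D f ->
  Ck_on 0 D (fun u => g (f u)).
Proof.
move=> H Hf; split=> // u Du; apply: continuous_comp; last exact: H.
exact: Ck_continuous Hf _ Du.
Qed.

Lemma is_derive_continuous (g : R -> R) (x d : R) : is_derive x 1 g d -> {for x, continuous g}.
Proof. by case=> D _; apply: differentiable_continuous; apply/derivable1_diffP. Qed.

Lemma Ck_comp_inv m D f : open D -> (forall u, D u -> f u != 0) ->
  Ck_on m D f -> Ck_on m D (fun u => (f u)^-1).
Proof.
move=> oD f0; elim: m => [|m IH] Hf.
  by apply: C0_comp1 Hf => u Du; apply: inv_continuous; exact: f0.
apply: (@Ck_S _ _ _ (fun i u => - (f u)^-2 * partial i f u)) => //.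
  by move=> i u Du; apply: is_derive_inv (f0 u Du) (Ck_is_derive i Hf Du).
have {}IH := IH (Ck_le (leqnSn m) Hf).
move=> i; apply: Ck_mul => //; last exact: Ck_partial.
apply: Ck_opp => //.
by apply: Ck_eq (Ck_exp 2 oD IH) => // u _; rewrite exprVn.
Qed.

Lemma Ck_sin_cos m D f : open D -> Ck_on m D f ->
  Ck_on m D (fun u => sin (f u)) /\ Ck_on m D (fun u => cos (f u)).
Proof.
move=> oD; elim: m => [|m IH] Hf.
  by split; apply: C0_comp1 Hf => u _; [exact: continuous_sin|exact: continuous_cos].
have [Hs Hc] := IH (Ck_le (leqnSn m) Hf); split.
  by apply: (@Ck_comp1 _ _ _ _ cos) => // u _; exact: is_derive_sin.
apply: (@Ck_comp1 _ _ _ _ (fun x => - sin x)) => //; exact: Ck_opp.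
Qed.

Lemma Ck_powR m D f a : open D -> (forall u, D u -> 0 < f u) ->
  Ck_on m D f -> Ck_on m D (fun u => f u `^ a).
Proof.
(* The exponent varies in the induction because each derivative lowers it by 1. *)
move=> oD f0; elim: m a => [|m IH] a Hf.
  apply: (@C0_comp1 _ _ (fun x => x `^ a)) Hf => u Du.
  exact: is_derive_continuous (is_derive1_powR a (f0 u Du)).
apply: (@Ck_comp1 _ _ _ (fun x => x `^ a) (fun x => a * x `^ (a - 1))) => //.
  by move=> u Du; exact: is_derive1_powR (f0 u Du).
apply: Ck_mul => //; first exact: Ck_cst.
exact/IH/(Ck_le (leqnSn m) Hf).
Qed.

Lemma Ck_sqrt m D f : open D -> (forall u, D u -> 0 < f u) ->
  Ck_on m D f -> Ck_on m D (fun u => Num.sqrt (f u)).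
Proof.
move=> oD f0 Hf; apply: Ck_eq (Ck_powR 2^-1 oD f0 Hf) => // u Du.
by rewrite powR12_sqrt // ltW // f0.
Qed.

Lemma Ck_norm m D f : open D -> (forall u, D u -> f u != 0) ->
  Ck_on m D f -> Ck_on m D (fun u => `|f u|).
Proof.
move=> oD f0 Hf; apply: Ck_eq (Ck_sqrt oD _ (Ck_exp 2 oD Hf)) => // u Du.
  by rewrite sqrtr_sqr.
by rewrite exprn_even_gt0 // f0.
Qed.

Lemma Ck_atan m D f : open D -> Ck_on m D f -> Ck_on m D (fun u => atan (f u)).
Proof.
move=> oD; case: m => [|m] Hf.
  by apply: C0_comp1 Hf => u _; exact: continuous_atan.
apply: (@Ck_comp1 _ _ _ _ (fun x => (1 + x ^+ 2)^-1)) => //.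
apply: Ck_comp_inv => //.
  by move=> u _; rewrite gt_eqF // ltr_pwDl // sqr_ge0.
apply: Ck_add => //; first exact: Ck_cst.
exact/Ck_exp/(Ck_le (leqnSn m) Hf).
Qed.

Lemma Ck_asin m D f : open D -> (forall u, D u -> -1 < f u < 1) ->
  Ck_on m D f -> Ck_on m D (fun u => asin (f u)).
Proof.
move=> oD f1; case: m => [|m] Hf.
  by apply: C0_comp1 Hf => u Du; exact/continuous_asin/f1.
apply: (@Ck_comp1 _ _ _ _ (fun x => (Num.sqrt (1 - x ^+ 2))^-1)) => //.
  by move=> u Du; exact/is_derive1_asin/f1.
have P u : D u -> 0 < 1 - f u ^+ 2.
  by move=> /f1 /andP[H1 H2]; rewrite subr_gt0; nra.
have Hf' := Ck_le (leqnSn m) Hf.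
apply: Ck_comp_inv => //.
  by move=> u Du; rewrite gt_eqF // sqrtr_gt0 P.
apply: Ck_sqrt => //; apply: Ck_add => //; first exact: Ck_cst.
exact/Ck_opp/Ck_exp.
Qed.

(** All derivatives of [g] are treated together, because the induction step for [derive1n k g] calls
    on [derive1n k.+1 g]. *)
Lemma Ck_smooth_comp m D f (g : R -> R) : open D ->
  (forall k x, derivable (derive1n k g) x 1) ->
  Ck_on m D f -> forall k, Ck_on m D (fun u => derive1n k g (f u)).
Proof.
move=> oD Hg; elim: m => [|m IH] Hf k.
  apply: (@C0_comp1 _ _ (derive1n k g)) Hf => u _; apply: is_derive_continuous.
  exact: derivableP.
apply: (@Ck_comp1 _ _ _ (derive1n k g) (derive1n k.+1 g) oD _ Hf
  (IH (Ck_le (leqnSn m) Hf) k.+1)) => u _.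
by rewrite derive1nS derive1E; exact: derivableP.
Qed.

End Ck.

Lemma continuous_rV {R : realType} {T : topologicalType} {p : nat}
    (h : T -> 'rV[R]_p) (u : T) :
  (forall j, {for u, continuous (fun w : T => h w 0 j)}) -> {for u, continuous h}.
Proof.
move=> H; apply/cvgrPdist_le => e e0; near=> w.
apply: rV_norm_le (ltW e0) _ => j; rewrite !mxE.
move: j; near: w; apply: filter_forall => j.
by have /cvgrPdist_le /(_ e e0) := H j.
Unshelve. all: by end_near. Qed.

Lemma Ck_comp {R : realType} {n p : nat} m (D : set 'rV[R]_n) (E : set 'rV[R]_p)
    (h : 'rV[R]_n -> 'rV[R]_p) (f : 'rV[R]_p -> R) :
  open D -> open E -> (forall u, D u -> E (h u)) ->
  (forall j, Ck_on m D (fun u => h u 0 j)) -> Ck_on m E f ->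
  Ck_on m D (fun u => f (h u)).
Proof.
move=> oD oE DE; elim: m f => [|m IH] f Hh Hf.
  split=> // u Du; apply: continuous_comp; last exact: Ck_continuous Hf _ (DE _ Du).
  by apply: continuous_rV => j; exact: Ck_continuous (Hh j) _ Du.
have Hh' j := Ck_le (leqnSn m) (Hh j).
apply: (@Ck_S _ _ _ _ _ (fun i u => \sum_(j < p) partial j f (h u) *
   partial i (fun w => h w 0 j) u)) => //.
  move=> i u Du; apply: is_derive_chain.
    by move=> j; exact: Ck_is_derive (Hh j) Du.
  exact: Ck_differentiable oE Hf (DE _ Du).
move=> i; apply: Ck_sum => // j; apply: Ck_mul => //.
  by apply: IH => //; exact: Ck_partial.
exact: Ck_partial (Hh j).
Qed.

(** * Hoelder continuity *)

Section Holder.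
Context {R : realType}.
Variable alpha : R.
Hypothesis alpha01 : 0 < alpha <= 1.

Definition holder_near (n : nat) (u : 'rV[R]_n) (f : 'rV[R]_n -> R) : Prop :=
  exists (C : R) (V : set 'rV[R]_n), nbhs u V /\
    forall v w, V v -> V w -> `|f v - f w| <= C * `|v - w| `^ alpha.

(** A radius of at most 1/2 keeps any two points of the ball at distance at most 1, where the
    modulus |v - w|^alpha is at most 1. *)
Lemma holder_nearP (n : nat) (u : 'rV[R]_n) (f : 'rV[R]_n -> R) :
  holder_near u f ->
  exists C : R, 0 <= C /\ exists2 r : R, 0 < r <= 2^-1 &
    forall v w, ball u r v -> ball u r w ->
      `|f v - f w| <= C * `|v - w| `^ alpha /\ `|v - w| <= 1.
Proof.
case=> C [V [/nbhs_ballP[r r0 HV] H]]; exists `|C|; split=> //.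
have m0 : 0 < Num.min r 2^-1 by rewrite lt_min r0 /= invr_gt0.
exists (Num.min r 2^-1); first by rewrite m0 /= ge_min lexx orbT.
move=> v w; rewrite -ball_normE /= !lt_min => /andP[v1 v2] /andP[w1 w2]; split.
  apply: (le_trans (H v w _ _)).
  - by apply: HV; rewrite -ball_normE.
  - by apply: HV; rewrite -ball_normE.
  by rewrite ler_wpM2r ?powR_ge0 // ler_norm.
rewrite -(subrKA u) (le_trans (ler_normD _ _)) // (distrC v).
have -> : 1 = 2^-1 + 2^-1 :> R by field.
by rewrite lerD // ltW.
Qed.

(** Turns Lipschitz bounds into Hoelder bounds at distances at most 1. *)
Lemma le_powR_unit (s : R) : 0 <= s <= 1 -> s <= s `^ alpha.
Proof.
case/andP=> s0 s1; have [->|sn0] := eqVneq s 0; first exact: powR_ge0.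
by apply: ger1_powR; [rewrite lt_neqAle eq_sym sn0 s0|case/andP: alpha01].
Qed.

Lemma holder_near_bounded (n : nat) (u : 'rV[R]_n) (f : 'rV[R]_n -> R) :
  holder_near u f -> exists M : R, 0 <= M /\ \forall v \near u, `|f v| <= M.
Proof.
move=> /holder_nearP[C [C0 [r /andP[r0 _] H]]].
exists (`|f u| + C); split; first by rewrite addr_ge0.
apply/nbhs_ballP; exists r => // v Bv.
have [H1 H2] := H _ _ Bv (ballxx u r0).
have -> : f v = f u + (f v - f u) by ring.
apply: (le_trans (ler_normD _ _)); rewrite lerD2l (le_trans H1) //.
rewrite ler_piMr //; apply: le_trans (ge0_ler_powR (ltW (andP alpha01).1) _ _ H2) _.
- by rewrite nnegrE.
- by rewrite nnegrE.
by rewrite powR1.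
Qed.

Lemma holder_near_eq (n : nat) (u : 'rV[R]_n) (f g : 'rV[R]_n -> R) :
  (\forall v \near u, f v = g v) -> holder_near u f -> holder_near u g.
Proof.
move=> E [C [V [NV H]]]; exists C, (V `&` [set v | f v = g v]); split.
  exact: filterI.
by move=> v w [Vv <-] [Vw <-]; exact: H.
Qed.

Lemma holder_near_add (n : nat) (u : 'rV[R]_n) (f g : 'rV[R]_n -> R) :
  holder_near u f -> holder_near u g -> holder_near u (fun v => f v + g v).
Proof.
move=> [C [V [NV H]]] [C' [V' [NV' H']]]; exists (C + C'), (V `&` V'); split.
  exact: filterI.
move=> v w [Vv Vv'] [Vw Vw'].
have -> : f v + g v - (f w + g w) = (f v - f w) + (g v - g w) by ring.
by rewrite (le_trans (ler_normD _ _)) // mulrDl lerD // ?H ?H'.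
Qed.

Lemma holder_near_mul (n : nat) (u : 'rV[R]_n) (f g : 'rV[R]_n -> R) :
  holder_near u f -> holder_near u g -> holder_near u (fun v => f v * g v).
Proof.
move=> Hf Hg.
have [M [M0 NM]] := holder_near_bounded Hf.
have [M' [M0' NM']] := holder_near_bounded Hg.
case: Hf Hg => [C [V [NV H]]] [C' [V' [NV' H']]].
exists (M' * C + M * C'), ((V `&` V') `&` ([set v | `|f v| <= M] `&` [set v | `|g v| <= M'])).
split; first by do !apply: filterI.
move=> v w [[Vv Vv'] [fv gv]] [[Vw Vw'] [fw gw]].
have -> : f v * g v - f w * g w = g v * (f v - f w) + f w * (g v - g w) by ring.
rewrite (le_trans (ler_normD _ _)) // !normrM mulrDl -!mulrA.
by rewrite lerD // ler_pM // ?H ?H'.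
Qed.

Lemma holder_near_sum (n p : nat) (u : 'rV[R]_n) (F : 'I_p -> 'rV[R]_n -> R) :
  (forall j, holder_near u (F j)) -> holder_near u (fun v => \sum_(j < p) F j v).
Proof.
elim: p F => [|p IH] F H.
  exists 0, setT; split; first exact: filterT.
  by move=> v w _ _; rewrite !big_ord0 subrr normr0 mul0r.
apply: holder_near_eq (holder_near_add (IH _ (fun j => H (widen_ord (leqnSn p) j))) (H ord_max)).
by apply: (@filterE _ (nbhs u)) => v; rewrite big_ord_recr.
Qed.

Lemma C1_lipschitz (n : nat) (D : set 'rV[R]_n) (f : 'rV[R]_n -> R) u :
  open D -> Ck_on 1 D f -> D u ->
  exists (L r : R), [/\ 0 <= L, 0 < r &
    forall v w, ball u r v -> ball u r w -> `|f v - f w| <= L * `|v - w|].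
Proof.
move=> oD Cf Du.
have [r r0 H] := partials_near oD Du (fun i w Dw => Ck_is_derive i Cf Dw)
  (fun i => Ck_continuous (Ck_partial i Cf) Du) ltr01.
pose L := n%:R * (\sum_(i < n) `|partial i f u| + 1).
have S0 : 0 <= \sum_(i < n) `|partial i f u| by exact: sumr_ge0.
exists L, r; split=> //; first by rewrite mulr_ge0 // addr_ge0.
move=> v w Bv Bw.
(* With reference slopes 0, the lemma bounds the increment of [f] itself. *)
have := @box_increment R n f (fun=> 0) (fun i => partial i f) u r
  (\sum_(i < n) `|partial i f u| + 1) r0 _ v w Bv Bw.
rewrite (_ : \sum_(i < n) 0 * _ = 0) ?subr0; last first.
  by apply: big1 => i _; rewrite mul0r.
apply=> i z /(H i)[Hz1 Hz2]; split=> //; rewrite subr0.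
rewrite -(subrK (partial i f u) (partial i f z)) addrC.
rewrite (le_trans (ler_normD _ _)) // lerD //.
by rewrite (bigD1 i) //= lerDl; exact: sumr_ge0.
Qed.

Lemma holder_near_C1 (n : nat) (D : set 'rV[R]_n) (f : 'rV[R]_n -> R) u :
  open D -> Ck_on 1 D f -> D u -> holder_near u f.
Proof.
move=> oD Cf Du; have [L [r [L0 r0 H]]] := C1_lipschitz oD Cf Du.
have m0 : 0 < Num.min r 2^-1 by rewrite lt_min r0 /= invr_gt0.
exists L, (ball u (Num.min r 2^-1)); split; first exact: nbhsx_ballx.
move=> v w; rewrite -ball_normE /= !lt_min => /andP[v1 v2] /andP[w1 w2].
apply: (le_trans (H v w _ _)); try by rewrite -ball_normE.
rewrite ler_wpM2l // le_powR_unit // normr_ge0 /=.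
rewrite -(subrKA u) (le_trans (ler_normD _ _)) // (distrC v).
have -> : 1 = 2^-1 + 2^-1 :> R by field.
by rewrite lerD // ltW.
Qed.

Lemma holder_near_comp (n p : nat) (D : set 'rV[R]_n) (h : 'rV[R]_n -> 'rV[R]_p)
    (f : 'rV[R]_p -> R) u :
  open D -> D u -> (forall j, Ck_on 1 D (fun v => h v 0 j)) ->
  holder_near (h u) f -> holder_near u (fun v => f (h v)).
Proof.
move=> oD Du Hh /holder_nearP[C [C0 [s /andP[s0 _] H]]].
have [L L0 NL] : exists2 L : R, 0 <= L & exists2 r : R, 0 < r &
    forall v w, ball u r v -> ball u r w -> `|h v - h w| <= L * `|v - w|.
  have /choice[Lr HLr] : forall j, exists Lr : R * R, [/\ 0 <= Lr.1, 0 < Lr.2 &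
      forall v w, ball u Lr.2 v -> ball u Lr.2 w ->
        `|h v 0 j - h w 0 j| <= Lr.1 * `|v - w|].
    by move=> j; have [L [r [L0 r0 HL]]] := C1_lipschitz oD (Hh j) Du; exists (L, r).
  have S0 : 0 <= \sum_(j < p) (Lr j).1 by apply: sumr_ge0 => j _; case: (HLr j).
  exists (\sum_(j < p) (Lr j).1) => //.
  exists (\big[Num.min/1]_(j < p) (Lr j).2).
    by apply: lt_bigmin => // j _; case: (HLr j).
  move=> v w Bv Bw; apply: rV_norm_le; first by rewrite mulr_ge0.
  move=> j; rewrite !mxE; have [L1 r1 HL] := HLr j.
  have B z : ball u (\big[Num.min/1]_(j < p) (Lr j).2) z -> ball u (Lr j).2 z.
    by apply: le_ball; apply: bigmin_le_cond.
  apply: (le_trans (HL v w (B _ Bv) (B _ Bw))); rewrite ler_wpM2r //.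
  rewrite (bigD1 j) //= lerDl; apply: sumr_ge0 => i _; by case: (HLr i).
case: NL => r r0 HL.
have Ch : {for u, continuous h}.
  by apply: continuous_rV => j; exact: Ck_continuous (Hh j) _ Du.
exists (C * L `^ alpha), (ball u r `&` h @^-1` (ball (h u) s)); split.
  by apply: filterI; [exact: nbhsx_ballx|apply: Ch; exact: nbhsx_ballx].
move=> v w [Bv hv] [Bw hw].
apply: (le_trans (H _ _ hv hw).1); rewrite -mulrA ler_wpM2l //.
rewrite -powRM //; apply: ge0_ler_powR; rewrite ?nnegrE ?mulr_ge0 //.
  by case/andP: alpha01 => /ltW.
exact: HL.
Qed.

End Holder.

(** * Closure properties of the class C^{1,alpha} *)

Section C1holder.
Context {R : realType}.
Variable alpha : R.
Hypothesis alpha01 : 0 < alpha <= 1.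
Context {n : nat}.
Implicit Types (D : set 'rV[R]_n) (f g : 'rV[R]_n -> R).

Lemma C1holder_intro D f (df : 'I_n -> 'rV[R]_n -> R) : open D ->
  (forall i u, D u -> is_derive u (delta_mx 0 i) f (df i u)) ->
  (forall i, Ck_on 0 D (df i)) -> (forall i u, D u -> holder_near alpha u (df i)) ->
  C1holder_on alpha D f.
Proof.
move=> oD H C Hh; split; first exact: (Ck_S oD H C).
move=> i u Du; apply: (@holder_near_eq _ _ _ _ (df i)); last exact: Hh.
apply: filterS (nbhs_open oD Du) => v Dv.
by rewrite /partial; case: (H i v Dv).
Qed.

Lemma C1holder_local D f :
  (forall u, D u -> exists V : set 'rV[R]_n,
     [/\ open V, V u & C1holder_on alpha V f]) -> C1holder_on alpha D f.
Proof.
move=> H; split.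
  by apply: Ck_local => u /H[V [oV Vu [C _]]]; exists V.
by move=> i u /H[V [oV Vu [_ C]]]; exact: C.
Qed.

Lemma C1holder_Ck2 D f : open D -> Ck_on 2 D f -> C1holder_on alpha D f.
Proof.
move=> oD C; split; first exact: Ck_le C.
move=> i u Du; exact: (holder_near_C1 alpha01 oD (Ck_partial i C) Du).
Qed.

Lemma C1holder_eq D f g : open D -> (forall u, D u -> f u = g u) ->
  C1holder_on alpha D f -> C1holder_on alpha D g.
Proof.
move=> oD E [C H]; apply: (@C1holder_intro _ _ (fun i => partial i f)) => //.
- by move=> i u Du; apply: is_derive_near oD Du E (Ck_is_derive i C Du).
- by move=> i; exact: Ck_partial C.
Qed.

Lemma C1holder_add D f g : open D -> C1holder_on alpha D f ->
  C1holder_on alpha D g -> C1holder_on alpha D (fun u => f u + g u).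
Proof.
move=> oD [Cf Hf] [Cg Hg].
apply: (@C1holder_intro _ _ (fun i u => partial i f u + partial i g u)) => //.
- move=> i u Du.
  exact: (is_deriveD (Ck_is_derive i Cf Du) (Ck_is_derive i Cg Du)).
- by move=> i; apply: Ck_add => //; exact: Ck_partial.
- by move=> i u Du; apply: holder_near_add; [exact: Hf|exact: Hg].
Qed.

Lemma C1holder_mul D f g : open D -> C1holder_on alpha D f ->
  C1holder_on alpha D g -> C1holder_on alpha D (fun u => f u * g u).
Proof.
move=> oD [Cf Hf] [Cg Hg].
apply: (@C1holder_intro _ _ (fun i u => partial i f u * g u + f u * partial i g u)) => //.
- move=> i u Du.
  exact: (is_derive_mul (Ck_is_derive i Cf Du) (Ck_is_derive i Cg Du)).
- move=> i; apply: (Ck_add oD); apply: (Ck_mul oD).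
  + exact: Ck_partial.
  + exact: Ck_le Cg.
  + exact: Ck_le Cf.
  + exact: Ck_partial.
- move=> i u Du; apply: holder_near_add; apply: holder_near_mul => //.
  + exact: Hf.
  + exact: holder_near_C1 oD Cg Du.
  + exact: holder_near_C1 oD Cf Du.
  + exact: Hg.
Qed.

(** The factor - f^-2 of the derivative is still C^1, hence Hoelder, so that only the other factor
    uses the Hoelder bound on the derivatives of [f]. *)
Lemma C1holder_inv D f : open D -> (forall u, D u -> f u != 0) ->
  C1holder_on alpha D f -> C1holder_on alpha D (fun u => (f u)^-1).
Proof.
move=> oD f0 [Cf Hf].
have C2 : Ck_on 1 D (fun u => - (f u)^-2).
  apply: (Ck_opp oD); apply: (Ck_comp_inv oD); last exact: (Ck_exp 2 oD Cf).
  by move=> u Du; rewrite expf_neq0 // f0.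
apply: (@C1holder_intro _ _ (fun i u => - (f u)^-2 * partial i f u)) => //.
- by move=> i u Du; apply: is_derive_inv (f0 u Du) (Ck_is_derive i Cf Du).
- by move=> i; apply: (Ck_mul oD); [exact: Ck_le C2|exact: Ck_partial].
- move=> i u Du; apply: holder_near_mul => //; last exact: Hf.
  exact: holder_near_C1 oD C2 Du.
Qed.

(** Two derivatives are asked of [h] because its partial derivatives enter the chain rule as
    factors: being C^1, they are Hoelder. *)
Lemma C1holder_comp {p : nat} D (E : set 'rV[R]_p) (h : 'rV[R]_n -> 'rV[R]_p)
    (f : 'rV[R]_p -> R) : open D -> open E -> (forall u, D u -> E (h u)) ->
  (forall j, Ck_on 2 D (fun u => h u 0 j)) -> C1holder_on alpha E f ->
  C1holder_on alpha D (fun u => f (h u)).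
Proof.
move=> oD oE DE Hh [Cf Hf].
have Hh1 j : Ck_on 1 D (fun u => h u 0 j) by exact: Ck_le (Hh j).
have Hh0 j : Ck_on 0 D (fun u => h u 0 j) by exact: Ck_le (Hh j).
have Hp i j : Ck_on 1 D (partial i (fun u => h u 0 j)) by exact: Ck_partial (Hh j).
apply: (@C1holder_intro _ _ (fun i u => \sum_(j < p) partial j f (h u) *
   partial i (fun w => h w 0 j) u)) => //.
- move=> i u Du; apply: is_derive_chain.
    by move=> j; exact: Ck_is_derive (Hh1 j) Du.
  exact: Ck_differentiable oE Cf (DE _ Du).
- move=> i; apply: Ck_sum => // j; apply: Ck_mul => //.
    by apply: Ck_comp oD oE DE Hh0 (Ck_partial j Cf).
  exact: Ck_le (Hp i j).
- move=> i u Du; apply: holder_near_sum => j; apply: holder_near_mul => //.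
    exact: holder_near_comp oD Du Hh1 (Hf _ _ (DE _ Du)).
  exact: holder_near_C1 oD (Hp i j) Du.
Qed.

End C1holder.

(** * The function psi *)

Lemma is_derive_normr (R : realType) (x : R) :
  x != 0 -> is_derive x 1 (@Num.norm R R) (`|x| / x).
Proof.
move=> x0; have [xp|xn|x00] := ltgtP x 0; last by rewrite x00 eqxx in x0.
- apply: (@is_derive_near _ _ -%R _ _ _ _ [set y : R | y < 0]) => //=.
  + by move=> y /= y0; rewrite ltr0_norm.
  + by rewrite ltr0_norm // mulNr divff //; exact: is_deriveNid.
- apply: (@is_derive_near _ _ id _ _ _ _ [set y : R | 0 < y]) => //=.
  + by move=> y /= y0; rewrite gtr0_norm.
  + by rewrite gtr0_norm // divff //; exact: is_derive_id.
Qed.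

(* The logarithmic derivative [x d/dx], which keeps the derivatives of a
   function of [|theta| / |r|^(1/alpha)] bounded. *)
Definition euler (R : realType) (f : R -> R) (x : R) : R := x * derive1 f x.

Section Profile.
Context {R : realType}.
Variable b : R -> R.
Hypothesis hb : step_profile b.

Lemma derivable_profile (x : R) : derivable b x 1.
Proof. exact: (hb.1 0%N). Qed.

Lemma is_derive_euler_profile (x : R) :
  is_derive x 1 (euler b) (derive1 b x + x * derive1n 2 b x).
Proof.
have H : is_derive x 1 (derive1 b) (derive1n 2 b x).
  rewrite derive1nS derive1E derive1n1; apply: derivableP.
  by have := hb.1 1%N x; rewrite derive1n1.
have := is_derive_mul (is_derive_id x 1) H.
by rewrite mul1r.
Qed.

Lemma derivable_euler_profile (x : R) : derivable (euler b) x 1.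
Proof. by case: (is_derive_euler_profile x). Qed.

Lemma derive1_locally_constant (f : R -> R) (c : R) (A : set R) x :
  open A -> A x -> (forall y, A y -> f y = c) -> derive1 f x = 0.
Proof.
move=> oA Ax E.
have H : is_derive x 1 f 0.
  by apply: (is_derive_near oA Ax) (is_derive_cst c x 1) => y /E.
by rewrite derive1E; case: H.
Qed.

Lemma profile_lt12 x : x < 2^-1 ->
  [/\ b x = 0, euler b x = 0 & euler (euler b) x = 0].
Proof.
case: hb => _ [b0 _ _ _ _] x12.
have E1 y : y < 2^-1 -> euler b y = 0.
  move=> y12; rewrite /euler.
  by rewrite (@derive1_locally_constant b 0 [set z : R | z < 2^-1]) ?mulr0 //
    => z /ltW/b0.
rewrite E1 // b0 ?ltW //; split=> //; rewrite /euler.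
by rewrite (@derive1_locally_constant _ 0 [set z : R | z < 2^-1]) ?mulr0 //
  => z /E1.
Qed.

Lemma profile_gt1 x : 1 < x -> euler b x = 0 /\ euler (euler b) x = 0.
Proof.
case: hb => _ [_ b0 _ _ _] x1.
have E1 y : 1 < y -> euler b y = 0.
  move=> y1; rewrite /euler.
  by rewrite (@derive1_locally_constant b 1 [set z : R | 1 < z]) ?mulr0 //
    => z /ltW/b0.
rewrite E1 //; split=> //; rewrite /euler.
by rewrite (@derive1_locally_constant _ 0 [set z : R | 1 < z]) ?mulr0 // => z /E1.
Qed.

(** On [1/2, 1] both x and x^2 are at most 1, so |x b'| <= 10 and |x (x b')'| = |x b' + x^2 b''| <=
    10 + 100; outside this interval both Euler derivatives vanish. *)
Lemma profile_bound x :
  [/\ `|b x| <= 1, `|euler b x| <= 10 & `|euler (euler b) x| <= 110].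
Proof.
case: (hb) => _ [_ _ bb b'b b''b].
have Hb : `|b x| <= 1 by have /andP[p1 p2] := bb x; rewrite ger0_norm.
have [x12|x12] := ltP x (2^-1).
  by have [-> -> ->] := profile_lt12 x12; rewrite normr0.
have [x1|x1] := ltP 1 x.
  by have [-> ->] := profile_gt1 x1; split=> //; rewrite normr0.
have x0 : 0 <= x by rewrite (le_trans _ x12) // invr_ge0.
have H1 : `|euler b x| <= 10.
  rewrite normrM (ger0_norm x0); have := b'b x; have := normr_ge0 (derive1 b x).
  nra.
split=> //; rewrite /euler -/(euler b).
have -> : derive1 (euler b) x = derive1 b x + x * derive1n 2 b x.
  by rewrite derive1E; case: (is_derive_euler_profile x).
rewrite mulrDr (le_trans (ler_normD _ _)) //.
have -> : 110 = 10 + 100 :> R by ring.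
rewrite lerD // !normrM ger0_norm // mulrA.
have := b''b x; have := normr_ge0 (derive1n 2 b x).
nra.
Qed.

End Profile.

Section Psi.
Context {R : realType}.
Variable alpha : R.
Hypothesis alpha01 : 0 < alpha < 1.

Local Notation beta := (alpha^-1).
Local Notation other := (@rev_ord 2).

Lemma other_neq (i : 'I_2) : other i != i.
Proof. by case: i => -[|[|]]. Qed.

Lemma ord2_cases (i j : 'I_2) : j = i \/ j = other i.
Proof. by case: i j => -[|[|]] // ? [[|[|]] // ?]; [left|right|right|left]; apply/val_inj. Qed.

(* For [i = 0] and [i = 1] these are the two arguments of [b] in [psi]. *)
Definition psi_arg (i : 'I_2) (u : 'rV[R]_2) : R :=
  `|u 0 (other i)| / `|u 0 i| `^ beta.

Lemma alpha_neq0 : alpha != 0.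
Proof. by case/andP: alpha01 => /gt_eqF ->. Qed.

Lemma inv_alpha_gt1 : 1 < beta.
Proof. by case/andP: alpha01 => a0 a1; rewrite invf_gt1. Qed.

Lemma inv_alpha_gt0 : 0 < beta. Proof. exact: lt_trans ltr01 inv_alpha_gt1. Qed.

Lemma is_derive_coord_dir (i j : 'I_2) (u : 'rV[R]_2) :
  is_derive u (delta_mx 0 i) (fun w : 'rV[R]_2 => w 0 j) (i == j)%:R.
Proof.
have := is_derive_coord u (delta_mx 0 i) 0 j.
by rewrite mxE eqxx /= eq_sym.
Qed.

Lemma is_derive_norm_coord (i : 'I_2) (u : 'rV[R]_2) : u 0 i != 0 ->
  is_derive u (delta_mx 0 i) (fun w : 'rV[R]_2 => `|w 0 i|) (`|u 0 i| / u 0 i).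
Proof.
move=> ui; have H := is_derive_coord_dir i i u.
by apply: is_derive_eq (is_derive_comp1 H (is_derive_normr ui)) _; rewrite eqxx mulr1.
Qed.

(** True for an arbitrary [f], such as the absolute value at 0, because the other coordinate is
    constant along the line. *)
Lemma is_derive_other_coord (i : 'I_2) (u : 'rV[R]_2) (f : R -> R) :
  is_derive u (delta_mx 0 i) (fun w : 'rV[R]_2 => f (w 0 (other i))) 0.
Proof.
apply: (is_derive_eq (f' := 0)) => //.
rewrite -[u]add0r -(scale0r (delta_mx 0 i)); apply/is_derive_lineP.
have -> : (fun s : R => f ((s *: delta_mx 0 i + u) 0 (other i))) =
    (fun=> f (u 0 (other i))).
  apply/funext => s; rewrite !mxE /= (negbTE (other_neq i)).
  by rewrite mulr0 add0r.
exact: is_derive_cst.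
Qed.

(** [psi_arg i] is homogeneous of degree - beta in |u_i|, whence this Euler relation;
    [psi_arg (other i)] is homogeneous of degree 1. *)
Lemma is_derive_psi_arg (i : 'I_2) (u : 'rV[R]_2) : u 0 i != 0 ->
  is_derive u (delta_mx 0 i) (psi_arg i) (- beta * psi_arg i u / u 0 i).
Proof.
move=> ui; have n0 : 0 < `|u 0 i| by rewrite normr_gt0.
have p0 : `|u 0 i| `^ beta != 0 by rewrite gt_eqF // powR_gt0.
have H := is_derive_comp1 (is_derive_norm_coord ui) (is_derive1_powR beta n0).
have := is_derive_mul (is_derive_other_coord i u Num.norm) 
  (@is_derive_inv _ _ (fun w : 'rV[R]_2 => `|w 0 i| `^ beta) u _ _ p0 H).
move=> H'; apply: (is_derive_eq H'); rewrite /psi_arg /=.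
rewrite powRB ?(gt_eqF n0) ?implybT // powRr1 ?ltW //.
by field; rewrite ui p0 normr_eq0 ui alpha_neq0.
Qed.

Lemma is_derive_psi_arg_other (i : 'I_2) (u : 'rV[R]_2) : u 0 i != 0 ->
  is_derive u (delta_mx 0 i) (psi_arg (other i)) (psi_arg (other i) u / u 0 i).
Proof.
move=> ui.
have := is_derive_mul (is_derive_norm_coord ui)
  (is_derive_other_coord i u (fun x => (`|x| `^ beta)^-1)).
rewrite /psi_arg rev_ordK => H; apply: (is_derive_eq H).
by rewrite mulr0 addr0; ring.
Qed.

Definition psi_prod (i : 'I_2) (f g : R -> R) (u : 'rV[R]_2) : R :=
  f (psi_arg i u) * g (psi_arg (other i) u).

Lemma psi_prodC i f g u : psi_prod i f g u = psi_prod (other i) g f u.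
Proof. by rewrite /psi_prod rev_ordK mulrC. Qed.

(** The operator u_i d_i maps products of this kind to combinations of such products: it replaces
    [f] by - beta [euler f] or [g] by [euler g]. All singular behaviour is thus isolated in powers
    of the coordinates. *)
Lemma is_derive_psi_prod (i : 'I_2) (f g : R -> R) (u : 'rV[R]_2) : u 0 i != 0 ->
  (forall x : R, derivable f x 1) -> (forall x : R, derivable g x 1) ->
  is_derive u (delta_mx 0 i) (psi_prod i f g)
    ((- beta * psi_prod i (euler f) g u + psi_prod i f (euler g) u) / u 0 i).
Proof.
move=> ui Hf Hg.
have Df (x : R) : is_derive x 1 f (derive1 f x) by rewrite derive1E; exact: derivableP.
have Dg (x : R) : is_derive x 1 g (derive1 g x) by rewrite derive1E; exact: derivableP.
have := is_derive_mul (is_derive_comp1 (is_derive_psi_arg ui) (Df _))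
  (is_derive_comp1 (is_derive_psi_arg_other ui) (Dg _)).
by move=> H; apply: (is_derive_eq H); rewrite /psi_prod /euler /=; field; rewrite ui alpha_neq0.
Qed.

Lemma is_derive_sign_coord (i j : 'I_2) (u : 'rV[R]_2) : u 0 i != 0 ->
  is_derive u (delta_mx 0 j) (fun w : 'rV[R]_2 => `|w 0 i| / w 0 i) 0.
Proof.
move=> ui; case: (ord2_cases j i) => ij; last first.
  by rewrite ij; exact: (is_derive_other_coord j u (fun x => `|x| / x)).
subst j; have := is_derive_mul (is_derive_norm_coord ui)
  (@is_derive_inv _ _ (fun w : 'rV[R]_2 => w 0 i) u _ _ ui (is_derive_coord_dir i i u)).
move=> H; apply: (is_derive_eq H).
by rewrite eqxx mulr1; field; rewrite ui.
Qed.

Variable b : R -> R.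
Hypothesis hb : step_profile b.

Local Notation Eb := (euler b).
Local Notation EEb := (euler (euler b)).

(** The factors |u_0| |u_1| vanish on the axes and so absorb the case distinction in [psi]. Stating
    it for either index lets one argument serve both directions. *)
Lemma psiE (i : 'I_2) (u : 'rV[R]_2) :
  psi alpha b u = `|u 0 i| * `|u 0 (other i)| * psi_prod i b b u.
Proof.
have E0 : psi alpha b u = `|u 0 0| * `|u 0 (other 0)| * psi_prod 0 b b u.
  have o0 : other 0 = 1 by apply/val_inj.
  have o1 : other 1 = 0 by apply/val_inj.
  rewrite /psi /psi_prod /psi_arg o0 o1 -normrM.
  by case: eqP => [->|_]; rewrite ?normr0 ?mul0r ?mulrA.
case: (ord2_cases 0 i) => ->; first exact: E0.
by rewrite E0 psi_prodC rev_ordK [`|_| * `|_|]mulrC.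
Qed.

(** This is 1 + u_i d_i applied to [psi_prod i b b], the 1 coming from the factor |u_i| of [psi]. *)
Definition psi_factor (i : 'I_2) (u : 'rV[R]_2) : R :=
  psi_prod i b b u - beta * psi_prod i Eb b u + psi_prod i b Eb u.

(* The factor [|x|/x] is the sign of [x], with value 0 at 0. *)
Definition psi_partial (i : 'I_2) (u : 'rV[R]_2) : R :=
  `|u 0 (other i)| * (`|u 0 i| / u 0 i) * psi_factor i u.

(** If [u 0 i = 0], the denominator is 0 since beta is not 0, and the quotient is 0 by the
    convention that 0 has inverse 0. *)
Lemma psi_arg0 (i : 'I_2) (u : 'rV[R]_2) :
  u 0 i = 0 \/ u 0 (other i) = 0 -> psi_arg i u = 0.
Proof.
rewrite /psi_arg => -[->|->]; last by rewrite normr0 mul0r.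
by rewrite normr0 powR0 ?invr0 ?mulr0 // gt_eqF // inv_alpha_gt0.
Qed.

Lemma psi_arg_ge0 i u : 0 <= psi_arg i u.
Proof. by rewrite /psi_arg divr_ge0 ?powR_ge0. Qed.

Lemma psi_prod_vanish (i : 'I_2) (f g : R -> R) (u : 'rV[R]_2) (j : 'I_2) :
  (forall x, x < 2^-1 -> f x = 0 /\ g x = 0) -> psi_arg j u < 2^-1 ->
  psi_prod i f g u = 0.
Proof.
move=> H; rewrite /psi_prod; case: (ord2_cases i j) => -> /H[E1 E2].
  by rewrite E1 mul0r.
by rewrite E2 mulr0.
Qed.

(** At an axis point other than the origin, [psi_arg i] is continuous with value 0. As [b] vanishes
    below 1/2, [psi] and its derivatives vanish near such a point. *)
Lemma psi_near_axis (i : 'I_2) (u : 'rV[R]_2) : u 0 i != 0 -> u 0 (other i) = 0 ->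
  exists V : set 'rV[R]_2, [/\ open V, V u & forall v, V v -> psi_arg i v < 2^-1].
Proof.
move=> ui uo; pose D := [set v : 'rV[R]_2 | v 0 i != 0].
have oD : open D.
  apply: (@open_comp _ _ (fun v : 'rV[R]_2 => v 0 i) [set x | x != 0]).
    by move=> v _; exact: coord_continuous.
  exact: open_neq.
have C : Ck_on 0 D (psi_arg i).
  apply: Ck_mul => //.
    split=> // v _; apply: (@continuous_comp _ _ _ (fun v : 'rV[R]_2 => v 0 (other i))).
      exact: coord_continuous.
    exact: norm_continuous.
  apply: Ck_comp_inv => //.
    by move=> v Dv; rewrite gt_eqF // powR_gt0 // normr_gt0.
  apply: Ck_powR => //; first by move=> v Dv; rewrite normr_gt0.
  by apply: Ck_norm => //; exact: Ck_coord.
have N : \forall v \near u, psi_arg i v < 2^-1.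
  have /cvgrPdist_lt /(_ 2^-1) := Ck_continuous C ui.
  rewrite psi_arg0; last by right.
  rewrite invr_gt0 ltr0n => /(_ isT); apply: filterS => v.
  by rewrite sub0r normrN ger0_norm // psi_arg_ge0.
exists (interior [set v | psi_arg i v < 2^-1]); split=> //.
- exact: open_interior.
- by move=> v; exact: interior_subset.
Qed.

Lemma psi_factor_vanish (i j : 'I_2) u : psi_arg j u < 2^-1 -> psi_factor i u = 0.
Proof.
move=> H; rewrite /psi_factor !(@psi_prod_vanish _ _ _ _ j) // ?mulr0 ?subr0 ?addr0 //.
all: by move=> x /(profile_lt12 hb)[H1 H2 _]; rewrite ?H1 ?H2.
Qed.

Lemma psi_vanish (j : 'I_2) u : psi_arg j u < 2^-1 -> psi alpha b u = 0.
Proof.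
move=> H; rewrite (psiE j) (@psi_prod_vanish _ _ _ _ j) ?mulr0 //.
by move=> x /(profile_lt12 hb)[-> _ _].
Qed.

Lemma psi_partial0 (i : 'I_2) (u : 'rV[R]_2) :
  u 0 i = 0 \/ u 0 (other i) = 0 -> psi_partial i u = 0.
Proof. by rewrite /psi_partial => -[] ->; rewrite ?normr0 !(mul0r, mulr0). Qed.

(** If [u 0 (other i) = 0], the origin included, [psi] vanishes along the whole line; at the
    remaining points with [u 0 i = 0] it vanishes nearby; off the axes the product rule applies. *)
Lemma is_derive_psi (i : 'I_2) (u : 'rV[R]_2) :
  is_derive u (delta_mx 0 i) (psi alpha b) (psi_partial i u).
Proof.
have [uo|uo] := eqVneq (u 0 (other i)) 0.
  rewrite psi_partial0; last by right.
  rewrite -[u]add0r -(scale0r (delta_mx 0 i)); apply/is_derive_lineP.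
  rewrite (_ : (fun s : R => _) = fun=> 0); first exact: is_derive_cst.
  apply/funext => s; rewrite (psiE i) !mxE /= (negbTE (other_neq i)).
  by rewrite mulr0 add0r uo normr0 mulr0 mul0r.
have [ui|ui] := eqVneq (u 0 i) 0.
  rewrite psi_partial0; last by left.
  have uoo : u 0 (other (other i)) = 0 by rewrite rev_ordK.
  have [V [oV Vu HV]] := psi_near_axis uo uoo.
  apply: (is_derive_near oV Vu) (is_derive_cst 0 u _) => v /HV H.
  by rewrite (psi_vanish H).
have D0 := derivable_profile hb.
have H := is_derive_mul (is_derive_mul (is_derive_norm_coord ui)
  (is_derive_other_coord i u Num.norm)) (is_derive_psi_prod ui D0 D0).
apply: is_derive_ext (is_derive_eq H _) _; last by move=> v; rewrite (psiE i).
rewrite /psi_partial /psi_factor; field.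
by rewrite ui alpha_neq0.
Qed.

Lemma psi_prod_bound i (f g : R -> R) u (M N : R) :
  (forall x, `|f x| <= M) -> (forall x, `|g x| <= N) ->
  `|psi_prod i f g u| <= M * N.
Proof. by move=> Hf Hg; rewrite normrM ler_pM. Qed.

Let bb x : `|b x| <= 1. Proof. by case: (profile_bound hb x). Qed.
Let Ebb x : `|Eb x| <= 10. Proof. by case: (profile_bound hb x). Qed.
Let EEbb x : `|EEb x| <= 110. Proof. by case: (profile_bound hb x). Qed.

Lemma sign_le1 (x : R) : `| `|x| / x| <= 1.
Proof.
have [->|x0] := eqVneq x 0; first by rewrite invr0 mulr0 normr0.
by rewrite normrM normfV normr_id divff // normr_eq0.
Qed.

(** The three terms contribute 1, 10 beta and 10. *)
Lemma psi_factor_bound i u : `|psi_factor i u| <= 11 + 10 * beta.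
Proof.
have B1 := psi_prod_bound i u bb bb; have B2 := psi_prod_bound i u Ebb bb.
have B3 := psi_prod_bound i u bb Ebb.
have b0 := inv_alpha_gt0.
rewrite /psi_factor (le_trans (ler_normD _ _)) //.
have : `|psi_prod i b b u - beta * psi_prod i Eb b u| <= 1 + beta * 10.
  rewrite (le_trans (ler_normB _ _)) // lerD //; first by rewrite (le_trans B1) ?mulr1.
  by rewrite normrM (gtr0_norm b0) ler_pM2l // (le_trans B2) // mulr1.
by move: B3; rewrite mul1r; lra.
Qed.

Lemma psi_partial_bound i (u : 'rV[R]_2) :
  `|psi_partial i u| <= `|u 0 (other i)| * (11 + 10 * beta).
Proof.
rewrite /psi_partial !normrM normr_id -mulrA ler_wpM2l //.
have := sign_le1 (u 0 i); have := psi_factor_bound i u.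
rewrite !normrM.
have := normr_ge0 (psi_factor i u).
have : 0 <= `| `|u 0 i| | * `|(u 0 i)^-1| by rewrite mulr_ge0.
nra.
Qed.

(** Once expanded, the coefficients are c, 1, c^2, c, c, 1 in absolute value. This is the common
    shape of [psi_second] and [psi_mixed]. *)
Lemma euler_combination_bound (c M w1 w2 w3 w4 w5 w6 : R) : 0 <= c ->
  `|w1| <= M -> `|w2| <= M -> `|w3| <= M -> `|w4| <= M -> `|w5| <= M -> `|w6| <= M ->
  `|- c * w1 + w2 - c * (- c * w3 + w4) + (- c * w5 + w6)| <=
    M * (2 + 3 * c + c ^+ 2).
Proof.
move=> c0 H1 H2 H3 H4 H5 H6.
have S w : `|w| <= M -> `|c * w| <= c * M by move=> H; rewrite normrM ger0_norm // ler_wpM2l.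
have T1 := S _ H1; have T3 := S _ (H3); have T4 := S _ H4; have T5 := S _ H5.
have T33 : `|c ^+ 2 * w3| <= c ^+ 2 * M.
  by rewrite normrM normrX ger0_norm // ler_wpM2l // exprn_ge0.
clear S T3 H1 H3 H4 H5; move: T1 T33 T4 T5 H2 H6; rewrite !ler_norml.
move=> /andP[? ?] /andP[? ?] /andP[? ?] /andP[? ?] /andP[? ?] /andP[? ?].
by apply/andP; split; lra.
Qed.

(** The result of u_i d_i on [psi_factor i]; [psi_mixed] is the result of the same operator in the
    other coordinate. *)
Definition psi_second (i : 'I_2) (u : 'rV[R]_2) : R :=
  - beta * psi_prod i Eb b u + psi_prod i b Eb u
  - beta * (- beta * psi_prod i EEb b u + psi_prod i Eb Eb u)
  + (- beta * psi_prod i Eb Eb u + psi_prod i b EEb u).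

Definition psi_mixed (i : 'I_2) (u : 'rV[R]_2) : R :=
  - beta * psi_prod i b Eb u + psi_prod i Eb b u
  - beta * (- beta * psi_prod i Eb Eb u + psi_prod i EEb b u)
  + (- beta * psi_prod i b EEb u + psi_prod i Eb Eb u).

Let C2 := 110 * (2 + 3 * beta + beta ^+ 2).

(** Each product of two among [b], [euler b] and [euler (euler b)] that occurs is at most 110, the
    extreme cases being 110 * 1 and 10 * 10. *)
Lemma psi_second_bound i u : `|psi_second i u| <= C2 /\ `|psi_mixed i u| <= C2.
Proof.
have b0 := ltW inv_alpha_gt0.
have S (f g : R -> R) (M N : R) : M * N <= 110 -> (forall x, `|f x| <= M) ->
    (forall x, `|g x| <= N) -> `|psi_prod i f g u| <= 110.
  by move=> MN Hf Hg; apply: le_trans MN; exact: psi_prod_bound.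
have L1 : 10 * 1 <= 110 :> R by lra.
have L2 : 1 * 10 <= 110 :> R by lra.
have L3 : 10 * 10 <= 110 :> R by lra.
have L4 : 1 * 110 <= 110 :> R by lra.
have L5 : 110 * 1 <= 110 :> R by lra.
have B1 := S _ _ _ _ L1 Ebb bb; have B2 := S _ _ _ _ L2 bb Ebb.
have B3 := S _ _ _ _ L3 Ebb Ebb; have B4 := S _ _ _ _ L4 bb EEbb.
have B5 := S _ _ _ _ L5 EEbb bb.
split; first exact: (euler_combination_bound b0 B1 B2 B5 B3 B3 B4).
exact: (euler_combination_bound b0 B2 B1 B3 B5 B4 B3).
Qed.

Lemma psi_second_vanish (i j : 'I_2) u : psi_arg j u < 2^-1 -> psi_second i u = 0.
Proof.
move=> H; rewrite /psi_second !(@psi_prod_vanish _ _ _ _ j) // ?(mulr0, addr0, subr0) //.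
all: by move=> x /(profile_lt12 hb)[H1 H2 H3]; rewrite ?H1 ?H2 ?H3.
Qed.

Lemma is_derive_psi_factor (i : 'I_2) (u : 'rV[R]_2) : u 0 i != 0 ->
  is_derive u (delta_mx 0 i) (psi_factor i) (psi_second i u / u 0 i).
Proof.
move=> ui; have D0 := derivable_profile hb; have D1 := derivable_euler_profile hb.
have H1 := is_derive_psi_prod ui D0 D0.
have H2 := is_derive_mul (is_derive_cst beta u (delta_mx 0 i)) (is_derive_psi_prod ui D1 D0).
have H3 := is_derive_psi_prod ui D0 D1.
have H := is_deriveD (is_deriveB H1 H2) H3.
apply: (is_derive_eq H); rewrite /psi_second /cst; field.
by rewrite ui alpha_neq0.
Qed.

Lemma is_derive_psi_factor_other (i : 'I_2) (u : 'rV[R]_2) : u 0 (other i) != 0 ->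
  is_derive u (delta_mx 0 (other i)) (psi_factor i) (psi_mixed i u / u 0 (other i)).
Proof.
move=> ui; have D0 := derivable_profile hb; have D1 := derivable_euler_profile hb.
have H1 := is_derive_psi_prod ui D0 D0.
have H2 := is_derive_mul (is_derive_cst beta u (delta_mx 0 (other i)))
  (is_derive_psi_prod ui D0 D1).
have H3 := is_derive_psi_prod ui D1 D0.
have H := is_deriveD (is_deriveB H1 H2) H3.
apply: is_derive_ext (is_derive_eq H _) _; last first.
  by move=> v; rewrite /psi_factor !(psi_prodC i).
rewrite /psi_mixed /cst !(psi_prodC i); field.
by rewrite ui alpha_neq0.
Qed.

Lemma psi_partial_near0 (i j : 'I_2) (u v : 'rV[R]_2) : u 0 j != 0 ->
  u 0 (other j) = 0 -> is_derive u v (psi_partial i) 0.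
Proof.
move=> uo ui.
have [V [oV Vu HV]] := psi_near_axis uo ui.
apply: (is_derive_near oV Vu) (is_derive_cst 0 u _) => w /HV H.
by rewrite /psi_partial (psi_factor_vanish i H) mulr0.
Qed.

(* [psi_partial i] is supported where [|u_i| >= |u_(other i)|^beta / 2]. *)
Lemma psi_partial_dir (i : 'I_2) (u : 'rV[R]_2) : u 0 (other i) != 0 ->
  exists2 d : R, is_derive u (delta_mx 0 i) (psi_partial i) d &
    `|d| <= 2 * C2 * (`|u 0 (other i)| / `|u 0 (other i)| `^ beta).
Proof.
move=> uo; have B := (psi_second_bound i u).1.
have C20 : 0 <= C2 := le_trans (normr_ge0 _) B.
have Q0 : 0 <= 2 * C2 * (`|u 0 (other i)| / `|u 0 (other i)| `^ beta).
  by apply: mulr_ge0; [exact: mulr_ge0|apply: divr_ge0 => //; exact: powR_ge0].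
have [ui|ui] := eqVneq (u 0 i) 0.
  exists 0; last by rewrite normr0.
  by apply: (psi_partial_near0 _ _ uo); rewrite rev_ordK.
exists (`|u 0 (other i)| * (`|u 0 i| / u 0 i) * (psi_second i u / u 0 i)).
  have H := is_derive_mul (is_derive_mul (is_derive_other_coord i u Num.norm)
    (is_derive_sign_coord i ui)) (is_derive_psi_factor ui).
  by apply: (is_derive_eq H); rewrite mul0r mulr0 addr0 mul0r add0r.
have [H|H] := ltP (psi_arg (other i) u) 2^-1.
  rewrite (psi_second_vanish _ H).
  by rewrite mul0r mulr0 normr0.
have n0 : 0 < `|u 0 i| by rewrite normr_gt0.
have p0 : 0 < `|u 0 (other i)| `^ beta by rewrite powR_gt0 // normr_gt0.
rewrite /psi_arg rev_ordK ler_pdivlMr // in H.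
rewrite !normrM !normfV !normr_id divff ?gt_eqF // mulr1.
have -> : 2 * C2 * (`|u 0 (other i)| / `|u 0 (other i)| `^ beta) =
  `|u 0 (other i)| * (C2 * (2 / `|u 0 (other i)| `^ beta)) by ring.
rewrite ler_wpM2l // ler_pM ?invr_ge0 //.
by rewrite -[X in X <= _]mul1r ler_pdivrMr // mulrAC ler_pdivlMr // mul1r; lra.
Qed.

(** The factor |u_(other i)| of [psi_partial i] compensates the division by u_(other i) in the
    derivative of [psi_factor i], so nothing blows up in this direction. *)
Lemma psi_partial_other (i : 'I_2) (u : 'rV[R]_2) : u 0 i != 0 ->
  exists2 d : R, is_derive u (delta_mx 0 (other i)) (psi_partial i) d &
    `|d| <= 11 + 10 * beta + C2.
Proof.
move=> ui; have B := (psi_second_bound i u).2; have B' := psi_factor_bound i u.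
have C20 : 0 <= C2 := le_trans (normr_ge0 _) B.
have C0 : 0 <= 11 + 10 * beta := le_trans (normr_ge0 _) B'.
have [uo|uo] := eqVneq (u 0 (other i)) 0.
  exists 0; last by rewrite normr0 addr_ge0.
  exact: (psi_partial_near0 _ _ ui uo).
exists ((`|u 0 (other i)| / u 0 (other i)) * (`|u 0 i| / u 0 i) * psi_factor i u +
  (`|u 0 (other i)| / u 0 (other i)) * (`|u 0 i| / u 0 i) * psi_mixed i u).
  have H := is_derive_mul (is_derive_mul (is_derive_norm_coord uo)
    (is_derive_sign_coord (other i) ui)) (is_derive_psi_factor_other uo).
  by apply: (is_derive_eq H); field; rewrite ui uo.
rewrite (le_trans (ler_normD _ _)) // !normrM !normfV !normr_id !divff ?normr_eq0 //.
by rewrite !mul1r lerD.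
Qed.

Lemma mean_value_bound (V : normedModType R) (f : V -> R) u v (M : R) :
  (forall t : R, 0 <= t <= 1 -> exists2 d : R, is_derive (t *: v + u) v f d & `|d| <= M) ->
  `|f (v + u) - f u| <= M.
Proof.
move=> H; have H' (t : R) : 0 <= t <= 1 ->
    is_derive (t *: v + u) v f ('D_v f (t *: v + u)).
  by move=> /H[d [D _] _]; exact: derivableP.
have [t t01 ->] := mean_value_segment H'.
by have [d [_ <-]] := H t t01.
Qed.

(** Put T = |w_(other i)|. If |a| >= T^beta, both values are at most a constant times T <=
    |a|^alpha. Otherwise the derivative bound gives a multiple of |a| T^(1 - beta), which is at most
    |a|^alpha because |a|^(1 - alpha) <= T^(beta - 1). *)
Lemma psi_partial_holder_dir (i : 'I_2) (w : 'rV[R]_2) (a : R) :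
  `|psi_partial i (a *: delta_mx 0 i + w) - psi_partial i w| <=
  2 * (11 + 10 * beta + C2) * `|a| `^ alpha.
Proof.
have C20 : 0 <= C2 := le_trans (normr_ge0 _) (psi_second_bound i w).1.
have C0 : 0 <= 11 + 10 * beta := le_trans (normr_ge0 _) (psi_factor_bound i w).
have Eo (c : R) : (c *: delta_mx 0 i + w) 0 (other i) = w 0 (other i).
  by rewrite !mxE /= (negbTE (other_neq i)) mulr0 add0r.
have a0 : 0 <= 2 * (11 + 10 * beta + C2) * `|a| `^ alpha.
  by apply: mulr_ge0; [apply: mulr_ge0 => //; exact: addr_ge0|exact: powR_ge0].
have [w0|w0] := eqVneq (w 0 (other i)) 0.
  by rewrite !psi_partial0 ?subr0 ?normr0 //; right; rewrite ?Eo.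
pose T := `|w 0 (other i)|; have T0 : 0 < T by rewrite normr_gt0.
have Tb : 0 < T `^ beta by rewrite powR_gt0.
have [le|lt] := leP (T `^ beta) `|a|.
  have Ta : T <= `|a| `^ alpha.
    have -> : T = (T `^ beta) `^ alpha.
      by rewrite -powRrM mulVf ?alpha_neq0 // powRr1 // ltW.
    by apply: ge0_ler_powR; rewrite ?nnegrE ?(ltW Tb) //; case/andP: alpha01 => /ltW.
  have B1 := psi_partial_bound i (a *: delta_mx 0 i + w).
  have B2 := psi_partial_bound i w; rewrite Eo -/T in B1; rewrite -/T in B2.
  rewrite (le_trans (ler_normB _ _)) // (le_trans (lerD B1 B2)) //.
  have : 0 <= C2 * `|a| `^ alpha by rewrite mulr_ge0 // powR_ge0.
  nra.
have [aE|an0] := eqVneq a 0; first by rewrite {1}aE scale0r add0r subrr normr0.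
have an : 0 < `|a| by rewrite normr_gt0.
have H : `|psi_partial i (a *: delta_mx 0 i + w) - psi_partial i w| <=
    `|a| * (2 * C2 * (T / T `^ beta)).
  apply: mean_value_bound => t _.
  have := @psi_partial_dir i (t *: (a *: delta_mx 0 i) + w).
  rewrite scalerA Eo => /(_ w0)[d Hd Bd].
  exists (a * d); first exact: is_derive_scale_dir.
  by rewrite normrM ler_wpM2l.
have E : `|a| * (T / T `^ beta) <= `|a| `^ alpha.
  have -> : T / T `^ beta = ((T `^ beta) `^ (1 - alpha))^-1.
    rewrite -powRrM mulrBr mulr1 mulVf ?alpha_neq0 // powRB ?(gt_eqF T0) ?implybT //.
    by rewrite powRr1 ?ltW // invf_div.
  rewrite ler_pdivrMr ?powR_gt0 //.
  have {1}-> : `|a| = `|a| `^ alpha * `|a| `^ (1 - alpha).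
    by rewrite -powRD ?(gt_eqF an) ?implybT // addrC subrK powRr1 // ltW.
  rewrite ler_pM2l ?powR_gt0 //; apply: ge0_ler_powR; rewrite ?nnegrE ?(ltW Tb) ?(ltW lt) //.
  by rewrite subr_ge0; case/andP: alpha01 => _ /ltW.
rewrite (le_trans H) //.
have -> : `|a| * (2 * C2 * (T / T `^ beta)) = 2 * C2 * (`|a| * (T / T `^ beta)) by ring.
apply: ler_pM => //; first by rewrite mulr_ge0.
- by apply: mulr_ge0 => //; apply: divr_ge0; exact: ltW.
by rewrite ler_pM2l // lerDr.
Qed.

Lemma psi_partial_lipschitz_other (i : 'I_2) (w : 'rV[R]_2) (a : R) :
  `|psi_partial i (a *: delta_mx 0 (other i) + w) - psi_partial i w| <=
  (11 + 10 * beta + C2) * `|a|.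
Proof.
have C20 : 0 <= C2 := le_trans (normr_ge0 _) (psi_second_bound i w).1.
have C0 : 0 <= 11 + 10 * beta := le_trans (normr_ge0 _) (psi_factor_bound i w).
have Eo (c : R) : (c *: delta_mx 0 (other i) + w) 0 i = w 0 i.
  by rewrite !mxE /= eq_sym (negbTE (other_neq i)) mulr0 add0r.
have [w0|w0] := eqVneq (w 0 i) 0.
  rewrite !psi_partial0 ?subr0 ?normr0; try by left; rewrite ?Eo.
  by apply: mulr_ge0 => //; exact: addr_ge0.
rewrite mulrC; apply: mean_value_bound => t _.
have := @psi_partial_other i (t *: (a *: delta_mx 0 (other i)) + w).
rewrite scalerA Eo => /(_ w0)[d Hd Bd].
exists (a * d); first exact: is_derive_scale_dir.
by rewrite normrM ler_wpM2l.
Qed.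

Lemma row2_decomp (i : 'I_2) (v w : 'rV[R]_2) :
  v = (v 0 i - w 0 i) *: delta_mx 0 i +
      ((v 0 (other i) - w 0 (other i)) *: delta_mx 0 (other i) + w).
Proof.
apply/rowP => j; rewrite !mxE /=.
case: (ord2_cases i j) => ->.
  by rewrite eqxx eq_sym (negbTE (other_neq i)) mulr0 mulr1 add0r subrK.
by rewrite eqxx (negbTE (other_neq i)) mulr0 mulr1 add0r subrK.
Qed.

Lemma holder_near_psi_partial (i : 'I_2) (u : 'rV[R]_2) :
  holder_near alpha u (psi_partial i).
Proof.
have C20 : 0 <= C2 := le_trans (normr_ge0 _) (psi_second_bound i u).1.
have C0 : 0 <= 11 + 10 * beta := le_trans (normr_ge0 _) (psi_factor_bound i u).
pose K := 11 + 10 * beta + C2; have K0 : 0 <= K by exact: addr_ge0.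
exists (3 * K), (ball u 2^-1); split; first by apply: nbhsx_ballx; rewrite invr_gt0.
move=> v w; rewrite -ball_normE /= => Bv Bw.
have vw1 : `|v - w| <= 1.
  rewrite -(subrKA u) (le_trans (ler_normD _ _)) // (distrC v).
  have -> : 1 = 2^-1 + 2^-1 :> R by field.
  by rewrite lerD // ltW.
have [a0 a1] := andP alpha01.
have N j : `|v 0 j - w 0 j| <= `|v - w| by have := rV_coord_le (v - w) j; rewrite !mxE.
have P j : `|v 0 j - w 0 j| `^ alpha <= `|v - w| `^ alpha.
  by apply: ge0_ler_powR; rewrite ?nnegrE // ltW.
have L : `|v - w| <= `|v - w| `^ alpha.
  by apply: le_powR_unit; rewrite ?a0 ?(ltW a1) ?normr_ge0.
(* From [w] to [m] only the coordinate [other i] changes, at cost [K]; from [m] to [v] only the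
   coordinate [i] does, at cost [2 * K]. *)
pose m := (v 0 (other i) - w 0 (other i)) *: delta_mx 0 (other i) + w.
rewrite -(subrKA (psi_partial i m)) (le_trans (ler_normD _ _)) //.
have H1 := psi_partial_holder_dir i m (v 0 i - w 0 i).
have H2 := psi_partial_lipschitz_other i w (v 0 (other i) - w 0 (other i)).
rewrite -/m -/K in H2; rewrite -row2_decomp -/K in H1.
have -> : 3 * K * `|v - w| `^ alpha = 2 * K * `|v - w| `^ alpha + K * `|v - w| `^ alpha by ring.
apply: lerD; first by apply: (le_trans H1); rewrite ler_wpM2l // mulr_ge0.
by apply: (le_trans H2); rewrite ler_wpM2l // (le_trans (N _)).
Qed.

Lemma holder_near_continuous (f : 'rV[R]_2 -> R) u :
  holder_near alpha u f -> {for u, continuous f}.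
Proof.
case=> C [V [NV H]]; apply/(@cvgrPdist_le _ _ _ (nbhs u)) => e e0.
have [a0 a1] := andP alpha01.
(* The radius whose power alpha is e / (|C| + 1); the added 1 covers C = 0. *)
pose d := (e / (`|C| + 1)) `^ beta.
have C1 : 0 < `|C| + 1 by rewrite ltr_wpDl.
have d0 : 0 < d by rewrite powR_gt0 // divr_gt0.
have ND : \forall w \near u, `|u - w| < d.
  by apply/nbhs_ballP; exists d => // w; rewrite -ball_normE.
near=> w.
have Vu : V u by exact: nbhs_singleton.
have Vw : V w by near: w.
have uwd : `|u - w| < d by near: w.
apply: (le_trans (H _ _ Vu Vw)).
have P : `|u - w| `^ alpha <= e / (`|C| + 1).
  have -> : e / (`|C| + 1) = d `^ alpha.
    by rewrite /d -powRrM mulVf ?alpha_neq0 // powRr1 // divr_ge0 // ltW.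
  by apply: ge0_ler_powR; rewrite ?nnegrE ?(ltW d0) ?(ltW uwd) ?(ltW a0).
apply: (@le_trans _ _ (`|C| * (e / (`|C| + 1)))).
  apply: (@le_trans _ _ (`|C| * `|u - w| `^ alpha)); last by rewrite ler_wpM2l.
  by rewrite ler_wpM2r ?powR_ge0 // ler_norm.
by rewrite mulrA ler_pdivrMr // mulrC ler_pM2l // lerDl.
Unshelve. all: by end_near. Qed.

Lemma C1holder_psi : C1holder_on alpha setT (psi alpha b).
Proof.
apply: (@C1holder_intro _ _ _ _ _ psi_partial).
- exact: openT.
- by move=> i u _; exact: is_derive_psi.
- by move=> i; split=> // u _; exact: holder_near_continuous (holder_near_psi_partial i u).
- by move=> i u _; exact: holder_near_psi_partial.
Qed.

Lemma Ck_psi m : Ck_on m [set u : 'rV[R]_2 | u != 0] (psi alpha b).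
Proof.
apply: Ck_local => u /= u0.
have vanish (j : 'I_2) : u 0 j != 0 -> u 0 (other j) = 0 ->
    exists V : set 'rV[R]_2, [/\ open V, V u & Ck_on m V (psi alpha b)].
  move=> uj uo; have [V [oV Vu HV]] := psi_near_axis uj uo; exists V; split=> //.
  by apply: Ck_eq (Ck_cst m 0 oV) => // v /HV H; rewrite (psi_vanish H).
have [u00|u00] := eqVneq (u 0 0) 0.
  apply: (vanish (other 0)); rewrite ?rev_ordK //; apply: contra u0 => /eqP uo.
  by apply/eqP/rowP => j; rewrite mxE; case: (ord2_cases 0 j) => ->.
have [uo|uo] := eqVneq (u 0 (other 0)) 0; first exact: (vanish 0).
pose D := [set v : 'rV[R]_2 | v 0 0 != 0] `&` [set v : 'rV[R]_2 | v 0 (other 0) != 0].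
have oD : open D.
  by apply: openI; apply: (@open_comp _ _ (fun v : 'rV[R]_2 => v 0 _) [set x | x != 0]);
    [move=> v _; exact: coord_continuous|exact: open_neq
    |move=> v _; exact: coord_continuous|exact: open_neq].
exists D; split=> //.
have Dn j v : D v -> v 0 j != 0 by case=> /= H1 H2; case: (ord2_cases 0 j) => ->.
have Cn j : Ck_on m D (fun v : 'rV[R]_2 => `|v 0 j|).
  by apply: (Ck_norm oD) => [v /Dn//|]; exact: Ck_coord.
have Cs j : Ck_on m D (psi_arg j).
  apply: (Ck_mul oD (Cn _)); apply: (Ck_comp_inv oD).
    by move=> v /Dn H; rewrite gt_eqF // powR_gt0 // normr_gt0.
  by apply: (Ck_powR _ oD _ (Cn _)) => v /Dn H; rewrite normr_gt0.
have Cb j := Ck_smooth_comp oD hb.1 (Cs j) 0.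
apply: Ck_eq (Ck_mul oD (Ck_mul oD (Cn 0) (Cn (other 0))) (Ck_mul oD (Cb 0) (Cb (other 0)))) => //.
by move=> v _; rewrite (psiE 0).
Qed.

End Psi.

(** * Rigidity of the round coordinates *)

Section Schwarz.
Context {R : realType} {n : nat}.
Implicit Types (f : 'rV[R]_n -> R) (u v w c : 'rV[R]_n).

Lemma is_derive_translate f u v c (d : R) : is_derive (u + c) v f d ->
  is_derive u v (fun w => f (w + c)) d.
Proof.
rewrite -{1}[u]add0r -(scale0r v) -addrA => /is_derive_lineP H.
rewrite -[u]add0r -(scale0r v); apply/is_derive_lineP.
by apply: is_derive_ext H _ => s; rewrite addrA.
Qed.

(** Two mean value theorems, one in each direction. The left side is symmetric in [i] and [j], which
    is what forces the mixed derivatives to agree. *)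
Lemma mixed_difference f (D : set 'rV[R]_n) i j u (h r : R) :
  open D -> Ck_on 2 D f -> ball u r `<=` D -> 0 < h -> 2 * h < r ->
  exists2 w, ball u r w &
    f (h *: delta_mx 0 i + h *: delta_mx 0 j + u) - f (h *: delta_mx 0 i + u)
    - f (h *: delta_mx 0 j + u) + f u = h ^+ 2 * partial j (partial i f) w.
Proof.
move=> oD Cf BD h0 hr.
have r0 : 0 < r by lra.
pose ei : 'rV[R]_n := h *: delta_mx 0 i; pose ej : 'rV[R]_n := h *: delta_mx 0 j.
have inB (s t : R) : 0 <= s <= 1 -> 0 <= t <= 1 -> ball u r (s *: ei + t *: ej + u).
  move=> /andP[s0 s1] /andP[t0 t1]; apply/(rV_ballP u _ r0) => k.
  rewrite !mxE addrK eqxx /=.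
  have P (x : R) (q : bool) : 0 <= x -> x <= 1 -> `|x * (h * q%:R)| <= h.
    move=> x0 x1; case: q; rewrite ?mulr0 ?normr0 ?(ltW h0) // mulr1.
    by rewrite ger0_norm ?ler_piMl ?mulr_ge0 // ltW.
  apply: le_lt_trans (ler_normD _ _) _; apply: le_lt_trans hr.
  by rewrite mulr_natl mulr2n lerD // P.
pose g w := f (w + ej) - f w.
have Hg (s : R) : 0 <= s <= 1 -> is_derive (s *: ei + u) ei g
    (h * (partial i f (s *: ei + ej + u) - partial i f (s *: ei + u))).
  move=> s01; apply: is_derive_scale_dir.
  have B1 : ball u r (s *: ei + ej + u).
    by have := inB s 1 s01; rewrite scale1r; apply; rewrite ler01 lexx.
  have B2 : ball u r (s *: ei + u).
    by have := inB s 0 s01; rewrite scale0r addr0; apply; rewrite ler01 lexx.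
  have D1 : is_derive (s *: ei + u) (delta_mx 0 i) (fun w => f (w + ej))
      (partial i f (s *: ei + ej + u)).
    by apply: is_derive_translate; rewrite -addrA [u + _]addrC addrA;
      apply: Ck_is_derive Cf (BD _ B1).
  exact: (is_deriveB D1 (Ck_is_derive i Cf (BD _ B2))).
have [s s01 Es] := mean_value_segment Hg.
have Hk (t : R) : 0 <= t <= 1 -> is_derive (t *: ej + (s *: ei + u)) ej (partial i f)
    (h * partial j (partial i f) (t *: ej + (s *: ei + u))).
  move=> t01; set w := _ + _.
  have Dw : D w by apply: BD; rewrite /w addrA [t *: _ + _]addrC; exact: inB.
  have H := @Ck_is_derive R n 0 D (partial i f) j w (Ck_partial i Cf) Dw.
  exact: (@is_derive_scale_dir R _ (partial i f) w (delta_mx 0 j) h _ H).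
have [t t01 Et] := mean_value_segment Hk.
exists (t *: ej + (s *: ei + u)); first by rewrite addrA [t *: _ + _]addrC; exact: inB.
rewrite expr2 -mulrA -Et -/ei -/ej.
have -> : ej + (s *: ei + u) = s *: ei + ej + u by rewrite addrCA addrA.
by rewrite -Es /g (addrAC ei u ej) (addrC u ej) opprB addrA addrAC.
Qed.

(** The two mixed derivatives are known to agree only at different points of each small ball;
    continuity brings the equality to [u]. *)
Lemma continuous_eq_of_near_values (D : set 'rV[R]_n) (p q : 'rV[R]_n -> R) u :
  open D -> D u -> {for u, continuous p} -> {for u, continuous q} ->
  (forall r : R, 0 < r -> ball u r `<=` D ->
    exists w1 w2, [/\ ball u r w1, ball u r w2 & p w1 = q w2]) -> p u = q u.
Proof.
move=> oD Du Cp Cq H.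
suff d0 : forall e : R, 0 < e -> `|p u - q u| <= e + e.
  apply/eqP; rewrite -subr_eq0 -normr_eq0 eq_le normr_ge0 andbT.
  by apply/ler_addgt0Pr => e e0; rewrite add0r (splitr e); apply: d0; rewrite divr_gt0.
move=> e e0.
have N : \forall w \near u, [/\ D w, `|p u - p w| <= e & `|q u - q w| <= e].
  have /cvgrPdist_le /(_ e e0) N1 := Cp; have /cvgrPdist_le /(_ e e0) N2 := Cq.
  by near=> w; split; near: w => //; exact: nbhs_open.
have [r r0 Hr] := near_exists_ball N.
have BD : ball u r `<=` D by move=> w /Hr[].
have [w1 [w2 [B1 B2 E]]] := H r r0 BD.
have [_ H1 _] := Hr _ B1; have [_ _ H2] := Hr _ B2.
rewrite -(subrKA (p w1)) (le_trans (ler_normD _ _)) //.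
by rewrite lerD // E distrC.
Unshelve. all: by end_near. Qed.

Lemma Schwarz f (D : set 'rV[R]_n) i j u : open D -> Ck_on 2 D f -> D u ->
  partial i (partial j f) u = partial j (partial i f) u.
Proof.
move=> oD Cf Du; apply: (continuous_eq_of_near_values oD Du).
- exact: (Ck_continuous (Ck_partial i (Ck_partial j Cf)) Du).
- exact: (Ck_continuous (Ck_partial j (Ck_partial i Cf)) Du).
(* A third of the radius leaves room for both displacements of length [h]. *)
move=> r r0 BD; pose h := r / 3; have h0 : 0 < h by rewrite divr_gt0.
have hr : 2 * h < r by rewrite /h; lra.
have [w1 B1 E1] := mixed_difference i j oD Cf BD h0 hr.
have [w2 B2 E2] := mixed_difference j i oD Cf BD h0 hr.
exists w2, w1; split; [exact: B2|exact: B1|].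
have hh : h ^+ 2 != 0 by rewrite expf_neq0 // gt_eqF.
move: E1 E2; set p := partial i _; set q := partial j _.
rewrite (addrC (h *: delta_mx 0 j) (h *: delta_mx 0 i)) (addrAC (f _)) => -> /(mulfI hh) E.
exact: (esym E).
Qed.

End Schwarz.

Section Harmonic.
Context {R : realType}.

Lemma zero_derivative_segment (V : normedModType R) (f : V -> R) u v :
  (forall t : R, 0 <= t <= 1 -> is_derive (t *: v + u) v f 0) -> f (v + u) = f u.
Proof.
move=> H; have [t _ /eqP] := mean_value_segment H.
by rewrite subr_eq0 => /eqP.
Qed.

(* [F cos - G sin] and [F sin + G cos] are first integrals of [F' = G],
   [G' = -F]. *)
Lemma harmonic_line (n : nat) (i : 'I_n) (F G : 'rV[R]_n -> R) (u : 'rV[R]_n) (r : R) :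
  u 0 i = 0 ->
  (forall t : R, 0 <= t <= 1 ->
    let w := t *: (r *: delta_mx 0 i) + u in
    is_derive w (delta_mx 0 i) F (G w) /\ is_derive w (delta_mx 0 i) G (- F w)) ->
  F (r *: delta_mx 0 i + u) = F u * cos r + G u * sin r.
Proof.
move=> ui H; set v := r *: delta_mx 0 i in H *.
have Dc (w : 'rV[R]_n) :
    is_derive w (delta_mx 0 i) (fun z : 'rV[R]_n => cos (z 0 i)) (- sin (w 0 i)).
  have := is_derive_comp1 (is_derive_coord w (delta_mx 0 i) 0 i) (is_derive_cos (w 0 i)).
  by rewrite mxE !eqxx mulr1.
have Ds (w : 'rV[R]_n) : is_derive w (delta_mx 0 i) (fun z : 'rV[R]_n => sin (z 0 i)) (cos (w 0 i)).
  have := is_derive_comp1 (is_derive_coord w (delta_mx 0 i) 0 i) (is_derive_sin (w 0 i)).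
  by rewrite mxE !eqxx mulr1.
have vi : (v + u) 0 i = r by rewrite !mxE !eqxx mulr1 ui addr0.
have EA : F (v + u) * cos r - G (v + u) * sin r = F u.
  have := @zero_derivative_segment _ (fun w => F w * cos (w 0 i) - G w * sin (w 0 i)) u v.
  rewrite /= vi ui cos0 sin0 mulr1 mulr0 subr0; apply=> t /H[HF HG].
  rewrite -(mulr0 r); apply: is_derive_scale_dir.
  have := is_deriveB (is_derive_mul HF (Dc _)) (is_derive_mul HG (Ds _)).
  by move=> H'; apply: (is_derive_eq H'); ring.
have EB : F (v + u) * sin r + G (v + u) * cos r = G u.
  have := @zero_derivative_segment _ (fun w => F w * sin (w 0 i) + G w * cos (w 0 i)) u v.
  rewrite /= vi ui cos0 sin0 mulr1 mulr0 add0r; apply=> t /H[HF HG].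
  rewrite -(mulr0 r); apply: is_derive_scale_dir.
  have := is_deriveD (is_derive_mul HF (Ds _)) (is_derive_mul HG (Dc _)).
  by move=> H'; apply: (is_derive_eq H'); ring.
rewrite -EA -EB -[LHS]mulr1 -(cos2Dsin2 r); ring.
Qed.

End Harmonic.

(** * The moving frame of the round coordinates *)

Section Rigidity.
Context {R : realType}.

(** Taken componentwise, so that the results on [Ck_on], which concern real functions, apply to maps
    into R^3. *)
Definition vpartial (i : 'I_2) (F : 'rV[R]_2 -> 'rV[R]_3) (u : 'rV[R]_2) : 'rV[R]_3 :=
  \row_j partial i (fun v => F v 0 j) u.

Definition vCk (m : nat) (D : set 'rV[R]_2) (F : 'rV[R]_2 -> 'rV[R]_3) : Prop :=
  forall j, Ck_on m D (fun u => F u 0 j).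

Lemma vCk_partial m D F i : vCk m.+1 D F -> vCk m D (vpartial i F).
Proof.
move=> H j; have := Ck_partial i (H j); set g := partial i _.
by rewrite (_ : g = fun u => vpartial i F u 0 j) //; apply/funext => u; rewrite mxE.
Qed.

Lemma vpartialE (i : 'I_2) (F : 'rV[R]_2 -> 'rV[R]_3) (u : 'rV[R]_2) :
  (forall j, derivable (fun v : 'rV[R]_2 => F v 0 j) u (delta_mx 0 i)) ->
  'D_(delta_mx 0 i) F u = vpartial i F u.
Proof.
move=> H; rewrite derive_mx; last by apply/derivable_mxP => k j; rewrite [k]ord1.
by apply/rowP => j; rewrite !mxE.
Qed.

Lemma dotpC n (v w : 'rV[R]_n) : dotp v w = dotp w v.
Proof. by apply: eq_bigr => i _; rewrite mulrC. Qed.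

Lemma dotpDl n (v v' w : 'rV[R]_n) : dotp (v + v') w = dotp v w + dotp v' w.
Proof. by rewrite /dotp -big_split; apply: eq_bigr => i _; rewrite !mxE mulrDl. Qed.

Lemma is_derive_dotp m D (F G : 'rV[R]_2 -> 'rV[R]_3) i u :
  vCk m.+1 D F -> vCk m.+1 D G -> D u ->
  is_derive u (delta_mx 0 i) (fun v => dotp (F v) (G v))
    (dotp (vpartial i F u) (G u) + dotp (F u) (vpartial i G u)).
Proof.
move=> HF HG Du.
have H (j : 'I_3) := is_derive_mul (Ck_is_derive i (HF j) Du) (Ck_is_derive i (HG j) Du).
have := is_derive_sum H; move=> H'.
apply: is_derive_ext (is_derive_eq H' _) _; last by move=> v; rewrite fct_sumE.
by rewrite /dotp -big_split; apply: eq_bigr => j _; rewrite !mxE.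
Qed.

Lemma dotp_const m D (F G : 'rV[R]_2 -> 'rV[R]_3) (c : 'rV[R]_2 -> R) i u (d : R) :
  open D -> vCk m.+1 D F -> vCk m.+1 D G -> D u ->
  (forall v, D v -> dotp (F v) (G v) = c v) -> is_derive u (delta_mx 0 i) c d ->
  dotp (vpartial i F u) (G u) + dotp (F u) (vpartial i G u) = d.
Proof.
move=> oD HF HG Du E Hc.
have [_ <-] := is_derive_near oD Du (fun v Dv => esym (E v Dv)) Hc.
by case: (is_derive_dotp i HF HG Du).
Qed.

(** The matrix with rows [A], [B], [C] has Gram matrix diag (1, 1, |C|^2), hence is invertible, and
    it annihilates [w]. *)
Lemma orthogonal_frame_eq0 (A B C w : 'rV[R]_3) :
  dotp A A = 1 -> dotp B B = 1 -> dotp C C != 0 ->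
  dotp A B = 0 -> dotp A C = 0 -> dotp B C = 0 ->
  dotp w A = 0 -> dotp w B = 0 -> dotp w C = 0 -> w = 0.
Proof.
move=> AA BB CC AB AC BC wA wB wC.
pose r (i : 'I_3) : 'rV[R]_3 := nth 0 [:: A; B; C] i.
pose M : 'M[R]_3 := \matrix_(i, j) r i 0 j.
have Mw : w *m M^T = 0.
  apply/rowP => i; rewrite !mxE.
  transitivity (dotp w (r i)); first by apply: eq_bigr => j _; rewrite !mxE.
  by case: i => -[|[|[|]]].
have MM : M *m M^T = diag_mx (\row_i [:: 1; 1; dotp C C]`_i).
  apply/matrixP => i j; rewrite !mxE.
  transitivity (dotp (r i) (r j)); first by apply: eq_bigr => l _; rewrite !mxE.
  have BA : dotp B A = 0 by rewrite dotpC.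
  have CA : dotp C A = 0 by rewrite dotpC.
  have CB : dotp C B = 0 by rewrite dotpC.
  by case: i j => -[|[|[|]]] // Hi [[|[|[|]]] // Hj]; rewrite /= ?mulr1n ?mulr0n.
have U : M^T \in unitmx.
  have : M *m M^T \in unitmx.
    rewrite MM unitmxE det_diag !big_ord_recl big_ord0 !mxE /= !mul1r mulr1.
    by rewrite unitfE.
  by rewrite unitmx_mul => /andP[].
by rewrite -[w](mulmxK U) Mw mul0mx.
Qed.

Lemma vpartial_coord i F u j :
  vpartial i F u 0 j = partial i (fun v => F v 0 j) u.
Proof. by rewrite mxE. Qed.

#[local] Opaque vpartial partial.

Lemma orthonormal_rows (A B C : 'rV[R]_3) :
  dotp A A = 1 -> dotp B B = 1 -> dotp C C = 1 ->
  dotp A B = 0 -> dotp A C = 0 -> dotp B C = 0 ->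
  orthogonal_mx (\matrix_(i < 3, j < 3) (nth 0 [:: A; B; C] i : 'rV[R]_3) 0 j).
Proof.
move=> AA BB CC AB AC BC; apply/matrixP => i j; rewrite !mxE.
pose r (i : 'I_3) : 'rV[R]_3 := nth 0 [:: A; B; C] i.
transitivity (dotp (r i) (r j)); first by apply: eq_bigr => l _; rewrite !mxE.
have BA : dotp B A = 0 by rewrite dotpC.
have CA : dotp C A = 0 by rewrite dotpC.
have CB : dotp C B = 0 by rewrite dotpC.
by case: i j => -[|[|[|]]] // Hi [[|[|[|]]] // Hj].
Qed.

(* In the application the vectors are a position [X], its first derivatives
   [A], [B] and its second derivatives [AA], [AB], [BB]. *)
Lemma moving_frame_equations (X A B AA AB BB : 'rV[R]_3) (c s : R) : c != 0 ->
  dotp X X = 1 -> dotp A A = 1 -> dotp A B = 0 -> dotp B B = c ^+ 2 ->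
  dotp A X = 0 -> dotp B X = 0 ->
  dotp AA X + dotp A A = 0 -> dotp AB X + dotp A B = 0 -> dotp BB X + dotp B B = 0 ->
  dotp AA A = 0 -> dotp AB A = 0 ->
  dotp AA B + dotp A AB = 0 -> dotp AB B + dotp A BB = 0 ->
  dotp AB B + dotp B AB = - 2 * (c * s) -> dotp BB B + dotp B BB = 0 ->
  AA = - X /\ (c = 1 -> s = 0 -> AB = 0 /\ BB = - X).
Proof.
move=> c0 XX AA1 AB0 BB1 AX BX p0 p1 p2 q0 q1 r0 r1 t0 t1.
have CC : dotp B B != 0 by rewrite BB1 expf_neq0.
have XA : dotp X A = 0 by rewrite dotpC.
have XB : dotp X B = 0 by rewrite dotpC.
have F := orthogonal_frame_eq0 XX AA1 CC XA XB AB0.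
have s2 : dotp AA B = 0 by rewrite -r0 (dotpC A) q1 addr0.
have b1 : dotp BB B = 0 by move: t1; rewrite (dotpC B BB); lra.
have a1 : dotp AB B = - (c * s) by move: t0; rewrite (dotpC B AB); lra.
have E w : w + X = 0 -> w = - X by move=> /eqP; rewrite addr_eq0 => /eqP.
split.
  apply: E; apply: F; rewrite dotpDl.
  - by move: p0; rewrite AA1 XX.
  - by rewrite q0 XA addr0.
  - by rewrite s2 XB addr0.
(* The values c = 1 and s = 0 belong to the equator r = 0, the only parallel along which the
   equations are integrated. *)
move=> c1 s0; rewrite c1 s0 in a1 BB1; split.
  apply: F => //; last by rewrite a1 mulr0 oppr0.
  by move: p1; rewrite AB0 addr0.
apply: E; apply: F; rewrite dotpDl.
- by move: p2; rewrite BB1 XX expr1n.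
- by rewrite (dotpC BB) XA addr0; move: r1; rewrite a1 mulr0 oppr0 add0r.
- by rewrite b1 XB addr0.
Qed.

Lemma cos_gt0_small (t : R) : `|t| < pi / 2 -> 0 < cos t.
Proof. by rewrite ltr_norml => H; exact: cos_gt0_pihalf. Qed.

Variables (U : set 'rV[R]_2) (x : 'rV[R]_2 -> 'rV[R]_3).
Hypothesis oU : open U.
Hypothesis Cx : forall m, vCk m U x.
Hypothesis xx : forall u, U u -> dotp (x u) (x u) = 1.

Local Notation x0 := (vpartial 0 x).
Local Notation x1 := (vpartial 1 x).
Hypothesis x00 : forall u, U u -> dotp (x0 u) (x0 u) = 1.
Hypothesis x01 : forall u, U u -> dotp (x0 u) (x1 u) = 0.
Hypothesis x11 : forall u, U u -> dotp (x1 u) (x1 u) = cos (u 0 0) ^+ 2.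

Let C0 : vCk 2 U x0. Proof. by apply: vCk_partial; exact: Cx. Qed.
Let C1 : vCk 2 U x1. Proof. by apply: vCk_partial; exact: Cx. Qed.

Let half (a : R) : a + a = 0 -> a = 0.
Proof. by move=> H; lra. Qed.

Lemma x_perp (i : 'I_2) u : U u -> dotp (vpartial i x u) (x u) = 0.
Proof.
move=> Uu; apply: half; rewrite {2}dotpC.
exact: (@dotp_const 0 U x x (cst 1) i u 0 oU (Cx 1) (Cx 1) Uu xx (is_derive_cst _ _ _)).
Qed.

Lemma mixed_vpartial u : U u -> vpartial 0 x1 u = vpartial 1 x0 u.
Proof.
move=> Uu; apply/rowP => j; rewrite [LHS]vpartial_coord [RHS]vpartial_coord.
have E (a : 'I_2) : (fun v => vpartial a x v 0 j) = partial a (fun v => x v 0 j).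
  by apply/funext => v; rewrite vpartial_coord.
rewrite !E; exact: (Schwarz 0 1 oU (Cx 2 j) Uu).
Qed.

Lemma is_derive_cos2 (i : 'I_2) (u : 'rV[R]_2) :
  is_derive u (delta_mx 0 i) (fun v : 'rV[R]_2 => cos (v 0 0) ^+ 2)
    (- 2 * (cos (u 0 0) * sin (u 0 0)) * (delta_mx 0 i : 'rV[R]_2) 0 0).
Proof.
have H := is_derive_comp1 (is_derive_coord u (delta_mx 0 i) 0 0) (is_derive_cos (u 0 0)).
apply: is_derive_ext (is_derive_eq (is_derive_mul H H) _) _ => /=; last by [].
by ring.
Qed.

(** The meridians and the equator are unit speed great circles, so their acceleration is - x; along
    the equator the unit vector pointing north is constant. *)
Lemma frame_ode u : U u -> cos (u 0 0) != 0 ->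
  vpartial 0 x0 u = - x u /\
  (u 0 0 = 0 -> vpartial 1 x0 u = 0 /\ vpartial 1 x1 u = - x u).
Proof.
move=> Uu c0.
have Z (c : R) i := is_derive_cst c u (delta_mx 0 i : 'rV[R]_2).
have p0 := fun i => dotp_const oU C0 (Cx 2) Uu (x_perp 0) (Z 0 i).
have p1 := dotp_const oU C1 (Cx 2) Uu (x_perp 1) (Z 0 1).
have q0 i : dotp (vpartial i x0 u) (x0 u) = 0.
  by apply: half; rewrite {2}dotpC; exact: (dotp_const oU C0 C0 Uu x00 (Z 1 i)).
have q01 := fun i => dotp_const oU C0 C1 Uu x01 (Z 0 i).
have q1 := fun i => dotp_const oU C1 C1 Uu x11 (is_derive_cos2 i u).
have e00 : (delta_mx 0 0 : 'rV[R]_2) 0 0 = 1 by rewrite mxE.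
have e10 : (delta_mx 0 1 : 'rV[R]_2) 0 0 = 0 by rewrite mxE.
have M := mixed_vpartial Uu.
have r0 := q01 0; rewrite M in r0.
have t0 := q1 0; rewrite M e00 mulr1 in t0.
have t1 := q1 1; rewrite e10 mulr0 in t1.
have [H1 H2] := moving_frame_equations c0 (xx Uu) (x00 Uu) (x01 Uu) (x11 Uu)
  (x_perp 0 Uu) (x_perp 1 Uu) (p0 0) (p0 1) p1 (q0 0) (q0 1) r0 (q01 1) t0 t1.
split; first exact: H1.
by move=> u0; move: H2; rewrite u0 cos0 sin0 => H; exact: (H erefl erefl).
Qed.

(** From the origin one goes along the equator to the foot point [m] of [u], carrying the constant
    vector [x0], and then along the meridian from [m] to [u]. *)
Lemma rigid_coordinates (a : R) : 0 <= a < pi / 2 -> square a `<=` U ->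
  exists P : 'M[R]_3, [/\ orthogonal_mx P, row 0 P = x 0 &
    forall u, square a u -> x u = spherical P (u 0 0) (u 0 1)].
Proof.
move=> /andP[a0 api] aU.
pose row0 : 'rV[R]_2 := 0.
have S0 : square a row0 by move=> i; rewrite mxE normr0.
have U0 := aU _ S0.
have o01 : (1 : 'I_2) != 0 by [].
have c0 u : square a u -> cos (u 0 0) != 0.
  by move=> Su; rewrite gt_eqF // cos_gt0_small // (le_lt_trans (Su 0)).
have Sscale (i : 'I_2) (u : 'rV[R]_2) (r t : R) : square a u -> u 0 i = 0 -> `|r| <= a ->
    0 <= t <= 1 -> square a (t *: (r *: delta_mx 0 i) + u).
  move=> Su ui ra /andP[t0 t1] j; rewrite !mxE /=.
  case: (eqVneq j i) => [->|ji]; last by rewrite !mulr0 add0r; exact: Su.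
  rewrite mulr1 ui addr0 normrM ger0_norm //.
  by apply: le_trans ra; rewrite ler_piMl.
(* The order of the rows is that of [spherical]: the terms cos r cos t, cos r sin t and sin r
   multiply the position, the theta direction and the r direction at the origin. *)
pose P : 'M[R]_3 := \matrix_(i < 3, j < 3) (nth 0 [:: x 0; x1 0; x0 0] i : 'rV[R]_3) 0 j.
exists P; split.
- have C := x11 U0; rewrite mxE cos0 expr1n in C.
  by apply: (orthonormal_rows (xx U0) C (x00 U0)); rewrite dotpC;
    [exact: x_perp|exact: x_perp|exact: x01].
- by apply/rowP => j; rewrite !mxE.
move=> u Su.
pose m := u 0 1 *: (delta_mx 0 1 : 'rV[R]_2) + 0.
have m0 : m 0 0 = 0 by rewrite !mxE /= mulr0 addr0.
have uE : u = u 0 0 *: delta_mx 0 0 + m.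
  rewrite /m addr0; apply/rowP => j; rewrite !mxE /=.
  case: j => -[|[|]] // Hj; rewrite /= ?mulr1 ?mulr0 ?addr0 ?add0r.
    by congr (u _ _); apply/val_inj.
  by congr (u _ _); apply/val_inj.
have Sm : square a m.
  by have := Sscale 1 0 (u 0 1) 1 S0; rewrite mxE scale1r; apply; rewrite ?Su ?ler01 ?lexx.
have D i (F : 'rV[R]_2 -> 'rV[R]_3) k v j : vCk k.+1 U F -> U v ->
    is_derive v (delta_mx 0 i) (fun w => F w 0 j) (vpartial i F v 0 j).
  by move=> H Uv; rewrite vpartial_coord; exact: Ck_is_derive (H j) Uv.
have E1 j : x u 0 j = x m 0 j * cos (u 0 0) + x0 m 0 j * sin (u 0 0).
  rewrite {1}uE; apply: (@harmonic_line _ _ 0 (fun w => x w 0 j) (fun w => x0 w 0 j)) => // t t01 w.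
  have Sw : square a w by apply: Sscale.
  have Uw := aU _ Sw; split; first exact: (D 0 x 0 w j (Cx 1) Uw).
  have [H _] := frame_ode Uw (c0 _ Sw).
  by have := D 0 x0 1 w j C0 Uw; rewrite H mxE.
have E2 j : x m 0 j = x 0 0 j * cos (u 0 1) + x1 0 0 j * sin (u 0 1).
  apply: (@harmonic_line _ _ 1 (fun w => x w 0 j) (fun w => x1 w 0 j)) => [|t t01 w].
    by rewrite mxE.
  have Sw : square a w by apply: Sscale; rewrite ?mxE.
  have Uw := aU _ Sw; split; first exact: (D 1 x 0 w j (Cx 1) Uw).
  have [_ H] := frame_ode Uw (c0 _ Sw).
  have w0 : w 0 0 = 0 by rewrite !mxE /= !mulr0 addr0.
  by have := D 1 x1 1 w j C1 Uw; rewrite (H w0).2 mxE.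
have E3 j : x0 m 0 j = x0 0 0 j.
  apply: (@zero_derivative_segment _ _ (fun w => x0 w 0 j)) => t t01.
  rewrite -(mulr0 (u 0 1)); apply: is_derive_scale_dir; set w := _ + _.
  have Sw : square a w by apply: Sscale; rewrite ?mxE.
  have Uw := aU _ Sw.
  have [_ H] := frame_ode Uw (c0 _ Sw).
  have w0 : w 0 0 = 0 by rewrite !mxE /= !mulr0 addr0.
  by have := D 1 x0 1 w j C0 Uw; rewrite (H w0).1 mxE.
apply/rowP => j; rewrite E1 E2 E3 !mxE !big_ord_recl big_ord0 !mxE /=; ring.
Qed.

End Rigidity.

(** * Scalar curvature of diagonal metrics *)

Section OrthogonalMetric.
Context {R : realType} {n : nat}.
Variables (G : 'rV[R]_n -> 'M[R]_n) (D : set 'rV[R]_n).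
Variables (d : 'I_n -> 'rV[R]_n -> R) (lam : 'I_n -> 'I_n -> 'rV[R]_n -> R).
Hypothesis oD : open D.
Hypothesis d0 : forall a v, D v -> d a v != 0.
Hypothesis GE : forall v, D v -> G v = diag_mx (\row_a d a v).
Hypothesis Hd : forall a i v, D v ->
  is_derive v (delta_mx 0 i) (d a) (2 * lam a i v * d a v).

Lemma partial_diag_metric i j l v : D v ->
  partial i (fun w => G w j l) v = (j == l)%:R * (2 * lam j i v * d j v).
Proof.
move=> Dv.
have H := is_derive_mul (is_derive_cst ((j == l)%:R : R) v (delta_mx 0 i)) (Hd j i Dv).
have E w : D w -> cst ((j == l)%:R : R) w * d j w = G w j l.
  move=> Dw; rewrite GE // !mxE /cst /=.
  by case: eqVneq => [->|_]; rewrite ?mul1r ?mul0r ?mulr1n ?mulr0n.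
have [_ H'] := is_derive_near oD Dv E H.
by rewrite /partial H' mul0r add0r.
Qed.

Lemma invmx_diag_metric v k l : D v ->
  invmx (G v) k l = (k == l)%:R * (d k v)^-1.
Proof.
move=> Dv; have E : G v *m diag_mx (\row_a (d a v)^-1) = 1%:M.
  rewrite GE // mulmx_diag; apply/matrixP => i j; rewrite !mxE.
  by case: eqVneq => [_|//]; rewrite divff // d0.
have U : G v \in unitmx by case/mulmx1_unit: E.
have -> : invmx (G v) = diag_mx (\row_a (d a v)^-1).
  by rewrite -[RHS](mulKmx U) E mulmx1.
rewrite !mxE; case: eqVneq => [->|_]; by rewrite ?mul1r ?mul0r.
Qed.

(** Symbols with three distinct indices vanish; in terms of [lam], half the logarithmic derivatives
    of the entries, the others need no derivative of the matrix. *)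
Definition diag_christoffel (k i j : 'I_n) (v : 'rV[R]_n) : R :=
  (j == k)%:R * lam k i v + (i == k)%:R * lam k j v
  - (i == j)%:R * (d i v / d k v * lam i k v).

Lemma christoffel_diag k i j v : D v ->
  christoffel G k i j v = diag_christoffel k i j v.
Proof.
move=> Dv; rewrite /christoffel (bigD1 k) //= big1 ?addr0; last first.
  move=> l lk; rewrite invmx_diag_metric // eq_sym (negbTE lk).
  by rewrite !mul0r.
rewrite invmx_diag_metric // eqxx !partial_diag_metric // /diag_christoffel.
have dk := d0 k Dv.
have Ej : (j == k)%:R * (lam j i v * d j v) = (j == k)%:R * (lam k i v * d k v).
  by case: eqVneq => [->|_]; rewrite ?mul0r.
have Ei : (i == k)%:R * (lam i j v * d i v) = (i == k)%:R * (lam k j v * d k v).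
  by case: eqVneq => [->|_]; rewrite ?mul0r.
transitivity ((d k v)^-1 * ((j == k)%:R * (lam j i v * d j v) +
    (i == k)%:R * (lam i j v * d i v) - (i == j)%:R * (lam i k v * d i v))).
  by rewrite /=; field; rewrite dk.
by rewrite Ej Ei; field; rewrite dk.
Qed.

Variable u : 'rV[R]_n.
Hypothesis Du : D u.
Variable dlam : 'I_n -> 'I_n -> R.
Hypothesis Hlam : forall a i, is_derive u (delta_mx 0 i) (lam a i) (dlam a i).

Definition diag_riemann (l k : 'I_n) : R :=
  - (d k u / d l u * (2 * lam k l u * (lam k l u - lam l l u) + dlam k l))
  - dlam l k
  + \sum_(m < n) (diag_christoffel l l m u * diag_christoffel m k k u
                  - diag_christoffel l k m u * diag_christoffel m l k u).

Lemma riemann_diag l k : l != k -> riemann G l k l k u = diag_riemann l k.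
Proof.
move=> lk; rewrite /riemann /diag_riemann; congr (_ + _); last first.
  by apply: eq_bigr => m _; rewrite !christoffel_diag.
have E1 w : D w -> - (d k w * (d l w)^-1 * lam k l w) = christoffel G l k k w.
  move=> Dw; rewrite christoffel_diag // /diag_christoffel eqxx.
  by rewrite eq_sym (negbTE lk) !mul0r !add0r mul1r.
have E2 w : D w -> lam l k w = christoffel G l l k w.
  move=> Dw; rewrite christoffel_diag // /diag_christoffel eqxx.
  by rewrite (negbTE lk) eq_sym (negbTE lk) !mul0r add0r subr0 mul1r.
have H1 := is_deriveN (is_derive_mul (is_derive_mul (Hd k l Du)
  (is_derive_inv (d0 l Du) (Hd l l Du))) (Hlam k l)).
have [_ P1] := is_derive_near oD Du E1 H1.
have [_ P2] := is_derive_near oD Du E2 (Hlam l k).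
rewrite /partial P1 P2; congr (_ - _).
by field; rewrite d0.
Qed.

(** The sectional curvature of the coordinate plane (l, k) of an orthogonal metric. Directions
    outside the plane enter only through a product of first derivatives. *)
Definition diag_sectional (l k : 'I_n) : R :=
  - ((d l u)^-1 * (dlam k l + lam k l u ^+ 2 - lam k l u * lam l l u))
  - (d k u)^-1 * (dlam l k + lam l k u ^+ 2 - lam l k u * lam k k u)
  - \sum_(m < n | (m != l) && (m != k)) (d m u)^-1 * (lam l m u * lam k m u).

Lemma diag_riemann_sectional l k : l != k ->
  (d k u)^-1 * diag_riemann l k = diag_sectional l k.
Proof.
move=> lk; have kl : k != l by rewrite eq_sym.
rewrite /diag_riemann /diag_sectional (bigD1 l) //= (bigD1 k) //=.
set S := \sum_(i < n | _) _; set S' := \sum_(m < n | _) _.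
have -> : S = - (d k u * S').
  rewrite /S /S' mulr_sumr -sumrN; apply: eq_bigr => m /andP[ml mk].
  rewrite /diag_christoffel !eqxx ?(eq_sym l m) ?(eq_sym k m).
  rewrite (negbTE ml) (negbTE mk) ?(negbTE lk) ?(negbTE kl) /=.
  by rewrite !(mul0r, mul1r, subr0, sub0r, addr0, add0r); ring.
rewrite /diag_christoffel !eqxx ?(negbTE lk) ?(negbTE kl) /=.
have dk := d0 k Du; have dl := d0 l Du.
move: (d k u) (d l u) dk dl (lam k l u) (lam l l u) (lam l k u) (lam k k u) S'.
move=> x y x0 y0 a b c e S'.
rewrite !(mul0r, mul1r, subr0, sub0r, addr0, add0r) !divff // !mul1r.
by field; rewrite x0 y0.
Qed.

(** The inverse metric is diagonal, so only diagonal Ricci terms count, and in these the index l = k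
    drops out by antisymmetry. *)
Lemma scalar_curvature_diag :
  scalar_curvature G u = \sum_(k < n) \sum_(l < n | l != k) diag_sectional l k.
Proof.
apply: eq_bigr => k _; rewrite (bigD1 k) //= big1 ?addr0; last first.
  by move=> j jk; rewrite invmx_diag_metric // eq_sym (negbTE jk) !mul0r.
rewrite invmx_diag_metric // eqxx mul1r /ricci mulr_sumr (bigD1 k) //=.
have -> : riemann G k k k k u = 0.
  rewrite /riemann subrr add0r big1 // => m _.
  by rewrite subrr.
rewrite mulr0 add0r; apply: eq_bigr => l lk.
by rewrite riemann_diag // diag_riemann_sectional.
Qed.

End OrthogonalMetric.

(** * Curvature of the twisted metric in latitude and longitude *)

Section TwistedMetric.
Context {R : realType}.
Variables (G : 'rV[R]_3 -> 'M[R]_3) (D : set 'rV[R]_3) (F : 'rV[R]_3 -> R).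
Hypothesis oD : open D.
Hypothesis CF : Ck_on 2 D F.
Hypothesis F0 : forall v, D v -> F v != 0.
Hypothesis c0 : forall v, D v -> cos (v 0 0) != 0.
Hypothesis F2 : forall v, D v -> partial ord_max F v = 0.
Hypothesis GE : forall v, D v -> G v =
  diag_mx (\row_a [:: F v ^- 2; F v ^- 2 * cos (v 0 0) ^+ 2; F v ^+ 2]`_a).

Let p v := partial 0 F v / F v.
Let q v := partial 1 F v / F v.
Let T (v : 'rV[R]_3) := sin (v 0 0) / cos (v 0 0).

Let twist_d (a : 'I_3) (v : 'rV[R]_3) : R :=
  [:: F v ^- 2; F v ^- 2 * cos (v 0 0) ^+ 2; F v ^+ 2]`_a.

(* [twist_lam a i] is half the logarithmic derivative of the [a]-th diagonal
   entry in the direction [i]. *)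
Let twist_lam (a i : 'I_3) (v : 'rV[R]_3) : R :=
  (nth [::] [:: [:: - p v; - q v; 0]; [:: - p v - T v; - q v; 0]; [:: p v; q v; 0]] a)`_i.

Lemma ord3_cases (i : 'I_3) : [\/ i = 0, i = 1 | i = ord_max].
Proof.
by case: i => -[|[|[|]]] // ?;
  [apply: Or31|apply: Or32|apply: Or33]; apply/val_inj.
Qed.

Lemma sum_ord3 (P : pred 'I_3) (E : 'I_3 -> R) : \sum_(i | P i) E i =
  (if P 0 then E 0 else 0) + (if P 1 then E 1 else 0) +
  (if P ord_max then E ord_max else 0).
Proof.
have S (f : 'I_3 -> R) : \sum_i f i = f 0 + f 1 + f ord_max.
  rewrite !big_ord_recl big_ord0 addr0 addrA.
  by congr (_ + f _ + f _); apply/val_inj.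
by rewrite big_mkcond (S (fun i => if P i then E i else 0)).
Qed.

Let is_derive_F0 v : D v -> is_derive v (delta_mx 0 0) F (p v * F v).
Proof. by move=> Dv; apply: is_derive_eq (Ck_is_derive 0 CF Dv) _; rewrite divfK // F0. Qed.

Let is_derive_F1 v : D v -> is_derive v (delta_mx 0 1) F (q v * F v).
Proof. by move=> Dv; apply: is_derive_eq (Ck_is_derive 1 CF Dv) _; rewrite divfK // F0. Qed.

Let is_derive_F2 v : D v -> is_derive v (delta_mx 0 ord_max) F 0.
Proof. by move=> Dv; apply: is_derive_eq (Ck_is_derive ord_max CF Dv) _; rewrite F2. Qed.

Let is_derive_cos_coord (v : 'rV[R]_3) i :
  is_derive v (delta_mx 0 i) (fun w : 'rV[R]_3 => cos (w 0 0))
    (- sin (v 0 0) * (0 == i)%:R).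
Proof.
have H := is_derive_comp1 (is_derive_coord v (delta_mx 0 i) 0 0) (is_derive_cos (v 0 0)).
by apply: (is_derive_eq H); rewrite mxE eqxx.
Qed.

Let is_derive_entries (i : 'I_3) v (l : R) : D v -> is_derive v (delta_mx 0 i) F (l * F v) ->
  [/\ is_derive v (delta_mx 0 i) (fun w => F w ^- 2) (2 * - l * F v ^- 2),
      is_derive v (delta_mx 0 i) (fun w => F w ^- 2 * cos (w 0 0) ^+ 2)
        (2 * (- l - (0 == i)%:R * T v) * (F v ^- 2 * cos (v 0 0) ^+ 2)) &
      is_derive v (delta_mx 0 i) (fun w => F w ^+ 2) (2 * l * F v ^+ 2)].
Proof.
move=> Dv H.
have H2 := is_derive_mul H H.
have FF : F v * F v != 0 by rewrite mulf_neq0 ?F0.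
have H1 := @is_derive_inv _ _ (fun w => F w * F w) _ _ _ FF H2.
have C := is_derive_cos_coord v i.
have C2 := is_derive_mul C C.
have Fv := F0 Dv; have cv := c0 Dv.
split.
- by apply: is_derive_ext (is_derive_eq H1 _) _ => //; field; rewrite Fv.
- apply: is_derive_ext (is_derive_eq (is_derive_mul H1 C2) _) _ => //.
  by rewrite /T; field; rewrite Fv cv.
- by apply: is_derive_ext (is_derive_eq H2 _) _ => //; ring.
Qed.

Let is_derive_twist_d a i v : D v ->
  is_derive v (delta_mx 0 i) (twist_d a) (2 * twist_lam a i v * twist_d a v).
Proof.
move=> Dv; rewrite /twist_d /twist_lam.
have [A0 A1 A2] := is_derive_entries Dv (is_derive_F0 Dv).
have [B0 B1 B2] := is_derive_entries Dv (is_derive_F1 Dv).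
have Z : is_derive v (delta_mx 0 ord_max) F (0 * F v) by rewrite mul0r; exact: is_derive_F2.
have [E0 E1 E2] := is_derive_entries Dv Z.
rewrite eqxx mul1r in A1.
have e1 : ((0 : 'I_3) == 1) = false by [].
have e2 : ((0 : 'I_3) == ord_max) = false by [].
rewrite e1 mul0r subr0 in B1; rewrite e2 mul0r subr0 oppr0 in E1; rewrite oppr0 in E0.
by case: (ord3_cases a) => ->; case: (ord3_cases i) => ->.
Qed.

Lemma scalar_curvature_twisted u : D u -> scalar_curvature G u =
  2 * F u ^+ 2 - 2 * (partial 0 F u ^+ 2 + partial 1 F u ^+ 2 / cos (u 0 0) ^+ 2).
Proof.
move=> Du.
have Cinv : Ck_on 1 D (fun v => (F v)^-1) by apply: Ck_comp_inv => //; exact: Ck_le CF.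
have Cp : Ck_on 1 D p by exact: (Ck_mul oD (Ck_partial 0 CF) Cinv).
have Cq : Ck_on 1 D q by exact: (Ck_mul oD (Ck_partial 1 CF) Cinv).
(* The derivatives of [p] along 0 and of [q] along 1 stay unknown: they carry the second derivatives
   of [F], and they cancel. *)
have [p0 Hp] : exists p0 : R, is_derive u (delta_mx 0 0) p p0.
  by exists (partial 0 p u); exact: (Ck_is_derive 0 Cp Du).
have [q1 Hq] : exists q1 : R, is_derive u (delta_mx 0 1) q q1.
  by exists (partial 1 q u); exact: (Ck_is_derive 1 Cq Du).
have HT : is_derive u (delta_mx 0 0) T (cos (u 0 0) ^- 2).
  have Hs := is_derive_comp1 (is_derive_coord u (delta_mx 0 0) 0 0) (is_derive_sin (u 0 0)).
  have := is_derive_mul Hs 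
    (@is_derive_inv _ _ (fun w : 'rV[R]_3 => cos (w 0 0)) _ _ _ (c0 Du)
      (is_derive_cos_coord u 0)).
  move=> H; apply: (is_derive_eq H); rewrite mxE !eqxx /= !mulr1.
  transitivity ((cos (u 0 0) ^+ 2 + sin (u 0 0) ^+ 2) / cos (u 0 0) ^+ 2).
    by field; exact: c0.
  by rewrite cos2Dsin2 mul1r.
pose dlam (a i : 'I_3) : R := (nth [::] [:: [:: - p0; - q1; 0];
  [:: - p0 - cos (u 0 0) ^- 2; - q1; 0]; [:: p0; q1; 0]] a)`_i.
have Hlam a i : is_derive u (delta_mx 0 i) (twist_lam a i) (dlam a i).
  rewrite /dlam.
  have Hp' := is_deriveN Hp; have Hq' := is_deriveN Hq; have HpT := is_deriveB Hp' HT.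
  case: (ord3_cases a) => ->; case: (ord3_cases i) => ->; [exact: Hp'|exact: Hq'
    |exact: is_derive_cst|exact: HpT|exact: Hq'|exact: is_derive_cst|exact: Hp
    |exact: Hq|exact: is_derive_cst].
have dne a v : D v -> twist_d a v != 0.
  move=> Dv; have Fv := F0 Dv; have cv := c0 Dv; rewrite /twist_d.
  by case: (ord3_cases a) => -> /=; rewrite ?mulf_neq0 ?invr_neq0 ?expf_neq0.
rewrite (scalar_curvature_diag oD dne GE is_derive_twist_d Du Hlam).
have Fu := F0 Du; have cu := c0 Du.
have -> : partial 0 F u = p u * F u by rewrite divfK.
have -> : partial 1 F u = q u * F u by rewrite divfK.
have e01 : ((0 : 'I_3) == 1) = false by [].
have e02 : ((0 : 'I_3) == ord_max) = false by [].
have e12 : ((1 : 'I_3) == ord_max) = false by [].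
have e10 : ((1 : 'I_3) == 0) = false by [].
have e20 : ((ord_max : 'I_3) == 0) = false by [].
have e21 : ((ord_max : 'I_3) == 1) = false by [].
rewrite /diag_sectional !sum_ord3 !eqxx !(e01, e02, e12, e10, e20, e21) /=.
have l00 : twist_lam 0 0 u = - p u by [].
have l01 : twist_lam 0 1 u = - q u by [].
have l02 : twist_lam 0 ord_max u = 0 by [].
have l10 : twist_lam 1 0 u = - p u - T u by [].
have l11 : twist_lam 1 1 u = - q u by [].
have l12 : twist_lam 1 ord_max u = 0 by [].
have l20 : twist_lam ord_max 0 u = p u by [].
have l21 : twist_lam ord_max 1 u = q u by [].
have l22 : twist_lam ord_max ord_max u = 0 by [].
have d0 : twist_d 0 u = F u ^- 2 by [].
have d1 : twist_d 1 u = F u ^- 2 * cos (u 0 0) ^+ 2 by [].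
have d2 : twist_d ord_max u = F u ^+ 2 by [].
have m01 : dlam 0 1 = - q1 by [].
have m02 : dlam 0 ord_max = 0 by [].
have m10 : dlam 1 0 = - p0 - cos (u 0 0) ^- 2 by [].
have m12 : dlam 1 ord_max = 0 by [].
have m20 : dlam ord_max 0 = p0 by [].
have m21 : dlam ord_max 1 = q1 by [].
rewrite !(l00, l01, l02, l10, l11, l12, l20, l21, l22, d0, d1, d2, m01, m02, m10, m12, m20, m21).
(* sec^2 - tan^2 = 1 is the curvature of the round sphere, the source of the term 2 phi^2. *)
have TT : cos (u 0 0) ^- 2 - T u ^+ 2 = 1.
  transitivity ((1 - sin (u 0 0) ^+ 2) / cos (u 0 0) ^+ 2); first by rewrite /T; field; exact: cu.
  have -> : 1 - sin (u 0 0) ^+ 2 = cos (u 0 0) ^+ 2 by rewrite -(cos2Dsin2 (u 0 0)) addrK.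
  by rewrite divff // expf_neq0.
transitivity (2 * F u ^+ 2 * (cos (u 0 0) ^- 2 - T u ^+ 2) -
    2 * ((p u * F u) ^+ 2 + (q u * F u) ^+ 2 / cos (u 0 0) ^+ 2)); last by rewrite TT mulr1.
move: Fu cu {TT}; move: (p u) (q u) (T u) (F u) (cos (u 0 0)) => P Q t f c f0 c0'.
rewrite !(mul0r, mulr0, mul1r, subr0, sub0r, addr0, add0r) expr0n /=
  !(mul0r, mulr0, subr0, addr0, oppr0, invrK).
by field; rewrite f0 c0'.
Qed.

End TwistedMetric.

(** * The functions phi and the twisted metric *)

Section SphericalCoordinates.
Context {R : realType}.

Lemma is_derive_pair (V W1 W2 : normedModType R) (f : V -> W1) (g : V -> W2) u v d e :
  is_derive u v f d -> is_derive u v g e ->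
  is_derive u v (fun w => (f w, g w)) (d, e).
Proof.
move=> [Df Ef] [Dg Eg].
have C : (h^-1 *: (((fun w => (f w, g w)) \o shift u) (h *: v) - (f u, g u)))
    @[h --> 0^'] --> (d, e).
  rewrite -Ef -Eg; exact: cvg_pair Df Dg.
split; first by apply/cvg_ex; exists (d, e).
exact: cvg_lim C.
Qed.

Lemma is_derive_mx_coords (V : normedModType R) m n (f : V -> 'M[R]_(m, n))
    (u v : V) (d : 'M[R]_(m, n)) :
  (forall i j, is_derive u v (fun w : V => f w i j) (d i j)) -> is_derive u v f d.
Proof.
move=> H; have D : derivable f u v by apply/derivable_mxP => i j; case: (H i j).
by split=> //; rewrite derive_mx //; apply/matrixP => i j; rewrite mxE; case: (H i j).
Qed.

Definition sph (r t : R) : 'rV[R]_3 :=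
  \row_(i < 3) [:: cos r * cos t; cos r * sin t; sin r]`_i.

Lemma sphericalE Q r t : spherical Q r t = sph r t *m Q.
Proof. by []. Qed.

Lemma dotp_mulmx_orthogonal n (Q : 'M[R]_n) (v w : 'rV[R]_n) :
  orthogonal_mx Q -> dotp (v *m Q) (w *m Q) = dotp v w.
Proof.
have dotpE (a b : 'rV[R]_n) : dotp a b = (a *m b^T) 0 0.
  by rewrite mxE; apply: eq_bigr => i _; rewrite mxE.
by move=> HQ; rewrite !dotpE trmx_mul mulmxA -(mulmxA v) HQ mulmx1.
Qed.

Lemma orthogonal_mxC n (Q : 'M[R]_n) : orthogonal_mx Q -> Q^T *m Q = 1%:M.
Proof. exact: mulmx1C. Qed.

Lemma orthogonal_mul_tr n (Q P : 'M[R]_n) :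
  orthogonal_mx Q -> orthogonal_mx P -> orthogonal_mx (Q *m P^T).
Proof.
move=> HQ HP; rewrite /orthogonal_mx trmx_mul trmxK mulmxA -(mulmxA Q).
by rewrite (orthogonal_mxC HP) mulmx1 HQ.
Qed.

Lemma dotp3E (v w : 'rV[R]_3) :
  dotp v w = v 0 0 * w 0 0 + v 0 1 * w 0 1 + v 0 ord_max * w 0 ord_max.
Proof. by rewrite /dotp sum_ord3. Qed.

Lemma sph0 r t : sph r t 0 0 = cos r * cos t. Proof. by rewrite mxE. Qed.
Lemma sph1 r t : sph r t 0 1 = cos r * sin t. Proof. by rewrite mxE. Qed.
Lemma sph2 r t : sph r t 0 ord_max = sin r. Proof. by rewrite mxE. Qed.

Lemma dotp_sph r t : dotp (sph r t) (sph r t) = 1.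
Proof.
rewrite dotp3E sph0 sph1 sph2.
transitivity (cos r ^+ 2 * (cos t ^+ 2 + sin t ^+ 2) + sin r ^+ 2); first by ring.
by rewrite cos2Dsin2 mulr1 cos2Dsin2.
Qed.

Definition latitude (y : 'rV[R]_3) : R := asin (y 0 ord_max).
(** The arctangent inverts the longitude only where [y 0 0 > 0], whence the restriction to a half
    sphere in what follows. *)
Definition longitude (y : 'rV[R]_3) : R := atan (y 0 1 / y 0 0).

Lemma unit_coord_bound (y : 'rV[R]_3) : dotp y y = 1 -> 0 < y 0 0 ->
  -1 < y 0 ord_max < 1.
Proof. rewrite dotp3E => H y0; apply/andP; split; nra. Qed.

Lemma sph_latitude_longitude (y : 'rV[R]_3) : dotp y y = 1 -> 0 < y 0 0 ->
  sph (latitude y) (longitude y) = y.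
Proof.
move=> Hy y0; have /andP[y2a y2b] := unit_coord_bound Hy y0.
rewrite dotp3E in Hy.
have y2 : -1 <= y 0 ord_max <= 1 by rewrite !ltW.
have cr : cos (latitude y) = Num.sqrt (y 0 0 ^+ 2 + y 0 1 ^+ 2).
  by rewrite /latitude cos_asin //; congr Num.sqrt; rewrite -Hy; ring.
have S0 : 0 < y 0 0 ^+ 2 + y 0 1 ^+ 2 by rewrite ltr_pwDl ?exprn_gt0 ?sqr_ge0.
have rt : Num.sqrt (1 + (y 0 1 / y 0 0) ^+ 2) = Num.sqrt (y 0 0 ^+ 2 + y 0 1 ^+ 2) / y 0 0.
  have -> : 1 + (y 0 1 / y 0 0) ^+ 2 = (y 0 0 ^+ 2 + y 0 1 ^+ 2) * (y 0 0)^-1 ^+ 2.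
    by field; rewrite gt_eqF.
  by rewrite sqrtrM ?ltW // sqrtr_sqr ger0_norm // invr_ge0 ltW.
have sq : Num.sqrt (y 0 0 ^+ 2 + y 0 1 ^+ 2) != 0 by rewrite gt_eqF // sqrtr_gt0.
have ct : cos (longitude y) = y 0 0 / Num.sqrt (y 0 0 ^+ 2 + y 0 1 ^+ 2).
  by rewrite /longitude cos_atan rt invf_div.
have st : sin (longitude y) = y 0 1 / Num.sqrt (y 0 0 ^+ 2 + y 0 1 ^+ 2).
  have c0 : cos (longitude y) != 0 by rewrite ct mulf_neq0 ?invr_neq0 // gt_eqF.
  have E : tan (longitude y) = y 0 1 / y 0 0 by rewrite /longitude atanK.
  have -> : sin (longitude y) = tan (longitude y) * cos (longitude y) by rewrite /tan divfK.
  by rewrite E ct; field; rewrite sq gt_eqF.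
apply/rowP => i; case: (ord3_cases i) => ->.
- by rewrite sph0 cr ct mulrC divfK.
- by rewrite sph1 cr st mulrC divfK.
- by rewrite sph2 /latitude asinK // in_itv.
Qed.

Lemma latitude_longitude_sph r t : `|r| < pi / 2 -> `|t| < pi / 2 ->
  latitude (sph r t) = r /\ longitude (sph r t) = t.
Proof.
move=> Hr Ht; have cr := cos_gt0_small Hr; have ct := cos_gt0_small Ht.
move: Hr Ht; rewrite !ltr_norml => /andP[r1 r2] /andP[t1 t2].
rewrite /latitude /longitude sph0 sph1 sph2; split.
  by rewrite sinK // in_itv /= !ltW.
have -> : cos r * sin t / (cos r * cos t) = tan t.
  by rewrite /tan; field; rewrite !gt_eqF.
by rewrite tanK // in_itv /= t1.
Qed.

Lemma latitude_lt_pihalf (y : 'rV[R]_3) : dotp y y = 1 -> 0 < y 0 0 ->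
  `|latitude y| < pi / 2.
Proof.
move=> Hy y0; have /andP[a b] := unit_coord_bound Hy y0.
by rewrite ltr_norml /latitude asin_gtNpi2 ?asin_ltpi2 ?a ?b ?ltW.
Qed.

(** The origin of sec^2(1/2) in [rho_star]: the cutoff is supported in |r| <= 2 rho <= 1/2. *)
Lemma cos_half_le (r : R) : `|r| <= 1 / 2 -> cos (1 / 2) <= cos r.
Proof.
move=> H; rewrite -(cos_norm r).
have p1 := @pihalf_ge1 R; have p2 : 1 <= pi :> R by lra.
have [->//|ne] := eqVneq `|r| (1 / 2).
rewrite ltW // ltr_cos ?in_itv /=.
- by rewrite lt_neqAle ne H.
- by rewrite normr_ge0 /=; lra.
- by apply/andP; split; lra.
Qed.

Lemma cos_half_gt0 : 0 < cos (1 / 2) :> R.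
Proof. by apply: cos_gt0_small; have := @pihalf_ge1 R; rewrite ger0_norm; lra. Qed.

End SphericalCoordinates.

(** * Bounds that the choice of rho_* provides *)

Section RhoStar.
Context {R : realType}.
Variables alpha k : R.
Hypothesis a0 : 0 < alpha.
Local Notation rho := (rho_star alpha k).
Local Notation secant := (Num.sqrt (1 + (cos (1 / 2)) ^- 2) : R).

Let k1 : 0 < 1 + `|k|. Proof. by rewrite ltr_pwDl. Qed.

Let C0 : 0 < 15 + 10 / alpha.
Proof. by rewrite addr_gt0 // divr_gt0. Qed.

Let S0 : 0 < secant.
Proof. by rewrite sqrtr_gt0 addr_gt0 // invr_gt0 exprn_gt0 // cos_half_gt0. Qed.

Lemma rho_star_gt0 : 0 < rho.
Proof. by rewrite /rho_star !lt_min !divr_gt0 // ?mulr_gt0. Qed.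

Lemma rho_star_le : rho <= 1 / 4.
Proof. by rewrite /rho_star ge_min lexx. Qed.

Lemma rho_star_mul_k : `|k| * rho <= 1 / 4.
Proof.
have : rho <= 1 / (4 * (1 + `|k|)) by rewrite /rho_star !ge_min lexx orbT.
rewrite ler_pdivlMr ?mulr_gt0 // => H; have := rho_star_gt0; lra.
Qed.

Lemma rho_star_mul_all : `|k| * (15 + 10 / alpha) * secant * rho <= 1 / 4.
Proof.
have : rho <= 1 / (4 * (1 + `|k|) * (15 + 10 / alpha) * secant).
  by rewrite /rho_star !ge_min lexx !orbT.
rewrite ler_pdivlMr ?mulr_gt0 // => H.
have : 0 <= (15 + 10 / alpha) * secant * rho.
  by rewrite !mulr_ge0 // ltW // rho_star_gt0.
move: H; move: (15 + 10 / alpha) (Num.sqrt _) rho `|k| => C S p K; lra.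
Qed.

End RhoStar.

Lemma four_sqr_le (R : realFieldType) (z : R) :
  0 <= z -> z <= 1 / 4 -> 4 * z ^+ 2 <= 1 / 4.
Proof. by move=> z0 z1; rewrite expr2; nra. Qed.

Section PhiLoc.
Context {R : realType}.
Variables (alpha k : R) (b : R -> R) (chi : 'rV[R]_2 -> R).
Hypothesis alpha01 : 0 < alpha < 1.
Hypothesis hb : step_profile b.
Hypothesis hchi : cutoff chi.

Local Notation rho := (rho_star alpha k).
Local Notation phil := (phi_loc alpha k b chi).

Let a0 : 0 < alpha. Proof. by case/andP: alpha01. Qed.
Let rho0 : 0 < rho. Proof. exact: rho_star_gt0. Qed.

Lemma dilate_out w : ~ square (2 * rho) w -> dilate rho chi w = 0.
Proof.
case: hchi => _ [_ _ H] Hw; apply: H => Hs; apply: Hw => i.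
have := Hs i; rewrite !mxE normrM ger0_norm ?invr_ge0 ?(ltW rho0) //.
by rewrite mulrC ler_pdivrMr.
Qed.

Lemma phi_loc_out w : ~ square (2 * rho) w -> phil w = 1.
Proof. by move=> H; rewrite /phi_loc dilate_out // mulr0 mul0r addr0. Qed.

Lemma psi_bound (i : 'I_2) w : `|psi alpha b w| <= `|w 0 i| * `|w 0 (rev_ord i)|.
Proof.
have bb y : `|b y| <= 1 by case: (profile_bound hb y).
rewrite (psiE alpha b i) normrM normrM !normr_id -[X in _ <= X]mulr1 ler_wpM2l ?mulr_ge0 //.
by have := @psi_prod_bound R alpha i b b w 1 1 bb bb; rewrite mulr1.
Qed.

Lemma dilate_bound w : 0 <= dilate rho chi w <= 1.
Proof. by case: hchi => _ [H _ _]; exact: H. Qed.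

Lemma square_small w i : square (2 * rho) w -> `|w 0 i| <= 2 * rho /\ `|w 0 i| <= 1 / 2.
Proof. by move=> /(_ i) H; split=> //; have := rho_star_le alpha k; lra. Qed.

Lemma phi_loc_close w : `|phil w - 1| <= 1 / 4.
Proof.
have [Hs|Hs] := pselect (square (2 * rho) w); last first.
  by rewrite phi_loc_out // subrr normr0; lra.
have [w0 w0'] := square_small 0 Hs; have [w1 w1'] := square_small (rev_ord 0) Hs.
have /andP[d0 d1] := dilate_bound w.
rewrite /phi_loc [1 + _]addrC addrK !normrM (ger0_norm d0).
have P := psi_bound 0 w.
have K := rho_star_mul_k k a0.
(* One coordinate is bounded by 2 rho, the other by 1/2. *)
have P' : `|psi alpha b w| <= rho.
  apply: (le_trans P); apply: (@le_trans _ _ (2 * rho * (1 / 2))); last by lra.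
  exact: ler_pM.
apply: le_trans K; rewrite -mulrA ler_wpM2l //.
by rewrite -[X in _ <= X]mul1r ler_pM.
Qed.

Lemma Ck_dilate m : Ck_on m setT (dilate rho chi).
Proof.
case: hchi => Hs _.
apply: (@Ck_comp R 2 2 m setT setT (fun u => rho^-1 *: u) chi openT openT) => //.
move=> j; apply: Ck_eq openT _ (Ck_mul openT (Ck_cst m rho^-1 openT) (Ck_coord m j openT)).
by move=> u _; rewrite mxE.
Qed.

Lemma Ck_phi_loc m : Ck_on m [set u : 'rV[R]_2 | u != 0] phil.
Proof.
have oD : open [set u : 'rV[R]_2 | u != 0].
  rewrite (_ : mkset _ = Num.norm @^-1` [set y : R | y != 0]).
    by apply: open_comp; [move=> u _; exact: norm_continuous|exact: open_neq].
  by apply/seteqP; split=> u /=; rewrite normr_eq0.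
apply: Ck_add => //; first exact: Ck_cst.
apply: Ck_mul => //; last exact: Ck_psi.
apply: Ck_mul => //; first exact: Ck_cst.
exact: Ck_sub (Ck_dilate m).
Qed.

Lemma C1holder_phi_loc : C1holder_on alpha setT phil.
Proof.
have a1 : 0 < alpha <= 1 by case/andP: alpha01 => -> /ltW.
apply: (C1holder_add openT).
  exact: (C1holder_Ck2 a1 openT (Ck_cst 2 1 openT)).
apply: (C1holder_mul a1 openT); last exact: C1holder_psi.
apply: (C1holder_Ck2 a1 openT).
exact: (Ck_mul openT (Ck_cst 2 k openT) (Ck_dilate 2)).
Qed.

Lemma is_derive_dilate i w :
  is_derive w (delta_mx 0 i) (dilate rho chi) (rho^-1 * partial i chi (rho^-1 *: w)).
Proof.
case: hchi => Hs _.
have D := Ck_differentiable openT (Hs 1%N) (I : setT (rho^-1 *: w)).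
have H (j : 'I_2) : is_derive w (delta_mx 0 i) (fun v : 'rV[R]_2 => (rho^-1 *: v) 0 j)
    (rho^-1 * (i == j)%:R).
  apply: is_derive_ext (is_derive_eq (is_derive_mul (is_derive_cst rho^-1 w (delta_mx 0 i))
    (is_derive_coord_dir i j w)) _) _; last by move=> v; rewrite mxE.
  by rewrite mul0r add0r.
apply: is_derive_eq (is_derive_chain H D) _.
rewrite (bigD1 i) //= big1 ?addr0; last by move=> j /negbTE ji; rewrite eq_sym ji !mulr0.
by rewrite eqxx mulr1 mulrC.
Qed.

Lemma is_derive_phi_loc i w : is_derive w (delta_mx 0 i) phil
  (k * (rho^-1 * partial i chi (rho^-1 *: w)) * psi alpha b w +
   k * dilate rho chi w * psi_partial alpha b i w).
Proof.
have H1 := is_derive_mul (is_derive_cst k w (delta_mx 0 i)) (is_derive_dilate i w).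
have H2 := is_derive_mul H1 (is_derive_psi alpha01 hb i w).
have H3 := is_deriveD (is_derive_cst (1 : R) w (delta_mx 0 i)) H2.
by apply: (is_derive_eq H3); rewrite /cst mul0r !add0r.
Qed.

Lemma partial_phi_loc_out i w : ~ square (2 * rho) w -> partial i phil w = 0.
Proof.
move=> Hw.
have [j Hj] : exists j, 2 * rho < `|w 0 j|.
  apply/not_existsP => H; apply: Hw => j; have := H j.
  by move/negP; rewrite -leNgt.
pose A := [set v : 'rV[R]_2 | 2 * rho < `|v 0 j|].
have oA : open A.
  apply: (@open_comp _ _ (fun v : 'rV[R]_2 => `|v 0 j|) [set y | 2 * rho < y]).
    move=> v _; apply: (@continuous_comp _ _ _ (fun v : 'rV[R]_2 => v 0 j)).
      exact: coord_continuous.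
    exact: norm_continuous.
  exact: open_gt.
have H : is_derive w (delta_mx 0 i) phil 0.
  apply: (is_derive_near oA Hj) (is_derive_cst (1 : R) w _) => v Av.
  rewrite phi_loc_out // => /(_ j); rewrite leNgt => /negP; apply; exact: Av.
by rewrite /partial; case: H.
Qed.

Hypothesis dchi : forall u i, `|partial i chi u| <= 2.

(** With t = |w_(other i)|, the derivative of the cutoff contributes rho^-1 * 2 * (2 rho t) = 4 t
    and that of [psi] contributes (11 + 10 / alpha) t. *)
Lemma partial_phi_loc_bound i w : square (2 * rho) w ->
  `|partial i phil w| <= `|k| * (15 + 10 / alpha) * `|w 0 (rev_ord i)|.
Proof.
move=> Hs; have [w0 _] := square_small i Hs.
have -> : partial i phil w = k * (rho^-1 * partial i chi (rho^-1 *: w)) * psi alpha b w +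
   k * dilate rho chi w * psi_partial alpha b i w.
  by rewrite /partial; case: (is_derive_phi_loc i w).
have /andP[d0 d1] := dilate_bound w.
have P1 := psi_bound i w; have P2 := psi_partial_bound alpha01 hb i w.
have P3 := dchi (rho^-1 *: w) i.
set t := `|w 0 (rev_ord i)| in P1 P2 *; have t0 : 0 <= t by exact: normr_ge0.
have -> : `|k| * (15 + 10 / alpha) * t = `|k| * (4 * t) + `|k| * (t * (11 + 10 * alpha^-1)).
  by field; rewrite gt_eqF.
apply: (le_trans (ler_normD _ _)); apply: lerD; rewrite -!mulrA normrM ler_wpM2l //.
  rewrite !normrM (ger0_norm (ltW _)) ?invr_gt0 //.
  have -> : 4 * t = rho^-1 * (2 * (2 * rho * t)) by field; rewrite gt_eqF.
  rewrite ler_wpM2l ?invr_ge0 ?(ltW rho0) //; apply: ler_pM => //.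
  by apply: (le_trans P1); rewrite ler_wpM2r.
rewrite normrM (ger0_norm d0); apply: le_trans P2.
by rewrite ler_piMl.
Qed.

(** Let A = |k| (15 + 10 / alpha) and let s be the square root in [rho_star]. On the support each
    partial derivative is at most 2 A rho in absolute value and 1 / cos^2 <= sec^2(1/2) = s^2 - 1,
    so the sum is at most 4 (A s rho)^2 <= 4 / 16. *)
Lemma gradient_phi_loc_bound (w : 'rV[R]_2) : `|w 0 0| < pi / 2 ->
  partial 0 phil w ^+ 2 + partial 1 phil w ^+ 2 / cos (w 0 0) ^+ 2 <= 1 / 4.
Proof.
move=> wpi.
have [Hs|Hs] := pselect (square (2 * rho) w); last first.
  by rewrite !partial_phi_loc_out // expr0n /= mul0r addr0; lra.
have [w0 w0'] := square_small 0 Hs; have [w1 w1'] := square_small 1 Hs.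
have c0 := @cos_half_gt0 R; have cc := cos_half_le w0'.
have B0 := partial_phi_loc_bound 0 Hs; have B1 := partial_phi_loc_bound 1 Hs.
have o0 : rev_ord (0 : 'I_2) = 1 by apply/val_inj.
have o1 : rev_ord (1 : 'I_2) = 0 by apply/val_inj.
rewrite o0 in B0; rewrite o1 in B1.
pose A := `|k| * (15 + 10 / alpha).
have A0 : 0 <= A by rewrite mulr_ge0 // addr_ge0 // divr_ge0 // ltW.
have AR : 0 <= A * (2 * rho) by exact: mulr_ge0 A0 (mulr_ge0 (ler0n _ 2) (ltW rho0)).
have S (i : 'I_2) y : `|partial i phil w| <= A * y -> 0 <= y -> y <= 2 * rho ->
    partial i phil w ^+ 2 <= (A * (2 * rho)) ^+ 2.
  move=> H y0 y1; rewrite -[leLHS]real_normK ?num_real //.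
  by rewrite ler_sqr ?nnegrE //; apply: (le_trans H); rewrite ler_wpM2l.
have S0 := S _ _ B0 (normr_ge0 _) w1; have S1 := S _ _ B1 (normr_ge0 _) w0.
have iC : (cos (w 0 0) ^+ 2)^-1 <= cos (1 / 2) ^- 2.
  rewrite lef_pV2 ?posrE ?exprn_gt0 // ?(lt_le_trans c0) //.
  by rewrite ler_sqr ?nnegrE // ?(ltW c0) // ltW // (lt_le_trans c0).
have iC0 : 0 <= (cos (w 0 0) ^+ 2)^-1 by rewrite invr_ge0 sqr_ge0.
have M := rho_star_mul_all k a0; rewrite -/A in M.
set s := Num.sqrt _ in M.
have ss : s ^+ 2 = 1 + cos (1 / 2) ^- 2.
  by rewrite sqr_sqrtr // addr_ge0 // invr_ge0 sqr_ge0.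
have s0 : 0 <= s by exact: sqrtr_ge0.
apply: (@le_trans _ _ ((A * (2 * rho)) ^+ 2 * (1 + cos (1 / 2) ^- 2))).
  by rewrite mulrDr mulr1; exact: (lerD S0 (ler_pM (sqr_ge0 _) iC0 S1 iC)).
rewrite -ss.
have -> : (A * (2 * rho)) ^+ 2 * s ^+ 2 = 4 * (A * s * rho) ^+ 2 by ring.
apply: four_sqr_le M; apply: mulr_ge0; [exact: mulr_ge0|exact: ltW].
Qed.

End PhiLoc.

(** * The twisted metric in the spherical charts *)

Section ChartVectors.
Context {R : realType}.

Definition sph_r (r t : R) : 'rV[R]_3 :=
  \row_(i < 3) [:: - (sin r * cos t); - (sin r * sin t); cos r]`_i.

Definition sph_t (r t : R) : 'rV[R]_3 :=
  \row_(i < 3) [:: - (cos r * sin t); cos r * cos t; 0]`_i.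

Lemma dotp_sph_frame r t :
  [/\ dotp (sph_r r t) (sph_r r t) = 1, dotp (sph_r r t) (sph_t r t) = 0 &
      dotp (sph_t r t) (sph_t r t) = cos r ^+ 2].
Proof.
have Er := cos2Dsin2 r; have Et := cos2Dsin2 t.
rewrite !dotp3E !mxE /=; split.
- transitivity (sin r ^+ 2 * (cos t ^+ 2 + sin t ^+ 2) + cos r ^+ 2); first by ring.
  by rewrite Et mulr1 addrC.
- by ring.
- transitivity (cos r ^+ 2 * (cos t ^+ 2 + sin t ^+ 2)); first by ring.
  by rewrite Et mulr1.
Qed.

Lemma is_derive_sph (V : normedModType R) (f g : V -> R) (u v : V) (df dg : R) :
  is_derive u v f df -> is_derive u v g dg ->
  is_derive u v (fun w => sph (f w) (g w))
    (df *: sph_r (f u) (g u) + dg *: sph_t (f u) (g u)).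
Proof.
move=> Hf Hg.
have Cf := is_derive_comp1 Hf (is_derive_cos (f u)).
have Sf := is_derive_comp1 Hf (is_derive_sin (f u)).
have Cg := is_derive_comp1 Hg (is_derive_cos (g u)).
have Sg := is_derive_comp1 Hg (is_derive_sin (g u)).
apply: is_derive_mx_coords => i j; rewrite [i]ord1 {i}.
case: (ord3_cases j) => ->; rewrite !mxE /=.
- apply: is_derive_ext (is_derive_eq (is_derive_mul Cf Cg) _) _ => [|w]; first by rewrite /=; ring.
  by rewrite sph0.
- apply: is_derive_ext (is_derive_eq (is_derive_mul Cf Sg) _) _ => [|w]; first by rewrite /=; ring.
  by rewrite sph1.
- apply: is_derive_ext (is_derive_eq Sf _) _ => [|w]; first by ring.
  by rewrite sph2.
Qed.

Lemma is_derive_mulmxr (V : normedModType R) n p (f : V -> 'rV[R]_n) (M : 'M[R]_(n, p))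
    (u v : V) (d : 'rV[R]_n) :
  is_derive u v f d -> is_derive u v (fun w => f w *m M) (d *m M).
Proof.
move=> [D E]; have H l : is_derive u v (fun w : V => f w 0 l) (d 0 l).
  split; first by move/derivable_mxP: D; exact.
  by rewrite -E derive_mx // mxE.
apply: is_derive_mx_coords => i j; rewrite [i]ord1 {i} mxE.
have S := is_derive_sum (fun l => is_derive_mul (H l) (is_derive_cst (M l j) u v)).
apply: is_derive_ext (is_derive_eq S _) _ => [|w].
  by apply: eq_bigr => l _; rewrite mulr0 addr0.
by rewrite fct_sumE mxE.
Qed.

Lemma is_derive_coord_delta n (i j : 'I_n) (u : 'rV[R]_n) :
  is_derive u (delta_mx 0 i) (fun w : 'rV[R]_n => w 0 j) (i == j)%:R.
Proof.
have := is_derive_coord u (delta_mx 0 i) 0 j.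
by rewrite mxE eqxx /= eq_sym.
Qed.

Lemma chart_vectorE (Q : 'M[R]_3) (u : 'rV[R]_3) (i : 'I_3) :
  chart_vector Q u i =
  (((i == 0)%:R *: sph_r (u 0 0) (u 0 1) + (i == 1)%:R *: sph_t (u 0 0) (u 0 1)) *m Q,
   (i == ord_max)%:R *: \row_(j < 2) [:: - sin (u 0 ord_max); cos (u 0 ord_max)]`_j).
Proof.
have H1 := is_derive_mulmxr Q (is_derive_sph (is_derive_coord_delta i 0 u)
  (is_derive_coord_delta i 1 u)).
pose circ (v : 'rV[R]_3) : 'rV[R]_2 := \row_(j < 2) [:: cos (v 0 ord_max); sin (v 0 ord_max)]`_j.
have H2 : is_derive u (delta_mx 0 i) circ
    ((i == ord_max)%:R *: \row_(j < 2) [:: - sin (u 0 ord_max); cos (u 0 ord_max)]`_j).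
  have X := is_derive_coord_delta i ord_max u.
  apply: is_derive_mx_coords => l j; rewrite [l]ord1 {l} !mxE.
  case: (ord2_cases 0 j) => ->.
    apply: is_derive_ext (is_derive_eq (is_derive_comp1 X (is_derive_cos _)) _) _ => [|w].
      by rewrite /= mulrC.
    by rewrite mxE.
  apply: is_derive_ext (is_derive_eq (is_derive_comp1 X (is_derive_sin _)) _) _ => [|w].
    by rewrite /= mulrC.
  by rewrite mxE.
have [_ E] := is_derive_pair H1 H2.
have EC : chart Q = fun w : 'rV[R]_3 => (sph (w 0 0) (w 0 1) *m Q, circ w).
  apply/funext => v; rewrite /chart sphericalE /circ; congr (_, _).
  have -> : 2 = ord_max :> 'I_3 by apply/val_inj.
  by [].
rewrite /chart_vector EC; exact: E.
Qed.

Lemma dotp_frame (A B : 'rV[R]_3) (a b a' b' c : R) :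
  dotp A A = 1 -> dotp A B = 0 -> dotp B B = c ->
  dotp (a *: A + b *: B) (a' *: A + b' *: B) = a * a' + b * b' * c.
Proof.
rewrite !dotp3E !mxE => AA AB BB.
transitivity (a * a' * (A 0 0 * A 0 0 + A 0 1 * A 0 1 + A 0 ord_max * A 0 ord_max) +
  (a * b' + b * a') * (A 0 0 * B 0 0 + A 0 1 * B 0 1 + A 0 ord_max * B 0 ord_max) +
  b * b' * (B 0 0 * B 0 0 + B 0 1 * B 0 1 + B 0 ord_max * B 0 ord_max)); first by ring.
by rewrite AA AB BB mulr1 mulr0 addr0.
Qed.

Lemma dotp_scale n (A B : 'rV[R]_n) (a b : R) : dotp (a *: A) (b *: B) = a * b * dotp A B.
Proof. by rewrite /dotp mulr_sumr; apply: eq_bigr => i _; rewrite !mxE; ring. Qed.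

Lemma dotp_circle_vector (t : R) :
  dotp (\row_(j < 2) [:: - sin t; cos t]`_j) (\row_(j < 2) [:: - sin t; cos t]`_j) = 1.
Proof.
rewrite /dotp !big_ord_recl big_ord0 !mxE /= addr0 mulrNN -!expr2 addrC.
exact: cos2Dsin2.
Qed.

Lemma components_twisted (f : 'rV[R]_3 -> R) (Q : 'M[R]_3) (u : 'rV[R]_3) :
  orthogonal_mx Q ->
  components (twisted_metric f) Q u =
  diag_mx (\row_a [:: f (spherical Q (u 0 0) (u 0 1)) ^- 2;
    f (spherical Q (u 0 0) (u 0 1)) ^- 2 * cos (u 0 0) ^+ 2;
    f (spherical Q (u 0 0) (u 0 1)) ^+ 2]`_a).
Proof.
move=> HQ; apply/matrixP => i j.
rewrite mxE /twisted_metric !chart_vectorE [LHS]/= dotp_mulmx_orthogonal //.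
have [s1 s2 s3] := dotp_sph_frame (u 0 0) (u 0 1).
rewrite (dotp_frame _ _ _ _ s1 s2 s3) dotp_scale dotp_circle_vector mulr1 !mxE.
move: (f _) (cos (u 0 0)) => F c.
by case: (ord3_cases i) => ->; case: (ord3_cases j) => ->;
  rewrite /= ?(mul0r, mulr0, mul1r, mulr1, addr0, add0r, mulr1n, mulr0n).
Qed.

End ChartVectors.

(** Invariance of the squared gradient. The hypotheses say that the Jacobian J with rows (a, b) and
    (c, d) pulls diag (1, H) back to diag (1, E); what is needed is the dual relation J diag (1,
    1/E) J^T = diag (1, 1/H), which [e1], [e2], [e3] state without denominators. *)
Lemma gradient_norm_change (R : fieldType) (a b c d H E x y : R) :
  H != 0 -> E != 0 ->
  a ^+ 2 + H * c ^+ 2 = 1 -> a * b + H * (c * d) = 0 -> b ^+ 2 + H * d ^+ 2 = E ->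
  (x * a + y * c) ^+ 2 + (x * b + y * d) ^+ 2 / E = x ^+ 2 + y ^+ 2 / H.
Proof.
move=> H0 E0 h1 h2 h3.
(* The determinant of the relation between the two metrics, as a Lagrange identity. *)
have K : H * (a * d - b * c) ^+ 2 = E.
  transitivity ((a ^+ 2 + H * c ^+ 2) * (b ^+ 2 + H * d ^+ 2) - (a * b + H * (c * d)) ^+ 2).
    by ring.
  by rewrite h1 h2 h3; ring.
have e1 : a ^+ 2 * E + b ^+ 2 = E.
  transitivity (2 * (a * b) * (a * b + H * (c * d)) + H * (a * d - b * c) ^+ 2 +
    b ^+ 2 * (1 - (a ^+ 2 + H * c ^+ 2))); first by rewrite -h3; ring.
  by rewrite h1 h2 K; ring.
have e2 : a * c * E + b * d = 0.
  transitivity ((a * b + H * (c * d)) * (a * d + b * c) +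
    b * d * (1 - (a ^+ 2 + H * c ^+ 2))); first by rewrite -h3; ring.
  by rewrite h1 h2; ring.
have e3 : H * (c ^+ 2 * E + d ^+ 2) = E.
  transitivity (H * (a * d - b * c) ^+ 2 + 2 * (H * (c * d)) * (a * b + H * (c * d)) +
    H * d ^+ 2 * (1 - (a ^+ 2 + H * c ^+ 2))); first by rewrite -h3; ring.
  by rewrite h1 h2 K; ring.
transitivity ((x ^+ 2 * (a ^+ 2 * E + b ^+ 2) + 2 * x * y * (a * c * E + b * d) +
   y ^+ 2 * (H * (c ^+ 2 * E + d ^+ 2)) / H) / E); first by field; rewrite H0 E0.
by rewrite e1 e2 e3; field; rewrite H0 E0.
Qed.

Lemma Ck_spherical (R : realType) (N : 'M[R]_3) m j :
  Ck_on m setT (fun u : 'rV[R]_3 => spherical N (u 0 0) (u 0 1) 0 j).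
Proof.
have [s0 c0] := Ck_sin_cos openT (@Ck_coord R 3 m setT 0 openT).
have [s1 c1] := Ck_sin_cos openT (@Ck_coord R 3 m setT 1 openT).
have K l := Ck_cst m (N l j) (@openT 'rV[R]_3).
apply: Ck_eq openT _ (Ck_add openT (Ck_add openT
  (Ck_mul openT (Ck_mul openT c0 c1) (K 0)) (Ck_mul openT (Ck_mul openT c0 s1) (K 1)))
  (Ck_mul openT s0 (K ord_max))) => u _.
by rewrite sphericalE [RHS]mxE sum_ord3 sph0 sph1 sph2.
Qed.

(** * phi in the spherical chart of an arbitrary orthonormal frame *)

Section Main.
Context {R : realType}.
Variables (alpha k : R) (b : R -> R) (chi : 'rV[R]_2 -> R).
Hypothesis alpha01 : 0 < alpha < 1.
Hypothesis hb : step_profile b.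
Hypothesis hchi : cutoff chi.
Variables (p : 'rV[R]_3) (U : set 'rV[R]_2) (x : 'rV[R]_2 -> 'rV[R]_3).
Hypothesis hx : round_coordinates p U x.
Hypothesis hU : square (2 * rho_star alpha k) `<=` U.

Local Notation rho := (rho_star alpha k).
Local Notation phil := (phi_loc alpha k b chi).
Local Notation f := (phi alpha k b chi U x).

Let alpha_gt0 : 0 < alpha. Proof. by case/andP: alpha01. Qed.

Lemma phi_param u : U u -> f (x u) = phil u.
Proof.
move=> Uu; rewrite /phi ifT; last by rewrite inE; exists u.
have I : {in U &, injective x}.
  by move=> v w; rewrite !inE; case: hx => _ [_ H _ _ _]; exact: H.
by rewrite pinvKV // inE.
Qed.

Lemma phi_unparam q : ~ (x @` U) q -> f q = 1.
Proof. by move=> H; rewrite /phi ifF //; apply/negbTE; rewrite notin_setE. Qed.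

Lemma phi_close q : `|f q - 1| <= 1 / 4.
Proof.
have [[u Uu <-]|H] := pselect ((x @` U) q).
  by rewrite phi_param //; exact: phi_loc_close.
by rewrite phi_unparam // subrr normr0 divr_ge0.
Qed.

Lemma phi_ge q : 3 / 4 <= f q.
Proof. by have := phi_close q; rewrite ler_norml => /andP[H _]; lra. Qed.

Lemma phi_gt0 q : 0 < f q.
Proof. by apply: lt_le_trans (phi_ge q); rewrite divr_gt0. Qed.

Lemma round_coordinates_rigid : exists P : 'M[R]_3, [/\ orthogonal_mx P, row 0 P = p &
  forall u, square (2 * rho) u -> x u = spherical P (u 0 0) (u 0 1)].
Proof.
case: hx => -[oU U0 x0] [Hs _ Hsm _ Hm].
have Cx m : vCk m U x by move=> j; exact: Hsm.
have D i u : U u -> 'D_(delta_mx 0 i) x u = vpartial i x u.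
  move=> Uu; apply: vpartialE => j.
  by case: (Ck_is_derive i (Cx 1%N j) Uu).
have r0 : 0 <= 2 * rho < pi / 2.
  have r1 := rho_star_gt0 k alpha_gt0; have r2 := rho_star_le alpha k.
  by have := @pihalf_ge1 R; move=> r3; apply/andP; split; move: r1 r2 r3;
    move: rho (pi / 2 : R) => r4 r5; lra.
have [P [H1 H2 H3]] := @rigid_coordinates R U x oU Cx Hs
  (fun u Uu => ltac:(by have [] := Hm u Uu; rewrite /= !D))
  (fun u Uu => ltac:(by have [] := Hm u Uu; rewrite /= !D))
  (fun u Uu => ltac:(by have [] := Hm u Uu; rewrite /= !D)) (2 * rho) r0 hU.
by exists P; split=> //; rewrite H2.
Qed.

Definition lonlat (y : 'rV[R]_3) : 'rV[R]_2 :=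
  \row_(i < 2) [:: latitude y; longitude y]`_i.

Lemma lonlat0 y : lonlat y 0 0 = latitude y. Proof. by rewrite mxE. Qed.
Lemma lonlat1 y : lonlat y 0 1 = longitude y. Proof. by rewrite mxE. Qed.

Variable P : 'M[R]_3.
Hypothesis HP : orthogonal_mx P.
Hypothesis Pp : row 0 P = p.
Hypothesis xP : forall u, square (2 * rho) u -> x u = spherical P (u 0 0) (u 0 1).

Lemma square_pihalf (w : 'rV[R]_2) i : square (2 * rho) w -> `|w 0 i| < pi / 2.
Proof.
move=> /(square_small i)[_ H]; apply: (le_lt_trans H).
by have := @pihalf_ge1 R; lra.
Qed.

Lemma mulmxP_inj (y z : 'rV[R]_3) : y *m P = z *m P -> y = z.
Proof. by move/(congr1 (fun w => w *m P^T)); rewrite -!mulmxA HP !mulmx1. Qed.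

(** Inside the square, [x] is the explicit map and [lonlat] inverts it. If [lonlat y] is outside,
    the right side is 1; the point may still be some [x u], but then [u] is outside too, since
    latitude and longitude would recover it, and the left side is again 1. *)
Lemma phi_front (y : 'rV[R]_3) : dotp y y = 1 -> 0 < y 0 0 -> f (y *m P) = phil (lonlat y).
Proof.
move=> Hy y0.
have [Hs|Hs] := pselect (square (2 * rho) (lonlat y)).
  rewrite -phi_param; last exact: hU.
  by rewrite (xP Hs) lonlat0 lonlat1 sphericalE (sph_latitude_longitude Hy y0).
rewrite phi_loc_out //.
have [[u Uu E]|H] := pselect ((x @` U) (y *m P)); last exact: phi_unparam.
rewrite -E phi_param // phi_loc_out // => Hu; apply: Hs.
move: E; rewrite (xP Hu) sphericalE => /mulmxP_inj E.
have [E1 E2] := latitude_longitude_sph (square_pihalf 0 Hu) (square_pihalf 1 Hu).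
suff -> : lonlat y = u by [].
rewrite -E; apply/rowP => j; case: (ord2_cases 0 j) => ->.
  by rewrite lonlat0.
have -> : rev_ord 0 = 1 :> 'I_2 by apply/val_inj.
by rewrite lonlat1.
Qed.

(** Points of the square have first coordinate cos r cos t >= cos^2(1/2). This threshold is
    positive, so the region overlaps the half sphere [y 0 0 > 0] and the two open sets cover
    everything. *)
Lemma phi_back (y : 'rV[R]_3) : y 0 0 < cos (1 / 2) ^+ 2 -> f (y *m P) = 1.
Proof.
move=> y0; have [[u Uu E]|H] := pselect ((x @` U) (y *m P)); last exact: phi_unparam.
rewrite -E phi_param // phi_loc_out // => Hu.
move: E; rewrite (xP Hu) sphericalE => /mulmxP_inj E.
move: y0; rewrite -E sph0 ltNge => /negP; apply.
have c0 := @cos_half_gt0 R; rewrite expr2.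
have [_ u0] := square_small 0 Hu; have [_ u1] := square_small 1 Hu.
by apply: ler_pM; rewrite ?(ltW c0) // cos_half_le.
Qed.

Variable Q : 'M[R]_3.
Hypothesis HQ : orthogonal_mx Q.

Let M := Q *m P^T.

(** The coordinates, in the frame [P] adapted to [x], of the point whose latitude and longitude in
    the frame [Q] are given by [u]. *)
Definition frame_coord (u : 'rV[R]_3) : 'rV[R]_3 := sph (u 0 0) (u 0 1) *m M.
Local Notation Y := frame_coord.
Local Notation F := (fun u : 'rV[R]_3 => f (spherical Q (u 0 0) (u 0 1))).
Local Notation h := (fun u : 'rV[R]_3 => lonlat (Y u)).

Lemma frame_coordK (u : 'rV[R]_3) : spherical Q (u 0 0) (u 0 1) = Y u *m P.
Proof. by rewrite sphericalE /Y /M -!mulmxA (orthogonal_mxC HP) mulmx1. Qed.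

Lemma dotp_frame_coord u : dotp (Y u) (Y u) = 1.
Proof. by rewrite /Y dotp_mulmx_orthogonal ?dotp_sph //; exact: orthogonal_mul_tr. Qed.

Lemma Ck_frame_coord m j : Ck_on m setT (fun u => Y u 0 j).
Proof. exact: Ck_spherical. Qed.

Definition front : set 'rV[R]_3 := [set u | 0 < Y u 0 0].
Definition back : set 'rV[R]_3 := [set u | Y u 0 0 < cos (1 / 2) ^+ 2].

Lemma open_front : open front.
Proof.
apply: (@open_comp _ _ (fun u => Y u 0 0) [set y | 0 < y]); last exact: open_gt.
by move=> u _; exact: (Ck_continuous (Ck_frame_coord 0 0)).
Qed.

Lemma open_back : open back.
Proof.
apply: (@open_comp _ _ (fun u => Y u 0 0) [set y | y < cos (1 / 2) ^+ 2]);
  last exact: open_lt.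
by move=> u _; exact: (Ck_continuous (Ck_frame_coord 0 0)).
Qed.

Lemma front_or_back u : front u \/ back u.
Proof.
have [H|H] := ltP 0 (Y u 0 0); first by left.
by right; apply: (le_lt_trans H); rewrite exprn_gt0 // cos_half_gt0.
Qed.

Lemma F_front (u : 'rV[R]_3) : front u ->
  phil (lonlat (Y u)) = f (spherical Q (u 0 0) (u 0 1)).
Proof. by move=> Hu; rewrite frame_coordK phi_front // dotp_frame_coord. Qed.

Lemma F_back (u : 'rV[R]_3) : back u -> 1 = f (spherical Q (u 0 0) (u 0 1)).
Proof. by move=> Hu; rewrite frame_coordK phi_back. Qed.

Lemma Ck_lonlat m j : Ck_on m front (fun u => h u 0 j).
Proof.
have C i : Ck_on m front (fun u => Y u 0 i) by exact: Ck_sub (Ck_frame_coord m i).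
have oV := open_front.
case: (ord2_cases 0 j) => ->.
  apply: Ck_eq oV _ (Ck_asin oV _ (C ord_max)) => u Hu; first by rewrite lonlat0.
  by apply: unit_coord_bound => //; exact: dotp_frame_coord.
have -> : rev_ord 0 = 1 :> 'I_2 by apply/val_inj.
apply: Ck_eq oV _ (Ck_atan oV (Ck_mul oV (C 1) (Ck_comp_inv oV _ (C 0)))) => u Hu.
  by rewrite lonlat1.
by rewrite gt_eqF.
Qed.

Lemma C1holder_F : C1holder_on alpha setT F.
Proof.
have a1 : 0 < alpha <= 1 by case/andP: alpha01 => -> /ltW.
apply: C1holder_local => u _; case: (front_or_back u) => Hu.
  exists front; split=> //; first exact: open_front.
  apply: (C1holder_eq open_front F_front).
  exact: (C1holder_comp a1 open_front openT (fun u _ => I) (Ck_lonlat 2)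
    (C1holder_phi_loc k alpha01 hb hchi)).
exists back; split=> //; first exact: open_back.
apply: (C1holder_eq open_back F_back).
exact: (C1holder_Ck2 a1 open_back (Ck_cst 2 1 open_back)).
Qed.

Lemma Ck_F (m : nat) (A : set 'rV[R]_3) : open A ->
  (forall u, A u -> spherical Q (u 0 0) (u 0 1) <> p) -> Ck_on m A F.
Proof.
move=> oA HA; apply: Ck_local => u Au; case: (front_or_back u) => Hu.
  have oB : open (A `&` front) by apply: openI => //; exact: open_front.
  exists (A `&` front); split=> //.
  apply: (Ck_eq oB (f := fun u => phil (h u))).
    by move=> v [_ /F_front].
  apply: (Ck_comp oB _ _ _ (Ck_phi_loc k alpha01 hb hchi m)).
  - rewrite (_ : mkset _ = Num.norm @^-1` [set y : R | y != 0]).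
      by apply: open_comp; [move=> v _; exact: norm_continuous|exact: open_neq].
    by apply/seteqP; split=> v /=; rewrite normr_eq0.
  - move=> v [Av Fv] /=; apply/eqP => h0; apply: (HA v Av).
    (* Latitude and longitude 0 mean the first vector of the frame [P], which is [p]; the chart
       avoids it. *)
    have Yv : Y v = delta_mx 0 0.
      rewrite -(sph_latitude_longitude (dotp_frame_coord v) Fv) -lonlat0 -lonlat1 h0 !mxE.
      apply/rowP => j; case: (ord3_cases j) => ->; rewrite ?sph0 ?sph1 ?sph2 !mxE.
      + by rewrite cos0 mulr1.
      + by rewrite sin0 mulr0.
      + by rewrite sin0.
    by rewrite frame_coordK Yv -rowE.
  - by move=> j; apply: Ck_sub (Ck_lonlat m j) => v [].
exists (A `&` back); split=> //; first by apply: openI => //; exact: open_back.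
have oB : open (A `&` back) by apply: openI => //; exact: open_back.
by apply: Ck_eq oB _ (Ck_cst m 1 oB) => v [_ /F_back].
Qed.

Hypothesis dchi : forall u i, `|partial i chi u| <= 2.

(** Passing from one frame to another is an isometry of the sphere, so the gradient bound in the
    adapted coordinates transfers to every chart; on [back] the function is locally constant. *)
Lemma gradient_F_bound (u : 'rV[R]_3) : cos (u 0 0) != 0 ->
  partial 0 F u ^+ 2 + partial 1 F u ^+ 2 / cos (u 0 0) ^+ 2 <= 1 / 4.
Proof.
move=> cu; case: (front_or_back u) => Hu; last first.
  have Z i : partial i F u = 0.
    have [_ H] := is_derive_near open_back Hu F_back (is_derive_cst (1 : R) u (delta_mx 0 i)).
    by rewrite /partial H.
  by rewrite !Z expr0n /= mul0r addr0 divr_ge0.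
pose w := h u.
have wpi : `|w 0 0| < pi / 2.
  by rewrite /w lonlat0; apply: latitude_lt_pihalf => //; exact: dotp_frame_coord.
have cw : cos (w 0 0) != 0 by rewrite gt_eqF // cos_gt0_small.
have D : differentiable phil w.
  exact: (Ck_differentiable openT (C1holder_phi_loc k alpha01 hb hchi).1 I).
have [J Hh] : exists J : 'I_3 -> 'I_2 -> R, forall i j,
    is_derive u (delta_mx 0 i) (fun v : 'rV[R]_3 => lonlat (Y v) 0 j) (J i j).
  exists (fun i j => partial i (fun v => h v 0 j) u) => i j.
  exact: (Ck_is_derive i (Ck_lonlat 1 j) Hu).
have dF i : partial i F u = partial 0 phil w * J i 0 + partial 1 phil w * J i 1.
  have [_ H] := is_derive_near open_front Hu F_front (is_derive_chain (Hh i) D).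
  rewrite /partial H !big_ord_recl big_ord0 addr0.
  by have -> : lift ord0 ord0 = 1 :> 'I_2 by apply/val_inj.
(* Both sides differentiate the same map, since [Y v] is the point with spherical coordinates
   [lonlat (Y v)]. Their dot products then say that [J] relates the two forms of the round
   metric. *)
have dY i : J i 0 *: sph_r (w 0 0) (w 0 1) + J i 1 *: sph_t (w 0 0) (w 0 1) =
    ((i == 0)%:R *: sph_r (u 0 0) (u 0 1) + (i == 1)%:R *: sph_t (u 0 0) (u 0 1)) *m M.
  have H1 := is_derive_mulmxr M (is_derive_sph (is_derive_coord_delta i 0 u)
    (is_derive_coord_delta i 1 u)).
  have H2 := is_derive_sph (Hh i 0) (Hh i 1).
  case: H1 => _ <-; case: H2 => _ <-; apply: near_eq_derive.
  apply: filterS (nbhs_open open_front Hu) => v Hv.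
  by rewrite lonlat0 lonlat1 sph_latitude_longitude //; exact: dotp_frame_coord.
have HM : orthogonal_mx M by exact: orthogonal_mul_tr.
have [s1 s2 s3] := dotp_sph_frame (w 0 0) (w 0 1).
have [t1 t2 t3] := dotp_sph_frame (u 0 0) (u 0 1).
have G i j : J i 0 * J j 0 + J i 1 * J j 1 * cos (w 0 0) ^+ 2 =
    (i == 0)%:R * (j == 0)%:R + (i == 1)%:R * (j == 1)%:R * cos (u 0 0) ^+ 2.
  rewrite -(dotp_frame _ _ _ _ s1 s2 s3) -(dotp_frame _ _ _ _ t1 t2 t3).
  by rewrite (dY i) (dY j) (dotp_mulmx_orthogonal _ _ HM).
have B := gradient_phi_loc_bound k alpha01 hb hchi dchi wpi.
have e01 : ((0 : 'I_3) == 1) = false by [].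
have e10 : ((1 : 'I_3) == 0) = false by [].
rewrite !dF.
rewrite (@gradient_norm_change _ (J 0 0) (J 1 0) (J 0 1) (J 1 1) (cos (w 0 0) ^+ 2)
  (cos (u 0 0) ^+ 2)) ?expf_neq0 //.
- have E := G 0 0; rewrite !eqxx e01 mulr1 !mul0r addr0 in E; rewrite -[RHS]E; ring.
- have E := G 0 1; rewrite !eqxx e01 e10 mulr0 !mul0r addr0 in E; rewrite -[RHS]E; ring.
- have E := G 1 1; rewrite !eqxx e10 !mul0r add0r !mul1r in E; rewrite -[RHS]E; ring.
Qed.

End Main.

Lemma twisted_metric_riemannian (R : realType) (f : 'rV[R]_3 -> R) :
  (forall q, 0 < f q) -> riemannian (twisted_metric f).
Proof.
move=> f0 q _; split.
- by move=> v w _ _; rewrite /twisted_metric (dotpC v.1) (dotpC v.2).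
- move=> a v v' w _ _ _; rewrite /twisted_metric /=.
  have E n (x y z : 'rV[R]_n) : dotp (a *: x + y) z = a * dotp x z + dotp y z.
    by rewrite dotpDl -[z in X in X + _]scale1r dotp_scale mulr1.
  by rewrite !E; ring.
- move=> v _ v0; rewrite /twisted_metric.
  have P n (x : 'rV[R]_n) : 0 <= dotp x x by apply: sumr_ge0 => i _; rewrite -expr2 sqr_ge0.
  have Z n (x : 'rV[R]_n) : x != 0 -> 0 < dotp x x.
    move=> x0; rewrite lt_neqAle P andbT eq_sym; apply: contra x0 => /eqP H.
    apply/eqP/rowP => i; rewrite mxE; apply/eqP; rewrite -sqrf_eq0 expr2.
    have /eqP := H; rewrite psumr_eq0 => [/allP/(_ i)|j _]; last by rewrite -expr2 sqr_ge0.
    by rewrite mem_index_enum => /(_ isT).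
  have fm : 0 < f q.1 ^- 2 by rewrite invr_gt0 exprn_gt0.
  have fp : 0 < f q.1 ^+ 2 by rewrite exprn_gt0.
  have [v1|v1] := eqVneq v.1 0; last first.
    by apply: ltr_pwDl; [rewrite mulr_gt0 // Z|rewrite mulr_ge0 // ltW].
  apply: ltr_wpDl; first by rewrite mulr_ge0 // ltW.
  rewrite mulr_gt0 // Z //; apply: contra v0 => /eqP v2.
  by rewrite [v]surjective_pairing v1 v2.
Qed.

Lemma open_spherical_neq (R : realType) (N : 'M[R]_3) (p : 'rV[R]_3) :
  open [set u : 'rV[R]_3 | spherical N (u 0 0) (u 0 1) <> p].
Proof.
rewrite (_ : mkset _ = (fun u : 'rV[R]_3 => `|spherical N (u 0 0) (u 0 1) - p|) @^-1`
    [set y : R | y != 0]).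
  apply: open_comp; last exact: open_neq.
  move=> u _; apply: (@continuous_comp _ _ _
    (fun u : 'rV[R]_3 => spherical N (u 0 0) (u 0 1) - p)); last exact: norm_continuous.
  apply: continuousB; last exact: cst_continuous.
  by apply: continuous_rV => j; exact: (Ck_continuous (Ck_spherical N 0 j)).
apply/seteqP; split=> u /=; rewrite normr_eq0 subr_eq0 => /eqP //.
Qed.

Lemma open_chart_dom (R : realType) (xi0 : R) : open (chart_dom xi0).
Proof.
have O (i : 'I_3) (c d : R) : open [set u : 'rV[R]_3 | `|u 0 i - c| < d].
  apply: (@open_comp _ _ (fun u : 'rV[R]_3 => `|u 0 i - c|) [set y | y < d]); last exact: open_lt.
  move=> u _; apply: (@continuous_comp _ _ _ (fun u : 'rV[R]_3 => u 0 i - c));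
    last exact: norm_continuous.
  by apply: continuousB; [exact: coord_continuous|exact: cst_continuous].
rewrite (_ : chart_dom xi0 = [set u : 'rV[R]_3 | `|u 0 0 - 0| < pi / 2] `&`
    [set u : 'rV[R]_3 | `|u 0 1 - 0| < pi] `&` [set u : 'rV[R]_3 | `|u 0 2 - xi0| < pi]).
  by do !apply: openI; exact: O.
by apply/seteqP; split=> u /=; rewrite !subr0 => -[]; [move=> ? ?|case].
Qed.

Lemma sphere_chart (R : realType) (N : 'M[R]_3) (u : 'rV[R]_3) :
  orthogonal_mx N -> S2xS1 (chart N u).
Proof.
move=> HN; split=> /=.
  by rewrite /sphere /= sphericalE dotp_mulmx_orthogonal // dotp_sph.
rewrite /sphere /= /dotp !big_ord_recl big_ord0 !mxE /= addr0 -!expr2.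
exact: cos2Dsin2.
Qed.

(** * Regularity of the metric components, and conclusion *)

Section Components.
Context {R : realType}.
Variables (f : 'rV[R]_3 -> R) (N : 'M[R]_3).
Hypothesis HN : orthogonal_mx N.
Hypothesis f0 : forall q, f q != 0.
Local Notation F := (fun u : 'rV[R]_3 => f (spherical N (u 0 0) (u 0 1))).

(** Abstracting the class [C] of functions serves C^m and C^{1,alpha} at once; squares are written
    as products to match the closure lemmas of both. *)
Lemma components_entry (C : ('rV[R]_3 -> R) -> Prop) i j :
  (forall g h : 'rV[R]_3 -> R, g =1 h -> C g -> C h) ->
  C (fun=> 0) -> C (fun u => (F u * F u)^-1) ->
  C (fun u => (F u * F u)^-1 * cos (u 0 0) ^+ 2) -> C (fun u => F u * F u) ->
  C (fun u => components (twisted_metric f) N u i j).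
Proof.
move=> E C0 C1 C2 C3.
have X u : (\row_a [:: F u ^- 2; F u ^- 2 * cos (u 0 0) ^+ 2; F u ^+ 2]`_a) 0 i *+ (i == j) =
    components (twisted_metric f) N u i j.
  by rewrite components_twisted // [RHS]mxE.
apply: (E _ _ X); have [_|_] := eqVneq i j; last by apply: E C0 => u; rewrite mulr0n.
case: (ord3_cases i) => ->.
- by apply: E C1 => u; rewrite mxE mulr1n.
- by apply: E C2 => u; rewrite mxE mulr1n.
- by apply: E C3 => u; rewrite mxE mulr1n.
Qed.

Lemma Ck_components m D i j : open D -> Ck_on m D F ->
  Ck_on m D (fun u => components (twisted_metric f) N u i j).
Proof.
move=> oD CF; have C2 := Ck_mul oD CF CF.
have Ci : Ck_on m D (fun u => (F u * F u)^-1).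
  by apply: (Ck_comp_inv oD _ C2) => u _; exact: mulf_neq0.
apply: (components_entry (C := Ck_on m D)) => //.
- by move=> g h E; apply: Ck_eq oD _ => u _; exact: E.
- exact: Ck_cst.
- apply: (Ck_mul oD Ci); apply: (Ck_exp 2 oD).
  exact: (Ck_sin_cos oD (Ck_coord m 0 oD)).2.
Qed.

Lemma C1holder_components alpha D i j : 0 < alpha <= 1 -> open D ->
  C1holder_on alpha D F ->
  C1holder_on alpha D (fun u => components (twisted_metric f) N u i j).
Proof.
move=> a01 oD CF; have C2 := C1holder_mul a01 oD CF CF.
have Ci : C1holder_on alpha D (fun u => (F u * F u)^-1).
  by apply: (C1holder_inv a01 oD _ C2) => u _; exact: mulf_neq0.
apply: (components_entry (C := C1holder_on alpha D)) => //.
- by move=> g h E; apply: C1holder_eq oD _ => u _; exact: E.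
- exact: (C1holder_Ck2 a01 oD (Ck_cst 2 0 oD)).
- apply: (C1holder_mul a01 oD Ci); apply: (C1holder_Ck2 a01 oD); apply: (Ck_exp 2 oD).
  exact: (Ck_sin_cos oD (Ck_coord 2 0 oD)).2.
Qed.

Lemma partial_spherical_angle v : partial ord_max F v = 0.
Proof.
have H : is_derive v (delta_mx 0 ord_max) F 0.
  rewrite -[v]add0r -(scale0r (delta_mx 0 ord_max)); apply/is_derive_lineP.
  rewrite (_ : (fun s : R => _) = fun=> F v); first exact: is_derive_cst.
  by apply/funext => s; rewrite !mxE /= !mulr0 !add0r.
by rewrite /partial; case: H.
Qed.

End Components.

Theorem lemma6p5 (R : realType) (alpha k : R)
  (halpha : 0 < alpha < 1)
  (b : R -> R) (hb : step_profile b)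
  (chi : 'rV[R]_2 -> R) (hchi : cutoff chi)
  (p : 'rV[R]_3) (hp : sphere p)
  (U : set 'rV[R]_2) (x : 'rV[R]_2 -> 'rV[R]_3)
  (hx : round_coordinates p U x)
  (hU : square (2 * rho_star alpha k) `<=` U) :
  let f := phi alpha k b chi U x in
  let g := twisted_metric f in
  let offGamma := S2xS1 (R := R) `\` [set q | q.1 = p] in
  [/\ [/\ forall u, U u -> f (x u) = phi_loc alpha k b chi u,
          forall q, sphere q ->
            ~ (exists u, [/\ U u, x u = q
                           & dilate (rho_star alpha k) chi u != 0]) ->
            f q = 1,
          forall q, sphere q -> 0 < f q,
          riemannian g
        & C1holder_metric alpha g],
      smooth_metric_on offGamma g
    & (forall u i, `|partial i chi u| <= 2) ->
      scalar_ge_on offGamma g (5 / 8)].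
Proof.
move=> f g offGamma.
have a01 : 0 < alpha <= 1 by case/andP: halpha => -> /ltW.
have fpos q : 0 < f q := phi_gt0 k halpha hb hchi hx q.
have f0 q : f q != 0 by rewrite gt_eqF.
have [P [HP Pp xP]] := round_coordinates_rigid halpha hx hU.
(* Chart points always lie on S^2 x S^1, so removing Gamma only constrains the spherical part. *)
have dom (Q : 'M[R]_3) xi0 : orthogonal_mx Q -> chart_dom xi0 `&` chart Q @^-1` offGamma =
    chart_dom xi0 `&` [set u : 'rV[R]_3 | spherical Q (u 0 0) (u 0 1) <> p].
  move=> HQ; apply/seteqP; split=> u /= [Hu H]; split=> //; first by case: H.
  by split=> //; exact: sphere_chart.
have odom (Q : 'M[R]_3) xi0 : open (chart_dom xi0 `&`
    [set u : 'rV[R]_3 | spherical Q (u 0 0) (u 0 1) <> p]).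
  by apply: openI; [exact: open_chart_dom|exact: open_spherical_neq].
have CF (Q : 'M[R]_3) xi0 m : orthogonal_mx Q ->
    Ck_on m (chart_dom xi0 `&` [set u : 'rV[R]_3 | spherical Q (u 0 0) (u 0 1) <> p])
      (fun u => f (spherical Q (u 0 0) (u 0 1))).
  move=> HQ; apply: (Ck_F halpha hb hchi hx hU HP Pp xP HQ m (odom Q xi0)).
  by move=> u [].
split; first split.
- exact: (phi_param _ _ _ _ hx).
(* Off the image of [x] the value is 1 by extension; on it, the hypothesis makes the cutoff
   vanish. *)
- move=> q _ Hq; have [[u Uu E]|H] := pselect ((x @` U) q); last exact: phi_unparam.
  rewrite -E /f (phi_param _ _ _ _ hx Uu) /phi_loc.
  have [->|d0] := eqVneq (dilate (rho_star alpha k) chi u) 0.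
    by rewrite mulr0 mul0r addr0.
  by case: Hq; exists u.
- by move=> q _; exact: fpos.
- exact: twisted_metric_riemannian.
- move=> Q xi0 HQ i j; apply: C1holder_components => //; first exact: open_chart_dom.
  have [C H] := C1holder_F halpha hb hchi hx hU HP xP HQ.
  by split; [exact: Ck_sub C|move=> l u _; exact: H].
- move=> Q xi0 HQ i j m; rewrite dom //.
  by apply: Ck_components => //; exact: CF.
move=> dchi Q xi0 HQ u Hu Au.
have Du : (chart_dom xi0 `&` [set u : 'rV[R]_3 | spherical Q (u 0 0) (u 0 1) <> p]) u.
  by rewrite -dom.
have cD v : (chart_dom xi0 `&` [set u : 'rV[R]_3 | spherical Q (u 0 0) (u 0 1) <> p]) v ->
    cos (v 0 0) != 0.
  by case=> -[H _ _] _; rewrite gt_eqF // cos_gt0_small.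
rewrite (scalar_curvature_twisted (odom Q xi0) (CF Q xi0 2%N HQ) (fun v _ => f0 _) cD
  (fun v _ => partial_spherical_angle f Q v) (fun v _ => components_twisted f v HQ) Du).
have B := gradient_F_bound halpha hb hchi hx hU HP xP HQ dchi (cD u Du).
have B' := phi_ge k halpha hb hchi hx (spherical Q (u 0 0) (u 0 1)).
move: B B'; set X := _ + _; set Y := f _; move=> B B'.
have : (3 / 4) ^+ 2 <= Y ^+ 2 by rewrite ler_sqr ?nnegrE ?divr_ge0 // ltW // fpos.
move: X Y B {B'} => X Y; lra.
Qed.
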